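(* Let $f\in\mathbf F(w,y,\kappa,\lambda,u,\omega,\omega')$, $n\in\mathbb N$, and assume that $$\min\big(n-w,\ u+\lfloor\lambda\rfloor\big)>\kappa+\iota',\qquad\tilde\lambda=\min(\kappa-\rho_p(y),\lambda)>0.$$ Let $$\hat{\mathbf e}_f(s)=\sum_{m\bmod p^{n-w}}e\left(\frac{f(m)p^{-w}-sm}{p^{n-w}}\right),$$ let $\varepsilon_\lambda=\lfloor\lambda\rfloor-\lceil\tilde\lambda\rceil$, and let $\tilde g_0=f'(0)p^{-w}-\omega'\in\mathbb Z_p$. In the case $p\in\{2,3\}$ assume additionally the following: let $\nu\in\{0,1\}$ be the residue of $n-w+\iota'+\kappa-\iota'(2)$ modulo $2$, let $n_1=n-w-\kappa-\iota'-1$, and let $\kappa_1$ be defined by $\kappa+\iota'(y+1)=\nu+2\iota'(2)+\kappa_1$; then assume $$\kappa+\iota'(y+1)\ge\nu+2\iota'(2),\qquad n_1\ge2\iota'(2)\nu,\qquad n_1+\kappa_1\ge\iota'(3).$$ (These additional assumptions are automatically satisfied if $\kappa\ge1+\iota'(4)$ and $n-w>\iota'+\kappa+\iota'(12)$, or if $\kappa\ge1+\iota'(12)$ and $n-w>\iota'+\kappa+\iota'(4)$.) Then there exist a power series $\breve f\in\mathbf F(\breve w,y^{-1},\kappa,\tilde\lambda,\breve u,1,-\omega'\omega^{-1})$ with $\breve f'\in p^{w+\iota'+\kappa}\mathbf I^n_0[\tilde\lambda](\mathbb Z_p)$, where $$\breve w=w+\mathrm{ord}_py,\qquad\breve u=u+\varepsilon_\lambda-\mathrm{ord}_py,$$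 and an $\epsilon\in\mathbb C$, $|\epsilon|=1$, such that $$\hat{\mathbf e}_f(s)=\hat{\mathbf e}_f\Big(\tilde g_0+\omega'\big(1+p^{\iota'+\kappa}t\big)\Big)=\epsilon\,p^{(n-w+\iota'+\kappa)/2}\,e\left(\frac{\breve f(t)}{p^n}\right)$$ if $s=\tilde g_0+\omega'\big(1+p^{\iota'+\kappa}t\big)$ for some $t\in\mathbb Z_p$, and $\hat{\mathbf e}_f(s)=0$ otherwise (here $s\in\mathbb Z_p$). The unit $\epsilon$ depends only on $\omega$, $\omega'$, $y$, $p$, the parity of $n-w+\iota'+\kappa-\iota'(2)$, and, for $p=2$ only, on $p^{u-\kappa-\iota'}g'(0)$ (with $g$ as in the definition of the class of $f$); in particular, it is independent of $s$.
   Context: $p$ is a prime, $\mathbb N=\{1,2,\dots\}$, $\rho_p=1/(p-1)$. $e(x)=e^{2\pi i x}$, also extended from $\mathbb Z[1/p]$ to the unique $\mathbb Z_p$-periodic function on $\mathbb Q_p$. For a positive rational $y$: $\iota(y)=\max(0,-\mathrm{ord}_py)$, $\iota'(y)=\max(0,\mathrm{ord}_py)$; $\iota,\iota'$ without argument mean $\iota(y),\iota'(y)$. $\rho_p(y)=\rho_p$ if $\mathrm{ord}_py\ne0$ and $\rho_p(y)=0$ otherwise. $\mathbf I_0(\mathbb Z_p)$ is the set of power series $\sum_{k\ge0}a_kt^k$ with $a_k\in\mathbb Z_p$, $|a_k|_p\to0$; for real $\lambda\ge0$, $\mathbf I_0[\lambda](\mathbb Z_p)=\{a\in\mathbf I_0(\mathbb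 Z_p):\mathrm{ord}_pa_k\ge\lceil k\lambda\rceil\ \forall k\ge0\}$ and $\mathbf I^n_0[\lambda](\mathbb Z_p)=t\,\mathbf I_0[\lambda](\mathbb Z_p)$ (the superscript $n$ here is just a label). $(1+x)^y=\sum_k\binom ykx^k$. Let $w\in\mathbb Z$, $u,\kappa\in\mathbb N$ with $\kappa\ge1+\iota'(2)$, $\lambda\in\rho_p\mathbb N$, $y\in\mathbb Q^+$, $\omega,\omega'\in\mathbb Z_p^\times$. A power series $f\in\mathbb Q_p^\times\mathbf I_0(\mathbb Z_p)$ belongs to $\mathbf F(w,y,\kappa,\lambda,u,\omega,\omega')$ if $f'(t)=p^w\omega'(1+p^{\iota(y)+\kappa}\omega t)^{-y}+p^w\gamma_0+p^{u+w}g(t)$ for some $\gamma_0\in\mathbb Z_p$ and $g\in\mathbf I_0[\lambda](\mathbb Z_p)$. For such $f$ and $n\ge w$, $m\mapsto e(f(m)/p^n)$ is $p^{n-w}$-periodic on $\mathbb Z$. *)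

(* Defs.v *)
From HB Require Import structures.
From mathcomp Require Import all_boot all_order all_algebra.
From mathcomp Require Import all_classical all_reals all_analysis.
From mathcomp Require Import fraction complex zify.
Set Implicit Arguments.
Unset Strict Implicit.
Unset Printing Implicit Defensive.
Import Order.TTheory GRing.Theory Num.Theory.
Local Open Scope ring_scope.

(* Z_p is the inverse limit of the rings Z/p^n; a class mod p^n is represented
   by its residue in [0, p^n), which the compatibility condition enforces. The
   proof of primality is a parameter of the type so that Z_p is canonically an
   integral domain and Q_p, its field of fractions, a field. *)
Record padic_int (p : nat) (p_pr : prime p) : Type := PadicInt {
  residue :> nat -> int;
  _ : forall n, residue n = (residue n.+1 %% (p ^ n)%N%:Z)%Z
}.

Section PadicIntRing.
Variables (p : nat) (p_pr : prime p).
Local Notation Zp := (padic_int p_pr).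
Implicit Types x y z : Zp.

HB.instance Definition _ := gen_eqMixin Zp.
HB.instance Definition _ := gen_choiceMixin Zp.

Lemma residueS x n : x n = (x n.+1 %% (p ^ n)%N%:Z)%Z.
Proof. by case: x. Qed.

Lemma residue_mod x n : (x n %% (p ^ n)%N%:Z)%Z = x n.
Proof. by rewrite residueS modz_mod. Qed.

Lemma padic_int_ext x y : (forall n, x n = y n) -> x = y.
Proof.
case: x y => [f fP] [g gP] /= /funext fg; move: fP gP; rewrite fg => fP gP.
by congr PadicInt; exact: Prop_irrelevance.
Qed.

Lemma modz_mod_expS (a : int) n :
  ((a %% (p ^ n.+1)%N%:Z)%Z %% (p ^ n)%N%:Z)%Z = (a %% (p ^ n)%N%:Z)%Z.
Proof.
rewrite {2}(divz_eq a (p ^ n.+1)%N%:Z) expnS PoszM mulrA.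
by rewrite modzMDl.
Qed.

Lemma padic_of_compat (F : nat -> int) :
  (forall n, (F n.+1 %% (p ^ n)%N%:Z)%Z = (F n %% (p ^ n)%N%:Z)%Z) ->
  forall n, (F n %% (p ^ n)%N%:Z)%Z
    = ((F n.+1 %% (p ^ n.+1)%N%:Z)%Z %% (p ^ n)%N%:Z)%Z.
Proof. by move=> FP n; rewrite modz_mod_expS FP. Qed.

Definition padic_of F FP : Zp := PadicInt p_pr (@padic_of_compat F FP).

Fact padic_const_compat (a : int) n :
  (a %% (p ^ n)%N%:Z)%Z = (a %% (p ^ n)%N%:Z)%Z.
Proof. by []. Qed.

Fact padic_opp_compat x n :
  (- x n.+1 %% (p ^ n)%N%:Z)%Z = (- x n %% (p ^ n)%N%:Z)%Z.
Proof. by rewrite [x n]residueS modzNm. Qed.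

Fact padic_add_compat x y n :
  ((x n.+1 + y n.+1) %% (p ^ n)%N%:Z)%Z = ((x n + y n) %% (p ^ n)%N%:Z)%Z.
Proof. by rewrite [x n]residueS [y n]residueS modzDm. Qed.

Fact padic_mul_compat x y n :
  ((x n.+1 * y n.+1) %% (p ^ n)%N%:Z)%Z = ((x n * y n) %% (p ^ n)%N%:Z)%Z.
Proof. by rewrite [x n]residueS [y n]residueS modzMm. Qed.

Definition padic_const a : Zp := padic_of (padic_const_compat a).
Definition padic_opp x : Zp := padic_of (padic_opp_compat x).
Definition padic_add x y : Zp := padic_of (padic_add_compat x y).
Definition padic_mul x y : Zp := padic_of (padic_mul_compat x y).

Fact padic_addA : associative padic_add.
Proof. by move=> x y z; apply: padic_int_ext => n /=; rewrite modzDml modzDmr addrA. Qed.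

Fact padic_addC : commutative padic_add.
Proof. by move=> x y; apply: padic_int_ext => n /=; rewrite addrC. Qed.

Fact padic_add0 : left_id (padic_const 0) padic_add.
Proof. by move=> x; apply: padic_int_ext => n /=; rewrite mod0z add0r residue_mod. Qed.

Fact padic_addN : left_inverse (padic_const 0) padic_opp padic_add.
Proof. by move=> x; apply: padic_int_ext => n /=; rewrite modzDml addNr. Qed.

HB.instance Definition _ :=
  GRing.isZmodule.Build Zp padic_addA padic_addC padic_add0 padic_addN.

Fact padic_mulA : associative padic_mul.
Proof. by move=> x y z; apply: padic_int_ext => n /=; rewrite modzMml modzMmr mulrA. Qed.

Fact padic_mulC : commutative padic_mul.
Proof. by move=> x y; apply: padic_int_ext => n /=; rewrite mulrC. Qed.

Fact padic_mul1 : left_id (padic_const 1) padic_mul.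
Proof. by move=> x; apply: padic_int_ext => n /=; rewrite modzMml mul1r residue_mod. Qed.

Fact padic_mulD : left_distributive padic_mul padic_add.
Proof.
by move=> x y z; apply: padic_int_ext => n /=; rewrite modzMml modzDm mulrDl.
Qed.

Fact padic_1neq0 : padic_const 1 != 0.
Proof.
apply/eqP => /(congr1 (fun x : Zp => x 1%N)) /=.
by rewrite mod0z expn1 modz_small //= ltz_nat prime_gt1.
Qed.

HB.instance Definition _ := GRing.Zmodule_isComNzRing.Build Zp
  padic_mulA padic_mulC padic_mul1 padic_mulD padic_1neq0.

Definition padic_unit : {pred Zp} := fun x => `[< exists y, y * x = 1 >].

Definition padic_inv x : Zp :=
  if pselect (exists y, y * x = 1) is left e then projT1 (cid e) else x.

Fact padic_mulV : {in padic_unit, left_inverse 1 padic_inv *%R}.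
Proof.
move=> x /asboolP ex; rewrite /padic_inv; case: pselect => // e.
by case: (cid e).
Qed.

Fact padic_unitP x y : y * x = 1 -> padic_unit x.
Proof. by move=> yx1; apply/asboolP; exists y. Qed.

Fact padic_inv_out : {in [predC padic_unit], padic_inv =1 id}.
Proof.
by move=> x /asboolP nex; rewrite /padic_inv; case: pselect.
Qed.

HB.instance Definition _ := GRing.ComNzRing_hasMulInverse.Build Zp
  padic_mulV padic_unitP padic_inv_out.

Lemma residue_neq0 x : x != 0 -> exists n, x n != 0.
Proof.
apply: contra_neqP => /forallNP x0; apply: padic_int_ext => n.
by have /negP := x0 n; rewrite negbK => /eqP ->; rewrite /= mod0z.
Qed.

Lemma residue_add x n m : (x (n + m)%N %% (p ^ n)%N%:Z)%Z = x n.
Proof.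
elim: m => [|m IH]; first by rewrite addn0 residue_mod.
rewrite -[RHS]IH [x (n + m)%N]residueS -addnS expnD PoszM.
set a := x _; rewrite [in LHS](divz_eq a ((p ^ n)%N%:Z * (p ^ m)%N%:Z)).
by rewrite [(p ^ n)%N%:Z * _]mulrC mulrA modzMDl.
Qed.

Fact padic_integral x y : x * y = 0 -> (x == 0) || (y == 0).
Proof.
move=> xy0; apply/norP => -[/residue_neq0[n xn] /residue_neq0[m ym]].
have /(congr1 (fun z : Zp => z (n + m)%N)) /= := xy0; rewrite mod0z => /eqP.
apply/negP; rewrite -(residue_add x n m) in xn.
rewrite -(residue_add y m n) [(m + n)%N]addnC in ym.
move: (x _) (y _) xn ym => a b.
rewrite !(sameP eqP dvdz_mod0P) !dvdzE abszM /= => pa pb.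
have a0 : (0 < `|a|)%N by rewrite lt0n; apply: contraNneq pa => ->.
have b0 : (0 < `|b|)%N by rewrite lt0n; apply: contraNneq pb => ->.
move: pa pb; rewrite !pfactor_dvdn ?muln_gt0 ?a0 // lognM //.
by move: (logn _ _) (logn _ _) => i j; lia.
Qed.

HB.instance Definition _ :=
  GRing.ComUnitRing_isIntegral.Build Zp padic_integral.

End PadicIntRing.

Definition padic (p : nat) (p_pr : prime p) : Type := {fraction padic_int p_pr}.

HB.instance Definition _ (p : nat) (p_pr : prime p) :=
  GRing.Field.on (padic p_pr).

Definition padic_of_int (p : nat) (p_pr : prime p) (z : padic_int p_pr)
  : padic p_pr := tofrac z.

Notation "z %:Qp" := (padic_of_int z)
  (at level 1, left associativity, format "z %:Qp") : ring_scope.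

(* ord_p x >= m, with ord_p 0 = +oo; for m = 0 this says that x lies in Z_p. *)
Definition ord_ge (p : nat) (p_pr : prime p) (m : int) (x : padic p_pr) : Prop :=
  exists z : padic_int p_pr, x = (p%:R : padic p_pr) ^ m * z%:Qp.

Section RationalOrder.
Variable p : nat.
Implicit Types y : rat.

Definition ordq y : int := (logn p `|numq y|)%:Z - (logn p `|denq y|)%:Z.

Definition iota_p y : int := Num.max 0 (- ordq y).

Definition iotap y : int := Num.max 0 (ordq y).

Definition rho (R : realType) : R := (p%:R - 1)^-1.

Definition rho_at (R : realType) y : R := if ordq y != 0 then rho R else 0.

End RationalOrder.

(* A power series in one variable is its sequence of coefficients. *)
Section PowerSeries.
Variables (p : nat) (p_pr : prime p).
Local Notation Zp := (padic_int p_pr).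
Local Notation Qp := (padic p_pr).
Implicit Types (a b f : nat -> Qp) (x c : Qp).

Definition ps_deriv f : nat -> Qp := fun k => f k.+1 *+ k.+1.

(* (1 + c t) ^ z, with binomial coefficients z (z - 1) ... (z - k + 1) / k! *)
Definition gbinom (z : rat) (k : nat) : rat :=
  (\prod_(i < k) (z - i%:R)) / k`!%:R.

Definition ps_binom (z : rat) c : nat -> Qp :=
  fun k => ratr (gbinom z k) * c ^+ k.

(* The value is a junk value where the series diverges. *)
Definition ps_eval f x : Qp :=
  xget 0 [set v : Qp | forall N : nat, exists K : nat, forall k, (K <= k)%N ->
    ord_ge N (v - \sum_(i < k) f i * x ^+ i)]%classic.

Definition I0 a : Prop :=
  (forall k, ord_ge 0 (a k)) /\
  (forall N : nat, exists K : nat, forall k, (K <= k)%N -> ord_ge N (a k)).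

Definition scaled_I0 f : Prop :=
  exists2 c, c != 0 & exists2 a, I0 a & forall k, f k = c * a k.

Variable R : realType.
Implicit Types lam : R.

Definition I0_lam lam a : Prop :=
  I0 a /\ forall k, ord_ge (Num.ceil (k%:R * lam)) (a k).

Definition tI0_lam lam b : Prop :=
  exists2 a, I0_lam lam a & b 0%N = 0 /\ forall k, b k.+1 = a k.

(* The parameters kappa and u are positive; u is kept in int because the
   transformed class has a parameter u obtained by subtraction. *)
Definition F_params (y : rat) (kappa : nat) (lam : R) (u : int) (om om' : Zp)
    : Prop :=
  [/\ (0 < kappa)%N /\ 1 + iotap p 2 <= kappa%:Z,
      0 < u,
      exists2 j : nat, (0 < j)%N & lam = j%:R * rho p R,
      0 < y
    & om \is a GRing.unit /\ om' \is a GRing.unit].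

Definition F_decomp (w : int) (y : rat) (kappa : nat) (lam : R) (u : int)
    (om om' : Zp) (f : nat -> Qp) (gamma0 : Zp) (g : nat -> Qp) : Prop :=
  [/\ F_params y kappa lam u om om',
      scaled_I0 f,
      I0_lam lam g
    & forall k, ps_deriv f k =
        p%:R ^ w * om'%:Qp
          * ps_binom (- y) (p%:R ^ (iota_p p y + kappa%:Z) * om%:Qp) k
        + (if k == 0%N then p%:R ^ w * gamma0%:Qp else 0)
        + p%:R ^ (u + w) * g k].

Definition F_class (w : int) (y : rat) (kappa : nat) (lam : R) (u : int)
    (om om' : Zp) (f : nat -> Qp) : Prop :=
  exists gamma0 g, F_decomp w y kappa lam u om om' f gamma0 g.

Local Open Scope complex_scope.

Definition expi2pi (x : R) : R[i] := cos (2 * pi * x) +i* sin (2 * pi * x).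

(* e(x) for x in Q_p is e(r) for any r in Z[1/p] congruent to x modulo Z_p. *)
Definition padic_e x : R[i] :=
  expi2pi (ratr (xget 0 [set r : rat |
    (exists (a : int) (k : nat), r = a%:~R / p%:R ^+ k) /\
    ord_ge 0 (x - ratr r)]%classic)).

(* The sum over m mod p^(n - w) is taken over 0 <= m < p^(n - w); it is used
   only when n > w. *)
Definition hat_e f (w : int) (n : nat) (s : Qp) : R[i] :=
  \sum_(m < p ^ `|n%:Z - w|%N)
    padic_e ((ps_eval f m%:R * p%:R ^ (- w) - s * m%:R) / p%:R ^ (n%:Z - w)).

End PowerSeries.

Section SmallPrimes.
Variables (p : nat) (w : int) (n : nat) (y : rat) (kappa : nat).

Definition parity : int :=
  ((n%:Z - w + iotap p y + kappa%:Z - iotap p 2) %% 2)%Z.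

Definition small_prime_cond : Prop :=
  let n1 := n%:Z - w - kappa%:Z - iotap p y - 1 in
  let kappa1 := kappa%:Z + iotap p (y + 1) - parity - 2 * iotap p 2 in
  [/\ parity + 2 * iotap p 2 <= kappa%:Z + iotap p (y + 1),
      2 * iotap p 2 * parity <= n1
    & iotap p 3 <= n1 + kappa1].

End SmallPrimes.

(* Main.v *)
Require Import Defs.
From HB Require Import structures.
From mathcomp Require Import all_boot all_order all_algebra.
From mathcomp Require Import all_classical all_reals all_analysis.
From mathcomp Require Import fraction complex zify ring lra.
Set Implicit Arguments.
Unset Strict Implicit.
Unset Printing Implicit Defensive.
Import Order.TTheory GRing.Theory Num.Theory.
Local Open Scope ring_scope.

(* Put a = iota'(y) + kappa. Up to the factor p^w, the phase f(m) - p^w s m has derivative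
   slope0 - s + p^a B(m), where B(t) = b_1 t + b_2 t^2 + ... has a unit b_1 and
   ord b_k >= (k - 1) lamt. Splitting off the top p-adic digits of m, on which the phase is
   affine, shows that the sum vanishes unless s = slope0 + om' p^a t. In that case the critical
   point is x(t) with B(x(t)) = om' t: a compositional inverse, which obeys the same weight
   bounds as B, and which for g = 0 is the binomial series (1 + c t)^(-1/y) up to scaling.
   The critical value, as a function of t, is the transformed series, whose derivative is
   proportional to x(t). After translating the critical point to 0, what remains is a quadratic
   Gauss sum modulo p^(n-w-a), in which the terms of degree at least 3 are negligible; only its
   parity and the leading coefficient b_1, modulo a small power of p, matter. *)

(** * p-adic integers and numbers *)

(** Power series are never composed as such. Only values modulo p^n at natural numbers enter the
    sum, so f is cut off at a degree K depending on n, and the critical point is replaced by a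
    natural number close to it. The formal identities then hold modulo 'X^K; from there on
    coefficients are negligible, because the weight k lamt grows linearly while the denominators k +
    1 met on integrating have logarithmic order. The minimum in lamt reflects the two parts of f':
    the binomial part loses ord(k!) < k/(p - 1) unless y is a p-adic unit, and the part g
    contributes lam. The inequality u + floor lam > a makes the share of g in b_1 divisible by p, so
    that b_1 stays a unit; n - w > a leaves a nontrivial modulus p^(n-w-a). Small primes interfere
    twice. At p = 2 the second Taylor coefficient has a denominator 2, so that for n - w - a even a
    quadratic term survives and b_1 matters modulo 8. When n - w - a = 1 the variable supplies no
    power of p, and the terms of degree at least 3 must be small through their coefficients
    alone. *)

Section PadicBasics.
Variables (p : nat) (p_pr : prime p).
Local Notation Zp := (padic_int p_pr).
Local Notation Qp := (padic p_pr).
Implicit Types (z : Zp) (x y : Qp) (m k : int) (n : nat).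

Lemma residue_nat i n : (i%:R : Zp) n = (i%:Z %% (p ^ n)%N%:Z)%Z.
Proof.
elim: i => [|i IH]; first by [].
by rewrite -addn1 natrD PoszD /= IH modzDm.
Qed.

Lemma residue_exprp_mul z i n :
  ((p%:R ^+ i : Zp) * z) n = ((p ^ i)%N%:Z * z n %% (p ^ n)%N%:Z)%Z.
Proof. by rewrite -natrX /= residue_nat modzMml. Qed.

Lemma expnz_gt0 n : 0 < (p ^ n)%N%:Z :> int.
Proof. by rewrite ltz_nat expn_gt0 prime_gt0. Qed.

(** The quotient shifts digits by [n] places: its residue of index i is z(n+i)/p^n, and
    compatibility is checked after multiplying back by p^n. *)
Lemma padic_int_dvd z n : z n = 0 -> exists z', z = p%:R ^+ n * z'.
Proof.
move=> zn0; pose F i := (z (n + i)%N %/ (p ^ n)%N%:Z)%Z.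
have pn0 := gt_eqF (expnz_gt0 n).
have zF i : z (n + i)%N = F i * (p ^ n)%N%:Z.
  by rewrite {1}(divz_eq (z (n + i)%N) (p ^ n)%N%:Z) residue_add zn0 addr0.
have FP i : (F i.+1 %% (p ^ i)%N%:Z)%Z = (F i %% (p ^ i)%N%:Z)%Z.
  apply/eqP; rewrite eqz_mod_dvd -(@dvdz_mul2r (p ^ n)%N%:Z) ?pn0//.
  rewrite -PoszM -expnD addnC mulrBl -!zF -eqz_mod_dvd addnS.
  by rewrite -residueS residue_mod.
exists (padic_of p_pr FP); apply: padic_int_ext => i.
rewrite residue_exprp_mul/= -(residue_add z i n) addnC zF.
by rewrite modzMmr mulrC.
Qed.

Lemma padic_int_approx z n : exists i : nat, exists z', z = i%:R + p%:R ^+ n * z'.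
Proof.
exists `|z n|%N.
have zn0 : 0 <= z n by rewrite residueS modz_ge0 // gt_eqF ?expnz_gt0.
have [|z' zE] := @padic_int_dvd (z - `|z n|%:R) n; last first.
  by exists z'; rewrite -zE addrC subrK.
have e : z n - z n = 0 by rewrite subrr.
by rewrite /= residue_nat modzNm gez0_abs// modzDmr e mod0z.
Qed.

(** Bezout inverses modulo each p^n are chosen independently; they are compatible because an inverse
    modulo p^n is unique, [z n] being prime to p. *)
Lemma padic_int_unit z : z 1%N != 0 -> z \is a GRing.unit.
Proof.
move=> z1; have zp n : coprimez (z n) (p ^ n)%N%:Z.
  case: n => [|n]; first by rewrite coprimezE/= coprimen1.
  rewrite coprimezE/= coprimeXr// coprime_sym prime_coprime//.
  apply: contra z1 => pz; apply/eqP; rewrite -(residue_add z 1 n) add1n expn1.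
  exact/dvdz_mod0P.
have inv n : exists u : int, (u * z n == 1 %[mod (p ^ n)%N%:Z])%Z.
  have /coprimezP[[u v] /= uv] := zp n.
  by exists u; rewrite -uv addrC modzMDl.
pose F n := xchoose (inv n).
have FE n : (F n * z n = 1 %[mod (p ^ n)%N%:Z])%Z := eqP (xchooseP (inv n)).
have FP n : (F n.+1 %% (p ^ n)%N%:Z)%Z = (F n %% (p ^ n)%N%:Z)%Z.
  have e : (F n.+1 * z n = 1 %[mod (p ^ n)%N%:Z])%Z.
    rewrite [z n]residueS modzMmr.
    by have /(congr1 (fun a => a %% (p ^ n)%N%:Z)%Z) := FE n.+1; rewrite !modz_mod_expS.
  apply/eqP; rewrite eqz_mod_dvd -(@Gauss_dvdzl _ _ (z n)).
    by rewrite mulrBl -eqz_mod_dvd e FE.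
  by rewrite coprimez_sym zp.
apply/unitrPr; exists (padic_of p_pr FP); apply: padic_int_ext => n.
by rewrite /= modzMmr mulrC FE.
Qed.

Lemma padic_int_residue0 z : z 0%N = 0.
Proof. by rewrite residueS expn0 modz1. Qed.

Lemma padic_int_unitP z : (exists z', z = p%:R * z') \/ z \is a GRing.unit.
Proof.
have [z1|z1] := eqVneq (z 1%N) 0; last by right; exact: padic_int_unit.
by left; have [z' ->] := padic_int_dvd z1; exists z'; rewrite expr1.
Qed.

Lemma padic_int_factor z : z != 0 ->
  exists n u, u \is a GRing.unit /\ z = p%:R ^+ n * u.
Proof.
move=> z0; have ex : exists n, z n != 0 by exact: residue_neq0.
case: (ex_minnP ex) => -[|n] zn nmin; first by rewrite padic_int_residue0 in zn.
have /eqP zn0 : z n == 0 by apply/negPn/negP => /nmin; rewrite ltnn.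
have [u uE] := padic_int_dvd zn0; exists n, u; split=> //.
apply: padic_int_unit; apply: contra zn => /eqP u1.
have [v vE] := padic_int_dvd u1.
by rewrite uE vE mulrA -exprD addn1 residue_exprp_mul mulrC modzMl.
Qed.

Lemma padic_of_int_is_zmod_morphism : zmod_morphism (@padic_of_int p p_pr).
Proof. by move=> z z'; rewrite /padic_of_int tofracB. Qed.

HB.instance Definition _ := GRing.isZmodMorphism.Build Zp Qp
  (@padic_of_int p p_pr) padic_of_int_is_zmod_morphism.

Lemma padic_of_int_is_monoid_morphism : monoid_morphism (@padic_of_int p p_pr).
Proof. by split=> [|z z']; rewrite /padic_of_int ?tofracM. Qed.

HB.instance Definition _ := GRing.isMonoidMorphism.Build Zp Qp
  (@padic_of_int p p_pr) padic_of_int_is_monoid_morphism.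

Lemma padic_of_int_inj : injective (@padic_of_int p p_pr).
Proof. by move=> z z' /eqP; rewrite tofrac_eq => /eqP. Qed.

Lemma padic_natr_eq0 n : (n%:R == 0 :> Qp) = (n == 0%N).
Proof.
rewrite -(rmorph_nat (@padic_of_int p p_pr)) -(rmorph0 (@padic_of_int p p_pr)).
rewrite (inj_eq padic_of_int_inj); apply/eqP/eqP => [|->//].
(* The residue of level [n] already detects n, because n < p^n. *)
move/(congr1 (fun z : Zp => z n)); rewrite residue_nat /= mod0z modz_small.
  by move=> [].
by rewrite ltz_nat ltn_expl ?prime_gt1.
Qed.

Lemma padic_p_neq0 : (p%:R : Qp) != 0.
Proof. by rewrite padic_natr_eq0 -lt0n prime_gt0. Qed.

Lemma padic_fracP x : exists z z', z' != 0 /\ x = z%:Qp / z'%:Qp.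
Proof.
rewrite /padic_of_int; elim/quotW: x => r; exists (frac r).1, (frac r).2.
have d0 := denom_ratioP r; split => //.
have d0' : FracField.tofrac (frac r).2 != 0 by rewrite tofrac_eq0.
apply: (canRL (mulfK d0')); unlock FracField.tofrac.
rewrite -[LHS]FracField.pi_mul; apply/eqmodP; rewrite /= FracField.equivfE.
rewrite /FracField.mulf !numden_Ratio ?mulr1 ?oner_neq0//.
by rewrite mulrC.
Qed.

Lemma padic_intr_eq0 (a : int) : (a%:~R == 0 :> Qp) = (a == 0).
Proof. by case: a => a; rewrite ?NegzE ?mulrNz ?oppr_eq0 padic_natr_eq0. Qed.

Lemma padic_ratr_frac (a b : int) : b != 0 ->
  ratr (a%:~R / b%:~R) = a%:~R / b%:~R :> Qp.
Proof.
move=> b0; set r : rat := _ / _.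
have : (numq r * b)%:~R = (a * denq r)%:~R :> rat.
  by rewrite !rmorphM/= numqE /r mulrAC divfK ?intr_eq0.
move/intr_inj/(congr1 (fun c : int => c%:~R : Qp)); rewrite !rmorphM/= => e.
by rewrite /ratr; apply/eqP; rewrite eqr_div ?padic_intr_eq0 ?denq_eq0// e.
Qed.

Lemma padic_ratr_is_zmod_morphism : zmod_morphism (ratr : rat -> Qp).
Proof.
move=> r s; have d0 (t : rat) : (denq t)%:~R != 0 :> Qp by rewrite padic_intr_eq0 denq_eq0.
have dr0 (t : rat) : (denq t)%:~R != 0 :> rat by rewrite intr_eq0 denq_eq0.
have -> : r - s = (numq r * denq s - numq s * denq r)%:~R / (denq r * denq s)%:~R.
  rewrite rmorphB !rmorphM/= -mulNr -addf_div ?dr0// mulNr.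
  by rewrite !divq_num_den.
rewrite padic_ratr_frac ?mulf_neq0 ?denq_eq0// /ratr rmorphB !rmorphM/=.
by rewrite -[- (_ / _)]mulNr addf_div ?d0// mulNr.
Qed.

Lemma padic_ratr_is_monoid_morphism : monoid_morphism (ratr : rat -> Qp).
Proof.
split=> [|r s]; first by rewrite /ratr divr1.
have -> : r * s = (numq r * numq s)%:~R / (denq r * denq s)%:~R.
  by rewrite !rmorphM/= invfM mulrACA !divq_num_den.
rewrite padic_ratr_frac ?mulf_neq0 ?denq_eq0// /ratr !rmorphM/=.
by rewrite invfM mulrACA.
Qed.

(* [ratr] itself is already the key of a canonical morphism, into numeric fields. *)
Definition padic_of_rat : rat -> Qp := ratr.

HB.instance Definition _ := GRing.isZmodMorphism.Build rat Qp
  padic_of_rat padic_ratr_is_zmod_morphism.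
HB.instance Definition _ := GRing.isMonoidMorphism.Build rat Qp
  padic_of_rat padic_ratr_is_monoid_morphism.

Lemma padic_ratrE r : ratr r = padic_of_rat r. Proof. by []. Qed.

Local Notation P := (p%:R : Qp).

Lemma padic_expzD m k : P ^ (m + k) = P ^ m * P ^ k.
Proof. by rewrite expfzDr// padic_p_neq0. Qed.

Lemma padic_expz_neq0 m : P ^ m != 0.
Proof. by rewrite expfz_neq0// padic_p_neq0. Qed.

Lemma padic_expzNr m : P ^ (- m) * P ^ m = 1.
Proof. by rewrite -padic_expzD addNr expr0z. Qed.

Lemma ord_ge_Zp z : ord_ge 0 z%:Qp.
Proof. by exists z; rewrite expr0z mul1r. Qed.

Lemma ord_ge0P x : ord_ge 0 x -> exists z, x = z%:Qp.
Proof. by case=> z ->; exists z; rewrite expr0z mul1r. Qed.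

Lemma ord_ge_nat n : ord_ge 0 (n%:R : Qp).
Proof. by rewrite -(rmorph_nat (@padic_of_int p p_pr)); exact: ord_ge_Zp. Qed.

Lemma ord_geM m k x y : ord_ge m x -> ord_ge k y -> ord_ge (m + k) (x * y).
Proof.
move=> [z ->] [z' ->]; exists (z * z').
by rewrite padic_expzD rmorphM/= mulrACA.
Qed.

Lemma ord_ge_expz m : ord_ge m (P ^ m).
Proof. by exists 1; rewrite rmorph1 mulr1. Qed.

Lemma ord_geW m k x : k <= m -> ord_ge m x -> ord_ge k x.
Proof.
move=> km [z ->]; have [n ->] : exists n : nat, m = k + n%:Z.
  by exists `|m - k|%N; lia.
by exists (p%:R ^+ n * z); rewrite padic_expzD rmorphM rmorphXn rmorph_nat mulrA.
Qed.

Lemma ord_ge0r m : ord_ge m (0 : Qp).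
Proof. by exists 0; rewrite rmorph0 mulr0. Qed.

Lemma ord_geD m x y : ord_ge m x -> ord_ge m y -> ord_ge m (x + y).
Proof. by move=> [z ->] [z' ->]; exists (z + z'); rewrite rmorphD/= mulrDr. Qed.

Lemma ord_geN m x : ord_ge m x -> ord_ge m (- x).
Proof. by move=> [z ->]; exists (- z); rewrite rmorphN/= mulrN. Qed.

Lemma ord_geB m x y : ord_ge m x -> ord_ge m y -> ord_ge m (x - y).
Proof. by move=> mx my; apply: ord_geD => //; exact: ord_geN. Qed.

Lemma ord_ge_sum m (I : Type) (r : seq I) (Q : pred I) (F : I -> Qp) :
  (forall i, Q i -> ord_ge m (F i)) -> ord_ge m (\sum_(i <- r | Q i) F i).
Proof.
by move=> FP; elim/big_ind: _ => //; [exact: ord_ge0r|exact: ord_geD].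
Qed.

Lemma ord_geMZp m x y : ord_ge m x -> ord_ge 0 y -> ord_ge m (x * y).
Proof. by move=> mx y0; rewrite -(addr0 m); exact: ord_geM. Qed.

Lemma ord_geZpM m x y : ord_ge 0 x -> ord_ge m y -> ord_ge m (x * y).
Proof. by move=> x0 my; rewrite mulrC; exact: ord_geMZp. Qed.

Lemma ord_geX x n : ord_ge 0 x -> ord_ge 0 (x ^+ n).
Proof.
move=> x0; elim: n => [|n IH]; first exact: (ord_ge_nat 1).
by rewrite exprS; exact: ord_geMZp.
Qed.

Lemma ord_geMn m x n : ord_ge m x -> ord_ge m (x *+ n).
Proof. by move=> mx; rewrite -mulr_natr; apply: ord_geMZp => //; exact: ord_ge_nat. Qed.

Lemma ord_ge_expzM m k x : ord_ge m (P ^ k * x) <-> ord_ge (m - k) x.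
Proof.
split=> [|H]; last first.
  by rewrite -(subrK k m) addrC; apply: ord_geM => //; exact: ord_ge_expz.
move/(ord_geM (ord_ge_expz (- k))).
by rewrite mulrA padic_expzNr mul1r addrC.
Qed.

Lemma ord_ge_nat_dvd n (k : nat) : ord_ge n%:Z (k%:R : Qp) <-> (p ^ n %| k)%N.
Proof.
split=> [[z]|/dvdnP[l ->]]; last first.
  by rewrite natrM natrX; apply: ord_geZpM; [exact: ord_ge_nat|exact: (ord_ge_expz n)].
rewrite -(rmorph_nat (@padic_of_int p p_pr) k) -exprnP.
rewrite -(rmorph_nat (@padic_of_int p p_pr) p) -rmorphXn -rmorphM.
move/padic_of_int_inj/(congr1 (fun z : Zp => z n)).
rewrite residue_exprp_mul residue_nat mulrC modzMl.
by move/dvdz_mod0P; rewrite dvdzE.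
Qed.

Lemma padic_of_intV (u : Zp) : u \is a GRing.unit -> (u^-1)%:Qp = u%:Qp^-1.
Proof. by move=> uu; rewrite rmorphV. Qed.

Lemma padic_factor x : x != 0 ->
  exists m u, u \is a GRing.unit /\ x = P ^ m * u%:Qp.
Proof.
have [z [z' [z'0 ->]]] := padic_fracP x.
have [->|z0 _] := eqVneq z 0; first by rewrite rmorph0 mul0r eqxx.
have [n [u [uu ->]]] := padic_int_factor z0.
have [n' [u' [uu' ->]]] := padic_int_factor z'0.
exists (n%:Z - n'%:Z), (u / u'); split; first by rewrite unitrMl ?unitrV.
rewrite [(u / u')%:Qp]rmorphM/= padic_of_intV//.
rewrite !(rmorphM, rmorphXn, rmorph_nat)/= invfM.
by rewrite padic_expzD -invr_expz -!exprnP mulrACA.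
Qed.

Lemma ord_ge_exists x : exists m, ord_ge m x.
Proof.
have [->|/padic_factor[m [u [_ ->]]]] := eqVneq x 0; first by exists 0; exact: ord_ge0r.
by exists m; exists u.
Qed.

Lemma ord_ge_unit_eq m (u : Zp) x : u \is a GRing.unit ->
  ord_ge m (u%:Qp * x) -> ord_ge m x.
Proof.
move=> uu H; have := ord_geZpM (ord_ge_Zp u^-1) H.
by rewrite mulrA -rmorphM mulVr// rmorph1 mul1r.
Qed.

Lemma ord_ge_unit1 (u : Zp) : u \is a GRing.unit -> ~ ord_ge 1 u%:Qp.
Proof.
move=> uu H; have : ord_ge 1%N%:Z (1%:R : Qp).
  have := ord_geZpM (ord_ge_Zp u^-1) H.
  by rewrite -rmorphM mulVr// rmorph1.
by rewrite ord_ge_nat_dvd expn1 dvdn1 => /eqP p1; move: p_pr; rewrite p1.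
Qed.

Lemma padic_nat_factor n : (0 < n)%N ->
  exists2 u : Zp, u \is a GRing.unit & n%:R = P ^ (logn p n)%:Z * u%:Qp.
Proof.
move=> n0; have [m pm nE] := pfactor_coprime p_pr n0.
exists m%:R; last first.
  by rewrite rmorph_nat {1}nE natrM natrX mulrC.
apply: padic_int_unit; rewrite residue_nat expn1; apply/eqP => /dvdz_mod0P.
rewrite dvdzE/= => pm'; move: pm; rewrite prime_coprime//.
by move: pm' => /= ->.
Qed.

Lemma padic_int_cast_factor (a : int) : a != 0 ->
  exists2 u : Zp, u \is a GRing.unit & a%:~R = P ^ (logn p `|a|)%:Z * u%:Qp.
Proof.
move=> a0; have [|u uu uE] := @padic_nat_factor `|a|%N; first by rewrite absz_gt0.
case: (intP a) a0 uE => [//|n _ uE|n _ uE]; first by exists u.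
exists (- u); first by rewrite unitrN.
by rewrite [(- u)%:Qp]rmorphN/= mulrN -uE abszN mulrNz.
Qed.

Lemma padic_rat_factor r : r != 0 ->
  exists2 u : Zp, u \is a GRing.unit & ratr r = P ^ (ordq p r) * u%:Qp.
Proof.
move=> r0; have [|u uu uE] := @padic_int_cast_factor (numq r); first by rewrite numq_eq0.
have [|v vu vE] := @padic_int_cast_factor (denq r); first by rewrite denq_eq0.
exists (u / v); first by rewrite unitrMl ?unitrV.
rewrite /ratr uE vE [(u / v)%:Qp]rmorphM/= padic_of_intV// invfM /ordq padic_expzD.
by rewrite invr_expz mulrACA.
Qed.

Lemma ord_ge_ratr r : ord_ge (ordq p r) (ratr r : Qp).
Proof.
have [->|/padic_rat_factor[u _ ->]] := eqVneq r 0; last by exists u.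
by rewrite padic_ratrE rmorph0; exact: ord_ge0r.
Qed.

Lemma ord_ge_invn n : (0 < n)%N -> ord_ge (- (logn p n)%:Z) (n%:R^-1 : Qp).
Proof.
move=> /padic_nat_factor[u uu ->]; exists u^-1.
by rewrite padic_of_intV// invfM invr_expz.
Qed.

Lemma ord_ge_int_dvd n (a : int) : ord_ge n%:Z (a%:~R : Qp) <-> ((p ^ n)%N%:Z %| a)%Z.
Proof.
rewrite dvdzE/= -ord_ge_nat_dvd; case: (intP a) => // m.
rewrite abszN/=; split=> [/ord_geN|H]; first by rewrite mulrNz opprK.
by rewrite mulrNz; apply: ord_geN.
Qed.

Lemma padic_approx_nat x n : ord_ge 0 x -> exists i : nat, ord_ge n%:Z (x - i%:R).
Proof.
move=> /ord_ge0P[z ->]; have [i [z' ->]] := padic_int_approx z n.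
exists i; rewrite rmorphD rmorph_nat/= addrC addKr rmorphM rmorphXn rmorph_nat.
by exists z'.
Qed.

(** Q_p = Z[1/p] + Z_p: clear the denominator by p^n and approximate the numerator by a natural
    number modulo p^n. *)
Lemma padic_approx_rat x :
  exists (a : int) n, ord_ge 0 (x - ratr (a%:~R / p%:R ^+ n)).
Proof.
have [m xm] := ord_ge_exists x; pose n := absz m.
have [|i iP] := @padic_approx_nat (P ^ n%:Z * x) n.
  by apply/ord_ge_expzM; apply: ord_geW xm; lia.
exists i%:Z, n; rewrite padic_ratrE rmorphM fmorphV/= rmorphXn/= !rmorph_nat.
rewrite exprnP invr_expz.
move: iP => /(ord_geM (ord_ge_expz (- n%:Z))).
by rewrite addNr mulrBr mulrA padic_expzNr mul1r [_ * i%:R]mulrC.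
Qed.

Lemma padic_unitP x : ord_ge 0 x ->
  ord_ge 1 x \/ exists2 u : Zp, u \is a GRing.unit & x = u%:Qp.
Proof.
move=> /ord_ge0P[z ->]; have [[z' ->]|zu] := padic_int_unitP z.
  by left; exists z'; rewrite rmorphM rmorph_nat.
by right; exists z.
Qed.

End PadicBasics.

(** * Power series and the additive character *)

Section PadicSeries.
Variables (p : nat) (p_pr : prime p).
Local Notation Zp := (padic_int p_pr).
Local Notation Qp := (padic p_pr).
Implicit Types (f a : nat -> Qp) (x : Qp) (m n : int).

Lemma residue_add_exprp_mul (z y : Zp) N : (z + p%:R ^+ N * y) N = z N.
Proof.
have := residue_exprp_mul y N N; move: (p%:R ^+ N * y) => t tN.
by rewrite /= tN mulrC modzMl addr0 residue_mod.
Qed.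

Lemma padic_int_series (s : nat -> Zp) :
  (forall N, exists K, forall k, (K <= k)%N -> s k.+1 N = s k N) ->
  exists z : Zp, forall N, exists K, forall k, (K <= k)%N -> z N = s k N.
Proof.
move=> /choice[K KP].
have stable N k : (K N <= k)%N -> s k N = s (K N) N.
  elim: k => [|k IH]; first by rewrite leqn0 => /eqP ->.
  by rewrite leq_eqVlt ltnS => /predU1P[<-//|Kk]; rewrite KP ?IH.
pose F N := s (K N) N.
have FP N : (F N.+1 %% (p ^ N)%N%:Z)%Z = (F N %% (p ^ N)%N%:Z)%Z.
  rewrite -residueS residue_mod -(stable N (maxn (K N) (K N.+1))) ?leq_maxl//.
  by rewrite [LHS]residueS [RHS]residueS (stable N.+1 (maxn _ _)) ?leq_maxr.
exists (padic_of p_pr FP) => N; exists (K N) => k Kk.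
by rewrite /= stable// /F residue_mod.
Qed.

(** [ps_eval] selects a limit by choice, so the task is to produce one: the partial sums of the
    integral series stabilise at every residue, and [c] times their limit qualifies. *)
Lemma ps_evalP f x : scaled_I0 f -> ord_ge 0 x -> forall N : nat,
  exists K : nat, forall k, (K <= k)%N ->
    ord_ge N (ps_eval f x - \sum_(i < k) f i * x ^+ i).
Proof.
move=> [c c0 [a [a0 alim] fE]] /ord_ge0P[z ->].
rewrite /ps_eval; case: xgetP => // none.
have /choice[b bE] : forall i, exists b : Zp, a i = b%:Qp.
  by move=> i; apply: ord_ge0P; exact: a0.
pose s k := \sum_(i < k) (b i * z ^+ i).
have [N|v vP] := @padic_int_series s.
  have [K KP] := alim N; exists K => k /KP; rewrite bE => -[y].
  rewrite -exprnP -[p%:R](rmorph_nat (@padic_of_int p p_pr)) -rmorphXn -rmorphM.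
  move/padic_of_int_inj => bk; rewrite /s big_ord_recr.
  by rewrite bk -mulrA residue_add_exprp_mul.
case: (none (c * v%:Qp)) => N; have [m cm] := ord_ge_exists c.
(* Since [c] has order at least m, agreement to N - m digits is enough; for negative N - m the
   absolute value only asks for more. *)
have [K KP] := vP (absz (N%:Z - m)); exists K => k /KP vk.
have [|y yE] := @padic_int_dvd _ _ (v - s k) (absz (N%:Z - m)).
  by rewrite /= vk modzDmr subrr mod0z.
have -> : c * v%:Qp - \sum_(i < k) f i * z%:Qp ^+ i = c * (v - s k)%:Qp.
  rewrite rmorphB/= mulrBr; congr (_ - _); rewrite rmorph_sum mulr_sumr.
  by apply: eq_bigr => i _; rewrite fE bE rmorphM rmorphXn mulrA.
rewrite yE rmorphM rmorphXn rmorph_nat.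
have := ord_geM cm (ord_geMZp (ord_ge_expz p_pr (absz (N%:Z - m))) (ord_ge_Zp y)).
by apply: ord_geW; lia.
Qed.

Lemma ps_eval_trunc f x K m : scaled_I0 f -> ord_ge 0 x ->
  (forall i, (K <= i)%N -> ord_ge m (f i)) ->
  ord_ge m (ps_eval f x - \sum_(i < K) f i * x ^+ i).
Proof.
move=> fI x0 fK; have [K' K'P] := ps_evalP fI x0 (absz m).
pose k := maxn K K'.
have -> : ps_eval f x - \sum_(i < K) f i * x ^+ i =
    ps_eval f x - \sum_(i < k) f i * x ^+ i + \sum_(K <= i < k) f i * x ^+ i.
  rewrite -!(big_mkord xpredT (fun i => f i * x ^+ i)).
  by rewrite (big_cat_nat (n := K) (p := k))//= ?leq_maxl// opprD addrA subrK.
apply: ord_geD; first by apply: ord_geW (K'P k (leq_maxr _ _)); lia.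
rewrite big_nat_cond; apply: ord_ge_sum => i /andP[/andP[Ki _] _].
by apply: ord_geMZp; [exact: fK|exact: ord_geX].
Qed.

End PadicSeries.

Section PadicCharacter.
Variables (R : realType) (p : nat) (p_pr : prime p).
Local Notation Qp := (padic p_pr).
Local Notation e := (@padic_e p p_pr R).
Local Notation P := (p%:R : Qp).
Local Open Scope complex_scope.
Implicit Types (x y : Qp).

Lemma expi2piD (s t : R) : expi2pi (s + t) = expi2pi s * expi2pi t.
Proof. by rewrite /expi2pi mulrDr cosD sinD; simpc; rewrite [cos _ * sin _ + _]addrC. Qed.

Lemma expi2pi0 : expi2pi (0 : R) = 1.
Proof. by rewrite /expi2pi mulr0 cos0 sin0. Qed.

Lemma expi2pi1 : expi2pi (1 : R) = 1.
Proof. by rewrite /expi2pi mulr1 mulrC mulr_natr cos2pi sin2pi. Qed.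

Lemma expi2pi_nat n : expi2pi (n%:R : R) = 1.
Proof.
elim: n => [|n IH]; first exact: expi2pi0.
by rewrite -addn1 natrD expi2piD IH expi2pi1 mulr1.
Qed.

Lemma expi2pi_int (a : int) : expi2pi (a%:~R : R) = 1.
Proof.
case: (intP a) => [|n|n]; first exact: expi2pi0.
  exact: expi2pi_nat.
rewrite -[LHS]mulr1 -[X in _ * X](expi2pi_nat n.+1) -expi2piD mulrNz addNr.
exact: expi2pi0.
Qed.

Lemma norm_expi2pi (t : R) : `|expi2pi t| = 1.
Proof. by rewrite /expi2pi normc_def/= cos2Dsin2 sqrtr1. Qed.

Lemma padic_integral_rat (a : int) k :
  ord_ge 0 (ratr (a%:~R / p%:R ^+ k) : Qp) -> exists b : int, a%:~R / p%:R ^+ k = b%:~R :> rat.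
Proof.
rewrite padic_ratrE rmorphM fmorphV/= rmorphXn/= rmorph_nat rmorph_int.
rewrite [X in ord_ge 0 X]mulrC [X in ord_ge 0 (X^-1 * _)]exprnP invr_expz.
rewrite ord_ge_expzM sub0r opprK ord_ge_int_dvd.
move=> /dvdzP[b ->]; exists b; rewrite rmorphM/= -natrX mulfK//.
by rewrite pnatr_eq0 -lt0n expn_gt0 prime_gt0.
Qed.

(** Well-definedness of e on Q_p: two representatives differ by an element of Z[1/p] that lies in
    Z_p, hence by an integer, on which [expi2pi] is 1. *)
Lemma padic_eE x (a : int) k : ord_ge 0 (x - ratr (a%:~R / p%:R ^+ k)) ->
  e x = expi2pi (ratr (a%:~R / p%:R ^+ k)).
Proof.
move=> xa; rewrite /padic_e; case: xgetP => [r _ [[b [l ->]] xb]|none]; last first.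
  by case: (none (a%:~R / p%:R ^+ k)); split => //; exists a, k.
have p0 : (p%:R : rat) != 0 by rewrite pnatr_eq0 -lt0n prime_gt0.
set s := b%:~R / _ in xb *; set t := a%:~R / _ in xa *.
have E : s - t = (b * p%:Z ^+ k - a * p%:Z ^+ l)%:~R / p%:R ^+ (l + k).
  rewrite rmorphB !rmorphM !rmorphXn/= mulrBl exprD invfM mulrACA divff ?expf_neq0//.
  by rewrite mulr1 [_^-1 / _]mulrC mulrACA divff ?expf_neq0// mulr1.
have : ord_ge 0 (ratr (s - t) : Qp).
  have -> : (ratr (s - t) : Qp) = (x - ratr t) - (x - ratr s).
    by rewrite !padic_ratrE rmorphB/=; ring.
  exact: ord_geB.
rewrite {1}E => /padic_integral_rat[c]; rewrite -E.
move=> /(canRL (subrK _)) ->; rewrite rmorphD/= expi2piD.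
by rewrite ratr_int expi2pi_int mul1r.
Qed.

Lemma padic_eD x y : e (x + y) = e x * e y.
Proof.
have [a [k xa]] := padic_approx_rat x; have [b [l yb]] := padic_approx_rat y.
have p0 : (p%:R : rat) != 0 by rewrite pnatr_eq0 -lt0n prime_gt0.
rewrite (padic_eE xa) (padic_eE yb) -expi2piD -rmorphD/=.
have E : a%:~R / p%:R ^+ k + b%:~R / p%:R ^+ l =
    (a * p%:Z ^+ l + b * p%:Z ^+ k)%:~R / p%:R ^+ (k + l) :> rat.
  by rewrite addf_div ?expf_neq0// rmorphD !rmorphM !rmorphXn/= exprD.
rewrite E; apply: padic_eE; rewrite -E padic_ratrE rmorphD/= opprD addrACA.
exact: ord_geD.
Qed.

Lemma padic_e_int x : ord_ge 0 x -> e x = 1.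
Proof.
move=> x0; rewrite (@padic_eE x 0 0%N) ?mul0r ?rmorph0 ?expi2pi0//.
by rewrite padic_ratrE rmorph0 subr0.
Qed.

Lemma eq_padic_e x y : ord_ge 0 (x - y) -> e x = e y.
Proof. by move=> xy; rewrite -(subrK y x) padic_eD padic_e_int ?mul1r. Qed.

Lemma norm_padic_e x : `|e x| = 1.
Proof. by have [a [k xa]] := padic_approx_rat x; rewrite (padic_eE xa) norm_expi2pi. Qed.

Lemma padic_eMn x n : e (x *+ n) = e x ^+ n.
Proof.
elim: n => [|n IH]; first by rewrite mulr0n expr0 padic_e_int//; exact: ord_ge0r.
by rewrite mulrS exprS padic_eD IH.
Qed.

(** The real part cos(2 pi/p) is less than cos 0, as 0 < 2 pi/p <= pi and cos is strictly decreasing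
    there. *)
Lemma padic_e_invp_neq1 : e P^-1 != 1.
Proof.
have p0 : (0 : R) < p%:R by rewrite ltr0n prime_gt0.
rewrite (@padic_eE _ 1 1%N) ?mul1r; last first.
  rewrite padic_ratrE fmorphV/= rmorphXn/= rmorph_nat expr1 subrr.
  exact: ord_ge0r.
rewrite fmorphV/= expr1 ratr_nat eq_complex/= negb_and; apply/orP; left.
rewrite lt_eqF// -[X in _ < X]cos0 ltr_cos ?in_itv/= ?lexx ?pi_ge0//.
  by rewrite pmulr_rgt0 ?mulr_gt0 ?pi_gt0// invr_gt0.
rewrite divr_ge0 ?mulr_ge0 ?pi_ge0 ?(ltW p0)//= ler_pdivrMr// mulrC.
by rewrite ler_pM2l ?pi_gt0// ler_nat prime_gt1.
Qed.

(** Some integer multiple of x is congruent to 1/p modulo Z_p, so e(x) = 1 would give e(1/p) = 1. *)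
Lemma padic_e_neq1 x : ~ ord_ge 0 x -> e x != 1.
Proof.
move=> nx; apply/eqP => ex; have [x0|x0] := eqVneq x 0.
  by apply: nx; rewrite x0; exact: ord_ge0r.
have [m [u [uu xE]]] := padic_factor x0.
have m0 : m < 0.
  by rewrite ltNge; apply/negP => m0; apply: nx; apply: (ord_geW m0); exists u.
have [n nE] : exists n : nat, m = - (n%:Z + 1) by exists (absz (- m - 1)); lia.
have [i iP] := @padic_approx_nat _ p_pr (u^-1)%:Qp 1 (ord_ge_Zp _).
suff : e P^-1 = 1 by move/eqP; rewrite (negPf padic_e_invp_neq1).
transitivity (e (x *+ (p ^ n * i))); last by rewrite padic_eMn ex expr1n.
apply: eq_padic_e; rewrite xE -[_ *+ (_ * _)]mulr_natr natrM natrX nE opprD padic_expzD.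
rewrite [_ * P ^ (- (1))]mulrC -!mulrA [u%:Qp * _]mulrCA [P ^ (- n%:Z) * _]mulrA padic_expzNr mul1r.
have -> : P^-1 - P ^ (- 1) * (u%:Qp * i%:R) = P ^ (- 1) * u%:Qp * ((u^-1)%:Qp - i%:R).
  rewrite mulrBr -[in RHS]mulrA -[u%:Qp * (u^-1)%:Qp]rmorphM divrr// rmorph1 mulr1 exprN1.
  by rewrite mulrA.
rewrite -(addNr 1); apply: ord_geM => //.
by apply: ord_geMZp; [exact: ord_ge_expz|exact: ord_ge_Zp].
Qed.

Lemma padic_e_orthogonality (c : Qp) l q : q = (p ^ l)%N ->
  ord_ge (- l%:Z) c ->
  \sum_(h < q) e (c *+ h) = if `[< ord_ge 0 c >] then q%:R else 0.
Proof.
move=> -> cl; case: asboolP => [c0|nc].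
  rewrite (eq_bigr (fun=> 1)) => [|h _]; last by rewrite padic_e_int//; exact: ord_geMn.
  by rewrite sumr_const card_ord.
have e1 := padic_e_neq1 nc.
rewrite (eq_bigr (fun h : 'I_(p ^ l) => e c ^+ h)) => [|h _]; last exact: padic_eMn.
apply: (mulfI (_ : 1 - e c != 0)); first by rewrite subr_eq0 eq_sym.
rewrite mulr0 -opprB mulNr -subrX1 -padic_eMn padic_e_int ?subrr ?oppr0//.
rewrite -mulr_natl natrX -(addrN l%:Z).
by apply: ord_geM => //; exact: (ord_ge_expz p_pr l).
Qed.

End PadicCharacter.

(** * Taylor expansions *)

Section PrimeValuationBounds.
Variables (p : nat) (p_pr : prime p).

Lemma expn_logn_leq n : (0 < n)%N -> (p ^ logn p n <= n)%N.
Proof. by move=> n0; rewrite dvdn_leq// pfactor_dvdnn. Qed.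

(** Makes Taylor terms of degree i >= 3 negligible: (i - 2) l >= v_p(i) for l >= 1. In degree 2 this
    fails for p = 2 only, by one unit, which is the correction in [logn_leq_sub2_odd]. *)
Lemma logn_leq_sub2 n : (2 < n)%N -> (logn p n + 2 <= n)%N.
Proof.
move=> n2; have := expn_logn_leq (ltn_trans (isT : 0 < 2) n2)%N.
case: (logn p n) => [|[|v]] H; [by lia|by lia|].
apply: leq_trans H; apply: (@leq_trans (2 ^ v.+2)); last first.
  by rewrite leq_exp2r// prime_gt1.
by elim: v => // v IH; rewrite expnS; lia.
Qed.

Lemma logn_leq_sub2_odd n : (1 < n)%N -> (logn p n + 2 <= n + (p == 2%N))%N.
Proof.
move=> n1; have [->|n2] := eqVneq n 2%N.
  have [->//|p2] := eqVneq p 2%N; rewrite logn_coprime// prime_coprime//.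
  by rewrite dvdn_prime2.
by apply: leq_trans (logn_leq_sub2 _) (leq_addr _ _); lia.
Qed.

Lemma logn_fact_leq n : (0 < n)%N -> (p.-1 * logn p n`! < n)%N.
Proof.
move=> n0; rewrite logn_fact//.
(* Legendre's sum is bounded for every upper limit m, keeping n/p^m as a reserve that pays for the
   next term; the maximum with 1 yields the strict inequality once the quotient is 0. *)
suff : (p.-1 * (\sum_(1 <= k < n.+1) n %/ p ^ k) + maxn 1 (n %/ p ^ n) <= n)%N.
  by apply: leq_trans; rewrite -addn1 leq_add2l leq_maxl.
have p1 := prime_gt1 p_pr; elim: {1 4}n => [|m IH].
  by rewrite big_geq// muln0 expn0 divn1; lia.
rewrite big_nat_recr//= mulnDr expnSr divnMA.
have := leq_divM (n %/ p ^ m) p; move: IH.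
move: (n %/ p ^ m)%N (\sum_(_ <= _ < _) _)%N => q S.
by case: (q %/ p)%N => [|r]; nia.
Qed.

End PrimeValuationBounds.

Section Taylor.
Variables (p : nat) (p_pr : prime p).
Local Notation Qp := (padic p_pr).
Local Notation P := (p%:R : Qp).
Implicit Types (Q : {poly Qp}) (x z : Qp) (m a : int).

Lemma ord_ge_horner m Q x : (forall k, ord_ge m Q`_k) -> ord_ge 0 x ->
  ord_ge m Q.[x].
Proof.
move=> Qm x0; rewrite horner_coef; apply: ord_ge_sum => i _.
by apply: ord_geMZp; [exact: Qm|exact: ord_geX].
Qed.

(** The i-th divided derivative of Q is 1/i times the (i-1)-th divided derivative of Q', so only
    v_p(i), and not v_p(i!), is lost. *)
Lemma ord_ge_nderivn a Q i k : (1 < i)%N ->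
  (forall k, (0 < k)%N -> ord_ge a Q^`()`_k) ->
  ord_ge (a - (logn p i)%:Z) Q^`N(i)`_k.
Proof.
move=> i1 Qa; rewrite coef_nderivn.
have -> : Q`_(i + k) *+ 'C(i + k, i) = i%:R^-1 * (Q^`()`_(i + k).-1 *+ 'C((i + k).-1, i.-1)).
  apply: (canRL (mulKf _)); first by rewrite padic_natr_eq0 -lt0n ltnW.
  rewrite coef_deriv prednK ?addn_gt0 ?(ltnW i1)// mulr_natl -!mulrnA; congr (_ *+ _).
  by case: i i1 => // i _; rewrite mulnC addSn -mul_bin_diag.
rewrite addrC; apply: ord_geM; first by apply: ord_ge_invn; exact: ltnW.
by apply: ord_geMn; apply: Qa; lia.
Qed.

Lemma poly_taylor_rem Q a m (l r : nat) x z : (1 < r)%N ->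
  (forall k, (0 < k)%N -> ord_ge a Q^`()`_k) -> ord_ge 0 x -> ord_ge 0 z ->
  (forall i, (r <= i)%N -> m <= a - (logn p i)%:Z + (i * l)%N%:Z) ->
  ord_ge m (Q.[x + P ^+ l * z] - \sum_(i < r) Q^`N(i).[x] * (P ^+ l * z) ^+ i).
Proof.
move=> r0 Qa x0 z0 mP; pose s := maxn r (size Q).
rewrite (@nderiv_taylor_wide _ s) ?leq_maxr//; last exact: mulrC.
rewrite -!(big_mkord xpredT (fun i => Q^`N(i).[x] * (P ^+ l * z) ^+ i)).
rewrite (big_cat_nat (n := r) (p := s))//= ?leq_maxl// [X in X - _]addrC addrK.
rewrite big_nat_cond; apply: ord_ge_sum => i /andP[/andP[ri _] _].
apply: ord_geW (mP i ri) _; apply: ord_geM.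
  by apply: ord_ge_horner => // k; apply: ord_ge_nderivn => //; exact: leq_trans ri.
rewrite exprMn -exprM mulnC; apply: ord_geMZp; last exact: ord_geX.
by rewrite exprnP; exact: ord_ge_expz.
Qed.

Lemma poly_taylor1 Q a (l : nat) x z : (0 < l)%N ->
  (forall k, (0 < k)%N -> ord_ge a Q^`()`_k) -> ord_ge 0 x -> ord_ge 0 z ->
  ord_ge (a + (l.*2)%:Z - (p == 2%N)%:Z)
    (Q.[x + P ^+ l * z] - (Q.[x] + Q^`().[x] * (P ^+ l * z))).
Proof.
move=> l0 Qa x0 z0.
have := @poly_taylor_rem Q a (a + (l.*2)%:Z - (p == 2%N)%:Z) l 2 x z isT Qa x0 z0.
rewrite big_ord_recl big_ord1/= expr0 mulr1 expr1 nderivn0 nderivn1; apply.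
by move=> i i2; have := logn_leq_sub2_odd p_pr i2; case: (p == 2%N); nia.
Qed.

Lemma poly_taylor2 Q a (l : nat) x z : (0 < l)%N ->
  (forall k, (0 < k)%N -> ord_ge a Q^`()`_k) -> ord_ge 0 x -> ord_ge 0 z ->
  ord_ge (a + (l.*2)%:Z)
    (Q.[x + P ^+ l * z] - (Q.[x] + Q^`().[x] * (P ^+ l * z) +
                           Q^`N(2).[x] * (P ^+ l * z) ^+ 2)).
Proof.
move=> l0 Qa x0 z0.
have := @poly_taylor_rem Q a (a + (l.*2)%:Z) l 3 x z isT Qa x0 z0.
rewrite !big_ord_recr big_ord0/= add0r expr0 mulr1 expr1 nderivn0 nderivn1; apply.
by move=> i i2; have := logn_leq_sub2 p_pr i2; nia.
Qed.

End Taylor.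

(** * Quadratic exponential sums *)

Section ResidueSums.
Variable V : zmodType.
Implicit Types F : nat -> V.

Lemma sum_ord_periodic_shift F q r : (forall i, F (i + q)%N = F i) ->
  \sum_(i < q) F (i + r)%N = \sum_(i < q) F i.
Proof.
move=> Fq; elim: r => [|r IH]; first by apply: eq_bigr => i _; rewrite addn0.
rewrite -{}IH; case: q Fq => [|q] Fq; first by rewrite !big_ord0.
rewrite big_ord_recr big_ord_recl/= add0n addrC; congr (_ + _).
  by rewrite addnS -addSn addnC Fq.
by apply: eq_bigr => i _; rewrite /bump/= addSn addnS.
Qed.

Lemma sum_ord_mul F q r :
  \sum_(i < q * r) F i = \sum_(x < q) \sum_(z < r) F (x + q * z)%N.
Proof.
rewrite exchange_big/=; elim: r => [|r IH]; first by rewrite muln0 !big_ord0.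
rewrite mulnS addnC big_split_ord/= big_ord_recr/= IH; congr (_ + _).
by apply: eq_bigr => i _; rewrite addnC.
Qed.

End ResidueSums.

Section QuadraticSums.
Variables (R : realType) (p : nat) (p_pr : prime p).
Local Notation Zp := (padic_int p_pr).
Local Notation Qp := (padic p_pr).
Local Notation e := (@padic_e p p_pr R).
Local Notation P := (p%:R : Qp).
Local Notation C := (complex R).
Implicit Types Q : {poly Qp}.

(** The sum over z is a complete character sum. The slope [D] is left free because it is not always
    Q'(x)/p^m: at p = 2 it acquires a correction from the quadratic Taylor term. *)
Lemma padic_e_sum_split (F : nat -> C) (D : nat -> Qp) (l m : nat) :
  (forall x : nat, ord_ge (- m%:Z) (D x)) ->
  (forall x z : nat, F (x + p ^ l * z)%N = F x * e (D x *+ z)) ->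
  \sum_(h < p ^ (l + m)) F h =
    (p ^ m)%:R * \sum_(x < p ^ l | `[< ord_ge 0 (D x) >]) F x.
Proof.
move=> Dm FD; rewrite expnD sum_ord_mul mulr_sumr [RHS]big_mkcond/=.
apply: eq_bigr => x _; under eq_bigr do rewrite FD.
rewrite -mulr_sumr (padic_e_orthogonality _ erefl)//; case: asboolP => _; last by rewrite mulr0.
by rewrite mulrC.
Qed.

(** Expanding the square as a sum over pairs (x + y, y) turns each summand into F(x) e(2 c x y/p);
    the sum over y kills every x except 0, as 2c is a unit. *)
Lemma quadratic_gauss_norm (c : Zp) : p != 2%N -> c \is a GRing.unit ->
  `|\sum_(y < p) e (c%:Qp * y%:R ^+ 2 / P)| ^+ 2 = p%:R :> C.
Proof.
move=> p2 cu; set S := \sum_(_ < _) _.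
pose F (n : nat) : C := e (c%:Qp * n%:R ^+ 2 / P).
have Pn0 := padic_p_neq0 p_pr.
have FS (x y : nat) : F (x + y)%N = F x * e (c%:Qp * y%:R ^+ 2 / P) * e ((c%:Qp * y%:R *+ 2 / P) *+ x).
  rewrite -!padic_eD; congr e; rewrite natrD -mulr_natr.
  by move: (P^-1) => Pi; ring.
have Fp i : F (i + p)%N = F i.
  rewrite FS (padic_e_int _ (_ : ord_ge 0 (c%:Qp * P ^+ 2 / P))).
    rewrite mulr1 (padic_e_int _ (_ : ord_ge 0 ((c%:Qp * P *+ 2 / P) *+ i))) ?mulr1//.
    apply: ord_geMn; rewrite mulrnAl mulfK//; apply: ord_geMn; exact: ord_ge_Zp.
  by rewrite expr2 mulrA mulfK//; apply: ord_geMZp; [exact: ord_ge_Zp|exact: ord_ge_nat].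
have -> : S = \sum_(y < p) F y by [].
rewrite sqr_normc (rmorph_sum (@conjc R)) mulr_sumr.
transitivity (\sum_(y < p) \sum_(x < p) F x * e ((c%:Qp * x%:R *+ 2 / P) *+ y)).
  apply: eq_bigr => y _; rewrite -(sum_ord_periodic_shift y Fp) mulr_suml.
  apply: eq_bigr => x _; rewrite addnC FS -/(F x) mulrAC [F y * F x]mulrC -!mulrA.
  by rewrite [F y * _]mulrA -sqr_normc norm_padic_e expr1n mul1r.
rewrite exchange_big/= (bigD1 (Ordinal (prime_gt0 p_pr)))//= [X in _ + X]big1.
  rewrite addr0 -mulr_sumr mulr0 mul0rn mul0r.
  rewrite (eq_bigr (fun=> 1)) => [|y _]; last by rewrite mul0rn padic_e_int//; exact: ord_ge0r.
  rewrite sumr_const card_ord /F expr0n/= mulr0 mul0r padic_e_int ?mul1r//.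
  exact: ord_ge0r.
move=> x x0; rewrite -mulr_sumr.
rewrite (padic_e_orthogonality _ (esym (expn1 p))); last first.
  rewrite mulrC -[P^-1]exprN1; apply: ord_geMZp; first exact: ord_ge_expz.
  by apply: ord_geMn; apply: ord_geMZp; [exact: ord_ge_Zp|exact: ord_ge_nat].
case: asboolP => [|_]; last by rewrite mulr0.
rewrite mulrC -[P^-1]exprN1 -mulrnAr ord_ge_expzM => /(ord_ge_unit_eq cu).
rewrite -mulr_natr -natrM => /ord_ge_nat_dvd; rewrite expn1 Euclid_dvdM//.
case/orP=> [|]; last by rewrite dvdn_prime2// (negPf p2).
rewrite gtnNdvd ?ltn_ord// lt0n; apply: contra x0 => /eqP x0.
by apply/eqP; exact: val_inj.
Qed.

(* Writing h = x + p^l z, the phase is affine in z up to an integer, so the sum over z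
   kills every x with Q'(x) not divisible by p^m. *)
Lemma sum_phase_split Q (a : int) l m : 0 <= a -> (0 < l)%N ->
  ord_ge 0 Q^`()`_0 -> (forall k, (0 < k)%N -> ord_ge a Q^`()`_k) ->
  (l + m)%:Z <= a + (l.*2)%:Z - (p == 2%N)%:Z ->
  \sum_(h < p ^ (l + m)) e (Q.[h%:R] / P ^+ (l + m)) =
  (p ^ m)%:R * \sum_(x < p ^ l | `[< ord_ge m%:Z Q^`().[x%:R] >])
                 e (Q.[x%:R] / P ^+ (l + m)).
Proof.
move=> a0 l0 Q0 Qa lma.
have Pm k : P ^+ k != 0 by rewrite expf_neq0// padic_p_neq0.
rewrite (@padic_e_sum_split (fun h => e (Q.[h%:R] / P ^+ (l + m)))
  (fun x : nat => Q^`().[x%:R] / P ^+ m)) => [|x|x z].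
- congr (_ * _); apply: eq_bigl => x; congr asbool; apply/propext.
  by rewrite mulrC exprnP invr_expz ord_ge_expzM sub0r opprK.
- rewrite mulrC exprnP invr_expz; apply: ord_geMZp; first exact: ord_ge_expz.
  apply: ord_ge_horner; last exact: ord_ge_nat.
  by case=> // k; apply: ord_geW (Qa _ _).
rewrite -padic_eD; apply: eq_padic_e.
have := poly_taylor1 l0 Qa (ord_ge_nat p_pr x) (ord_ge_nat p_pr z).
rewrite natrD natrM natrX; move: (Q.[_ + _]) (Q.[x%:R]) (Q^`().[x%:R]) => A B D.
move=> /(ord_geW lma) H.
have -> : A / P ^+ (l + m) - (B / P ^+ (l + m) + D / P ^+ m *+ z) =
    P ^ (- (l + m)%:Z) * (A - (B + D * (P ^+ l * z%:R))).
  rewrite -invr_expz -exprnP mulrBr mulrDr ![_^-1 * _]mulrC; congr (_ - (_ + _)).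
  rewrite -[_ *+ z]mulr_natr exprD invfM mulrACA.
  by rewrite -[LHS]mulrA -[RHS]mulrA -[P ^+ l * _ / _]mulrA mulKf// [z%:R / _]mulrC.
by apply/ord_ge_expzM; rewrite sub0r opprK.
Qed.

Lemma sum_multiples (F : nat -> C) m k :
  \sum_(x < p ^ (m + k) | (p ^ m %| x)%N) F x = \sum_(y < p ^ k) F (p ^ m * y)%N.
Proof.
rewrite big_mkcond/= expnD (sum_ord_mul (fun x => if (p ^ m %| x)%N then F x else 0)).
have pm : (0 < p ^ m)%N by rewrite expn_gt0 prime_gt0.
rewrite (bigD1 (Ordinal pm))//= [X in _ + X]big1 => [|x x0].
  by rewrite addr0; apply: eq_bigr => z _; rewrite add0n dvdn_mulr.
rewrite big1// => z _; rewrite dvdn_addl ?dvdn_mulr// gtnNdvd// lt0n.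
by apply: contra x0 => /eqP x0; apply/eqP; exact: val_inj.
Qed.

(* These identities are stated over an abstract field because [field] would unfold
   the construction of Q_p. *)
Fact quadratic_rescale (F : fieldType) (c y q r : F) : q != 0 -> r != 0 ->
  c * y ^+ 2 / q = (q * (r * r))^-1 * (c * (r * y) ^+ 2).
Proof. by move=> q0 r0; field; rewrite q0 r0. Qed.

Fact taylor2_rescale (F : fieldType) (A B B' B'' u z r : F) :
  r != 0 -> 2%:R != 0 :> F ->
  A / (2%:R * r * (2%:R * r)) -
    (B / (2%:R * r * (2%:R * r)) + (2%:R * r)^-1 * (B' + r * u) * z) =
  (2%:R * r * (2%:R * r))^-1 *
    (A - (B + B' * (2%:R * r * z) + B'' * (2%:R * r * z) ^+ 2))
  + (B'' - u / 2%:R) * z ^+ 2 + u * ((z ^+ 2 - z) / 2%:R).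
Proof. by move=> r0 n2; field; rewrite r0 n2. Qed.

Fact eighth_rescale (F : fieldType) (A b u r : F) : r != 0 -> 2%:R != 0 :> F ->
  A / (2%:R * r * (2%:R * r)) - b / 8%:R =
  (2%:R * r * (2%:R * r))^-1 * (A - u / 2%:R * r ^+ 2) + (2%:R ^+ 3)^-1 * (u - b).
Proof.
move=> r0 n2; have e8 : 8%:R = 2%:R ^+ 3 :> F by rewrite -natrX.
have n8 : 8%:R != 0 :> F by rewrite e8 expf_neq0.
by rewrite e8; field; apply/and3P; split.
Qed.

Section CriticalPoint.
Variables (Q T : {poly Qp}) (u : Zp).
Hypotheses (uu : u \is a GRing.unit) (QT : Q^`() = 'X * T) (Q0 : Q`_0 = 0).
Hypotheses (T0 : T`_0 = u%:Qp) (Tk : forall k, (0 < k)%N -> ord_ge 1 T`_k).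

(** Hence T takes unit values, Q'(x) = x T(x) has the order of x, and 0 is the only critical
    point. *)
Lemma critical_cofactor (x : nat) : ord_ge 1 (T.[x%:R] - u%:Qp).
Proof.
rewrite -T0 horner_coef; case: (posnP (size T)) => [s0|s0].
  by rewrite s0 big_ord0 nth_default ?s0// subr0; exact: ord_ge0r.
rewrite -(prednK s0) big_ord_recl expr0 mulr1 addrAC subrr add0r.
apply: ord_ge_sum => i _; apply: ord_geMZp; first exact: Tk.
by apply: ord_geX; exact: ord_ge_nat.
Qed.

Lemma critical_cofactor_unit (x : nat) :
  exists2 v : Zp, v \is a GRing.unit & T.[x%:R] = v%:Qp.
Proof.
have H := critical_cofactor x; case: (@padic_unitP _ p_pr T.[x%:R]) => //.
  rewrite -(subrK u%:Qp T.[_]); apply: ord_geD; last exact: ord_ge_Zp.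
  exact: ord_geW H.
move=> H'; case: (ord_ge_unit1 uu).
by have := ord_geB H' H; rewrite opprB addrC subrK.
Qed.

Lemma critical_deriv_ord (x m : nat) : ord_ge m%:Z Q^`().[x%:R] <-> (p ^ m %| x)%N.
Proof.
have [v vu vE] := critical_cofactor_unit x.
rewrite QT hornerM hornerX vE -ord_ge_nat_dvd mulrC; split.
  exact: ord_ge_unit_eq.
by apply: ord_geZpM; exact: ord_ge_Zp.
Qed.

Lemma critical_deriv_coef k : (0 < k)%N -> ord_ge 0 Q^`()`_k.
Proof.
case: k => // k _; rewrite QT coefXM/=; case: k => [|k].
  by rewrite T0; exact: ord_ge_Zp.
by apply: ord_geW (Tk _).
Qed.

Lemma critical_coef2 : Q`_2 = u%:Qp / 2%:R.
Proof.
apply: (canRL (mulfK _)); first by rewrite padic_natr_eq0.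
by rewrite -T0 mulr_natr -[_ *+ 2]/(Q`_1.+1 *+ 1.+1) -coef_deriv QT coefXM.
Qed.

Lemma critical_coef j : (2 < j)%N -> Q`_j = T`_j.-2 / j%:R.
Proof.
move=> j2; apply: (canRL (mulfK _)).
  by rewrite padic_natr_eq0; clear -j2; lia.
case: j j2 => [|[|j]]// _; rewrite mulr_natr -coef_deriv QT coefXM//.
Qed.

Lemma sum_critical_split l m : (m <= l)%N -> (0 < l)%N ->
  (l + m + (p == 2%N) <= l.*2)%N ->
  \sum_(h < p ^ (l + m)) e (Q.[h%:R] / P ^+ (l + m)) =
  (p ^ m)%:R * \sum_(y < p ^ (l - m)) e (Q.[(p ^ m * y)%:R] / P ^+ (l + m)).
Proof.
move=> ml l0 lm; have -> := @sum_phase_split Q 0 l m; last 5 first.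
- by [].
- by [].
- by rewrite QT coefXM; exact: ord_ge0r.
- exact: critical_deriv_coef.
- by lia.
congr (_ * _).
have -> : \sum_(x < p ^ l | `[< ord_ge m Q^`().[x%:R] >]) e (Q.[x%:R] / P ^+ (l + m)) =
    \sum_(x < p ^ (m + (l - m)) | (p ^ m %| x)%N) e (Q.[x%:R] / P ^+ (l + m)).
  rewrite subnKC//; apply: eq_bigl => x.
  by apply/asboolP/idP => /critical_deriv_ord.
by rewrite (sum_multiples (fun x => e (Q.[x%:R] / P ^+ (l + m)))).
Qed.

Lemma sum_critical_even l : p != 2%N -> (0 < l)%N ->
  \sum_(h < p ^ (l + l)) e (Q.[h%:R] / P ^+ (l + l)) = (p ^ l)%:R.
Proof.
move=> p2 l0; rewrite sum_critical_split// ?(negPf p2) ?addn0 ?addnn//.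
rewrite subnn expn0 big_ord1 muln0 horner_coef0 Q0 mul0r padic_e_int ?mulr1//.
exact: ord_ge0r.
Qed.

Lemma critical_horner_ord m (x : nat) :
  (forall j, (2 < j)%N -> ord_ge m (Q`_j * x%:R ^+ j)) ->
  ord_ge m (Q.[x%:R] - u%:Qp / 2%:R * x%:R ^+ 2).
Proof.
move=> H; have Q1 : Q`_1 = 0 by rewrite -[LHS]mulr1n -coef_deriv QT coefXM.
rewrite (@horner_coef_wide _ (maxn 3 (size Q))) ?leq_maxr//.
rewrite -(big_mkord xpredT (fun i => Q`_i * x%:R ^+ i)).
rewrite (big_cat_nat (n := 3))//= ?leq_maxl//.
rewrite !big_nat_recr//= big_geq// Q0 Q1 !mul0r !add0r critical_coef2 addrAC subrr add0r.
by rewrite big_nat_cond; apply: ord_ge_sum => j /andP[/andP[j2 _] _]; exact: H.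
Qed.

Lemma sum_critical_odd l b :
  ord_ge (1 + (p == 2%N)%:Z) (u%:Qp - b) ->
  (l = 0%N -> forall j, (2 < j)%N -> ord_ge 1 Q`_j) ->
  \sum_(h < p ^ (l.+1 + l)) e (Q.[h%:R] / P ^+ (l.+1 + l)) =
  (p ^ l)%:R * \sum_(y < p) e (b / 2%:R * y%:R ^+ 2 / P).
Proof.
move=> ub Qsmall; rewrite sum_critical_split ?leqnSn//; last by case: (p == 2%N); lia.
congr (_ * _); rewrite subSnn expn1; apply: eq_bigr => y _; apply: eq_padic_e.
have -> : Q.[(p ^ l * y)%:R] / P ^+ (l.+1 + l) - b / 2%:R * y%:R ^+ 2 / P =
    P ^ (- (l.+1 + l)%:Z) * (Q.[(p ^ l * y)%:R] - b / 2%:R * (p ^ l * y)%:R ^+ 2).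
  rewrite -invr_expz -exprnP mulrBr [_^-1 * Q.[_]]mulrC; congr (_ - _).
  rewrite natrM natrX addSn [P ^+ (l + l).+1]exprS exprD; apply: quadratic_rescale.
    exact: padic_p_neq0.
  by rewrite expf_neq0// padic_p_neq0.
apply/ord_ge_expzM; rewrite sub0r opprK.
have -> : Q.[(p ^ l * y)%:R] - b / 2%:R * (p ^ l * y)%:R ^+ 2 =
  Q.[(p ^ l * y)%:R] - u%:Qp / 2%:R * (p ^ l * y)%:R ^+ 2
    + (u%:Qp - b) / 2%:R * (p ^ l * y)%:R ^+ 2.
  by move: (2%:R^-1) (Q.[_]) => h q; ring.
apply: ord_geD; last first.
  rewrite natrM natrX exprMn -exprM muln2 mulrA.
  apply: ord_geMZp; last by apply: ord_geX; exact: ord_ge_nat.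
  (* At p = 2 the denominator of b/2 costs one order, which is why u and b must agree modulo 4
     there. *)
  have -> : (l.+1 + l)%:Z = 1 + (p == 2%N)%:Z - (logn p 2)%:Z + l.*2%:Z.
    have [->|p2] := eqVneq p 2%N; first by rewrite logn_prime//=; lia.
    by rewrite logn_coprime ?prime_coprime ?dvdn_prime2//=; lia.
  rewrite exprnP; apply: ord_geM; last exact: ord_ge_expz.
  by apply: ord_geM => //; exact: ord_ge_invn.
apply: critical_horner_ord => j j2; rewrite natrM natrX exprMn -exprM mulrA.
apply: ord_geMZp; last by apply: ord_geX; exact: ord_ge_nat.
(* For l = 0 the argument carries no power of p and the coefficients are small by assumption; for l
   > 0 the factor p^(l j) beats the denominator j. *)
case: (posnP l) => [l0|l0].
  rewrite l0 mul0n expr0 mulr1; exact: Qsmall.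
have -> : (l.+1 + l)%:Z = 1 - (logn p j)%:Z + ((l.+1 + l)%:Z - 1 + (logn p j)%:Z) by lia.
rewrite critical_coef//; apply: ord_geM.
  by apply: ord_geM; [apply: Tk; lia|apply: ord_ge_invn; lia].
rewrite exprnP; apply: ord_geW (ord_ge_expz _ _).
by have := logn_leq_sub2 p_pr j2; nia.
Qed.

(* For p = 2 the factor 1/2 in Q(x) = u x^2 / 2 moves the only surviving residue
   modulo 2^l from 0 to 2^(l - 1). *)
Lemma sum_critical_even2 l b : p = 2%N -> (1 < l)%N ->
  (forall k, (0 < k)%N -> ord_ge k%:Z T`_k) ->
  ord_ge 3 (u%:Qp - b) ->
  \sum_(h < p ^ (l + l)) e (Q.[h%:R] / P ^+ (l + l)) = (p ^ l)%:R * e (b / 8%:R).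
Proof.
move=> p2 l1 Tkk ub; have Pm k : P ^+ k != 0 by rewrite expf_neq0// padic_p_neq0.
have l0 : (0 < l)%N by lia.
have P2 : P = 2%:R := congr1 (fun k => k%:R : Qp) p2.
have n2 : (2%:R : Qp) != 0 by rewrite padic_natr_eq0.
(* The quadratic Taylor term contributes u z^2/2 and cannot be dropped. Since (z^2 - z)/2 is an
   integer it acts like the linear term u z/2, which is the summand p^(l-1) u. *)
pose D (x : nat) := P ^ (- l%:Z) * (Q^`().[x%:R] + P ^+ l.-1 * u%:Qp).
(* The class of Q''(x)/2 modulo Z_2 is u/2 at every x because T_k is even for k > 0. *)
have Nx (x : nat) : ord_ge 0 (Q^`N(2).[x%:R] - u%:Qp / 2%:R).
  have -> : u%:Qp / 2%:R = (u%:Qp / 2%:R)%:P.[x%:R] by rewrite hornerC.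
  rewrite -hornerN -hornerD; apply: ord_ge_horner; last exact: ord_ge_nat.
  case=> [|k]; rewrite coefB coefC/= coef_nderivn.
    by rewrite mulr1n critical_coef2 subrr; exact: ord_ge0r.
  rewrite subr0; have -> : Q`_(2 + k.+1) *+ 'C(2 + k.+1, 2) = 2%:R^-1 * (T`_k.+1 *+ k.+2).
    apply: (canRL (mulKf n2)); rewrite mulr_natl -mulrnA.
    have -> : T`_k.+1 = Q^`()`_k.+2 by rewrite QT coefXM.
    rewrite coef_deriv -mulrnA; congr (_ *+ _).
    rewrite addSn add1n bin2/=; have := odd_double_half (k.+3 * k.+2).
    by rewrite -muln2 oddM /= negbK; case: (odd k); lia.
  rewrite -(addNr 1); apply: ord_geM; last by apply: ord_geMn; exact: Tk.
  by rewrite -P2 -[P^-1]exprN1; exact: ord_ge_expz.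
have PE : P ^+ l = 2%:R * P ^+ l.-1 by rewrite -{1}(prednK l0) exprS P2.
rewrite (@padic_e_sum_split (fun h => e (Q.[h%:R] / P ^+ (l + l))) D); first last.
- move=> x z; rewrite -padic_eD; apply: eq_padic_e.
  have := poly_taylor2 l0 critical_deriv_coef (ord_ge_nat p_pr x) (ord_ge_nat p_pr z).
  rewrite natrD natrM natrX /D -addnn add0r.
  have := Nx x; move: (Q.[_ + _]) (Q.[x%:R]) (Q^`().[x%:R]) (Q^`N(2).[_]).
  move=> A B B' B'' B''u H.
  have -> : P ^ (- l%:Z) = (P ^+ l)^-1 by rewrite -invr_expz.
  rewrite exprD PE -[_ *+ z]mulr_natr (taylor2_rescale _ _ _ B'')//.
  apply: ord_geD.
    apply: ord_geD; last by apply: ord_geMZp => //; apply: ord_geX; exact: ord_ge_nat.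
    rewrite -PE -exprD exprnP invr_expz; apply/ord_ge_expzM.
    by rewrite sub0r opprK.
  apply: ord_geMZp; first exact: ord_ge_Zp.
  suff -> : (z%:R ^+ 2 - z%:R) / 2%:R = 'C(z, 2)%:R :> Qp by exact: ord_ge_nat.
  apply: (canLR (mulfK n2)); rewrite -natrM -natrX; apply/(canLR (addrK _)).
  rewrite -natrD; congr (_%:R); elim: z {H} => // z' IH.
  by rewrite binS bin1; move: IH; rewrite !expnS !expn0; lia.
- move=> x; apply: ord_geMZp; first exact: ord_ge_expz.
  apply: ord_geD; last first.
    by apply: ord_geMZp; [apply: ord_geX; exact: ord_ge_nat|exact: ord_ge_Zp].
  by apply/(critical_deriv_ord x 0); rewrite expn0 dvd1n.
have x0P : (p ^ l.-1 < p ^ l)%N by rewrite ltn_exp2l ?prime_gt1//; lia.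
(* Integrality of [D x] means that 2^l divides x T(x) + 2^(l-1) u. This forces 2^(l-1) to divide x,
   so x is 0 or 2^(l-1), and 0 is excluded because u is a unit. *)
have DP (x : 'I_(p ^ l)) : `[< ord_ge 0 (D x) >] = (x == Ordinal x0P).
  rewrite /D; apply/asboolP/eqP => [|->].
    rewrite ord_ge_expzM sub0r opprK => H.
    have /critical_deriv_ord/dvdnP[k xE] : ord_ge l.-1%:Z Q^`().[x%:R].
      rewrite -(addrK (P ^+ l.-1 * u%:Qp) Q^`().[_]); apply: ord_geB.
        by apply: ord_geW H; lia.
      by apply: ord_geMZp; [exact: ord_ge_expz|exact: ord_ge_Zp].
    have k2 : (k < 2)%N.
      have := ltn_ord x; rewrite xE -[X in (_ < p ^ X)%N](prednK l0) expnS p2.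
      by rewrite ltn_mul2r => /andP[].
    apply: val_inj; rewrite /= xE; case: k k2 xE => [_ xE|[_ _|//]]; last by rewrite mul1n.
    case: (ord_ge_unit1 uu); move: H; rewrite xE QT hornerM hornerX mul0n mul0r add0r.
    have le1 : 1 <= l%:Z - l.-1%:Z by clear -l0; lia.
    by rewrite [P ^+ l.-1]exprnP ord_ge_expzM; apply: ord_geW.
  rewrite ord_ge_expzM sub0r opprK QT hornerM hornerX/= natrX -mulrDr exprnP.
  rewrite ord_ge_expzM (_ : l%:Z - l.-1%:Z = 1); last by lia.
  have := critical_cofactor (p ^ l.-1); rewrite natrX.
  move: T.[_] => t tu; have -> : t + u%:Qp = t - u%:Qp + P * u%:Qp by rewrite P2; ring.
  by apply: ord_geD => //; apply: ord_geMZp; [exact: (ord_ge_expz p_pr 1)|exact: ord_ge_Zp].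
rewrite (eq_bigl _ _ DP) big_pred1_eq/=; congr (_ * _); apply: eq_padic_e.
(* The value at 2^(l-1), divided by 2^(2l), is u/8 up to an integer. The point has order only l - 1,
   so T_k has to supply 2^k for the higher terms to vanish. *)
have Qx : ord_ge (l + l)%:Z (Q.[(p ^ l.-1)%:R] - u%:Qp / 2%:R * (p ^ l.-1)%:R ^+ 2).
  apply: critical_horner_ord => j j2; rewrite natrX -exprM critical_coef//.
  have -> : (l + l)%:Z = j.-2%:Z - (logn p j)%:Z + ((l + l)%:Z - j.-2%:Z + (logn p j)%:Z) by lia.
  apply: ord_geM; first by apply: ord_geM; [apply: Tkk; lia|apply: ord_ge_invn; lia].
  rewrite exprnP; apply: ord_geW (ord_ge_expz _ _).
  (* For l = 2 and j = 3 there is no slack, and the exact value v_2(3) = 0 is required. *)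
  have := logn_leq_sub2 p_pr j2; have [->|j3] := eqVneq j 3%N; last by nia.
  by rewrite logn_coprime ?p2//; lia.
have -> : Q.[(p ^ l.-1)%:R] / P ^+ (l + l) - b / 8%:R =
    P ^ (- (l + l)%:Z) * (Q.[(p ^ l.-1)%:R] - u%:Qp / 2%:R * (p ^ l.-1)%:R ^+ 2)
      + P ^ (- 3) * (u%:Qp - b).
  rewrite -!invr_expz -!exprnP natrX exprD PE P2; apply: eighth_rescale => //.
  by rewrite expf_neq0// -P2 padic_p_neq0.
apply: ord_geD; first by apply/ord_ge_expzM; rewrite sub0r opprK.
by apply/ord_ge_expzM; rewrite sub0r opprK.
Qed.

End CriticalPoint.

End QuadraticSums.

(** * Normalised quadratic Gauss sums *)

Section GaussFactor.
Variables (R : realType) (p : nat) (p_pr : prime p).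
Local Notation Zp := (padic_int p_pr).
Local Notation Qp := (padic p_pr).
Local Notation e := (@padic_e p p_pr R).
Local Notation P := (p%:R : Qp).
Local Notation C := (complex R).
Local Notation sqrtp := (real_complex R (Num.sqrt p%:R)).

(** For a unit b this is the Gauss sum of b x^2/2 modulo p^L divided by p^(L/2), which depends on L
    only through its parity. *)
Definition gauss_factor (is_odd : bool) (b : Qp) : C :=
  if is_odd then (\sum_(y < p) e (b / 2%:R * y%:R ^+ 2 / P)) / sqrtp
  else if p == 2%N then e (b / 8%:R) else 1.

Lemma sqr_sqrtp : sqrtp ^+ 2 = p%:R.
Proof. by rewrite -rmorphXn/= sqr_sqrtr ?ler0n// rmorph_nat. Qed.

Lemma sqrtp_neq0 : sqrtp != 0.
Proof.
by rewrite -sqrf_eq0 sqr_sqrtp pnatr_eq0 -lt0n prime_gt0.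
Qed.

(** The sum is 1 + w with w = e(u/4); from w^2 = -1 the squared norm is (1 + w)(1 - w) = 2. *)
Lemma gauss_sum2_norm (u : Zp) : p = 2%N -> u \is a GRing.unit ->
  `|\sum_(y < p) e (u%:Qp / 2%:R * y%:R ^+ 2 / P)| ^+ 2 = p%:R :> C.
Proof.
move=> p2 uu; have P2 : P = 2%:R := congr1 (fun k => k%:R : Qp) p2.
have n2 : (2%:R : Qp) != 0 by rewrite padic_natr_eq0.
rewrite -(big_mkord xpredT (fun y => e (u%:Qp / 2%:R * y%:R ^+ 2 / P))).
rewrite [X in \sum_(0 <= _ < X) _]p2 big_nat_recr//= big_nat1.
rewrite expr0n expr1n mulr0 mul0r mulr1 padic_e_int; last exact: ord_ge0r.
set w := e _; have w2 : w ^+ 2 = -1.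
  have w4 : (w ^+ 2) ^+ 2 = 1.
    rewrite -exprM -padic_eMn padic_e_int// -[_ *+ (2 * 2)]mulr_natr natrM P2 mulrA.
    by rewrite divfK// divfK//; exact: ord_ge_Zp.
  have wn1 : w ^+ 2 != 1.
    rewrite -padic_eMn padic_e_neq1// -[_ / P *+ 2]mulr_natr mulrAC divfK// mulrC.
    rewrite -[P^-1]exprN1 => /ord_ge_expzM; rewrite sub0r opprK.
    exact: ord_ge_unit1.
  by apply/eqP; move/eqP: w4; rewrite sqrf_eq1 (negPf wn1).
have w0 : w != 0 by rewrite -normr_eq0 norm_padic_e oner_eq0.
have wJ : conjc w = - w.
  apply: (mulfI w0); rewrite -sqr_normc norm_padic_e expr1n mulrN -expr2 w2.
  by rewrite opprK.
have wJ1 : conjc (1 + w) = 1 - w.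
  by rewrite (rmorphD (@conjc R)) (rmorph1 (@conjc R)); congr (_ + _).
by rewrite sqr_normc wJ1 mulrC -subr_sqr expr1n w2 opprK p2.
Qed.

Lemma gauss_factor_norm is_odd (u : Zp) : u \is a GRing.unit ->
  `|gauss_factor is_odd u%:Qp| = 1.
Proof.
move=> uu; rewrite /gauss_factor; case: is_odd; last first.
  by case: (p == 2%N); rewrite ?norm_padic_e ?normr1.
have Sp : `|\sum_(y < p) e (u%:Qp / 2%:R * y%:R ^+ 2 / P)| ^+ 2 = p%:R :> C.
  have [p2|p2] := eqVneq p 2%N; first exact: gauss_sum2_norm.
  have u2 : (2%:R : Zp) \is a GRing.unit.
    apply: padic_int_unit; rewrite residue_nat expn1; apply/eqP => /dvdz_mod0P.
    by rewrite dvdzE/= dvdn_prime2// (negPf p2).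
  have -> : u%:Qp / 2%:R = (u / 2%:R)%:Qp.
    by rewrite [RHS]rmorphM/= padic_of_intV// rmorph_nat.
  by apply: quadratic_gauss_norm => //; rewrite unitrMl ?unitrV.
apply/eqP; rewrite -sqrp_eq1//; apply/eqP.
rewrite normrM exprMn Sp normfV exprVn -normrX sqr_sqrtp normr_nat.
by rewrite divff// pnatr_eq0 -lt0n prime_gt0.
Qed.

Section CriticalSum.
Variables (Q T : {poly Qp}) (u : Zp) (b : Qp).
Hypotheses (uu : u \is a GRing.unit) (QT : Q^`() = 'X * T) (Q0 : Q`_0 = 0).
Hypotheses (T0 : T`_0 = u%:Qp) (Tk : forall k, (0 < k)%N -> ord_ge 1 T`_k).

Lemma critical_sum L : (0 < L)%N ->
  (if odd L then ord_ge (1 + (p == 2%N)%:Z) (u%:Qp - b) /\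
     (L = 1%N -> forall j, (2 < j)%N -> ord_ge 1 Q`_j)
   else p = 2%N -> [/\ (2 < L)%N, forall k, (0 < k)%N -> ord_ge k%:Z T`_k
     & ord_ge 3 (u%:Qp - b)]) ->
  \sum_(h < p ^ L) e (Q.[h%:R] / P ^+ L) = gauss_factor (odd L) b * sqrtp ^+ L.
Proof.
rewrite /gauss_factor; have [l [c ->]] : exists l (c : bool), L = (c + (l + l))%N.
  by exists L./2, (odd L); rewrite addnn odd_double_half.
have -> : odd (c + (l + l)) = c by rewrite oddD addnn odd_double addbF oddb.
case: c => [_ [ub Qs]|l0 H].
  rewrite (_ : (true + (l + l) = l.+1 + l)%N)// (sum_critical_odd R uu QT Q0 T0 Tk ub); last first.
    by move=> l0; apply: Qs; rewrite l0.
  have -> : sqrtp ^+ (l.+1 + l) = sqrtp * (p ^ l)%:R.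
    by rewrite addSn exprS addnn -mul2n exprM sqr_sqrtp natrX.
  by rewrite mulrA divfK ?sqrtp_neq0// mulrC.
have -> : sqrtp ^+ (false + (l + l)) = (p ^ l)%:R.
  by rewrite add0n addnn -mul2n exprM sqr_sqrtp natrX.
rewrite add0n in l0 H *; case: eqVneq H => [p2 /(_ p2)[l2 Tkk ub]|p2 _].
  by rewrite (sum_critical_even2 R uu QT Q0 T0 Tk p2 _ Tkk ub) 1?mulrC//; lia.
by rewrite (sum_critical_even R uu QT Q0 T0 Tk)// ?mul1r//; lia.
Qed.

End CriticalSum.

End GaussFactor.

(** * Compositional inverses of power series *)

Section PolyOrder.
Variable F : fieldType.

Lemma coef_dvdpXn K (A : {poly F}) j : 'X^K %| A -> (j < K)%N -> A`_j = 0.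
Proof. by move=> /dvdpP[q ->] jK; rewrite coefMXn jK. Qed.

Lemma dvdpXn_coef K (A : {poly F}) : (forall j, (j < K)%N -> A`_j = 0) -> 'X^K %| A.
Proof.
move=> A0; rewrite -[A](poly_take_drop K) dvdp_addr ?dvdp_mull//.
rewrite (_ : take_poly K A = 0) ?dvdp0//; apply/polyP => j.
by rewrite coef_take_poly coef0; case: ltnP => // /A0.
Qed.

End PolyOrder.

(** * Real lower bounds for orders and weights of polynomials *)

Section RealOrder.
Variables (R : realType) (p : nat) (p_pr : prime p).
Local Notation Qp := (padic p_pr).
Implicit Types (x y : Qp) (c d : R).

(** Real bounds add up exactly under products, which their ceilings do not; [rord_ge_ceil] returns
    to the form used in [I0_lam]. *)
Definition rord_ge c x : Prop := exists2 m : int, c <= m%:~R & ord_ge m x.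

Lemma ord_ge_rord (m : int) c x : c <= m%:~R -> ord_ge m x -> rord_ge c x.
Proof. by move=> cm mx; exists m. Qed.

Lemma rord_ge_ord (m : int) c x : m%:~R - 1 < c -> rord_ge c x -> ord_ge m x.
Proof.
move=> mc [k ck]; apply: ord_geW.
by rewrite -ltzD1 -(ltr_int R) rmorphD/= -ltrBlDr; exact: lt_le_trans ck.
Qed.

Lemma rord_ge_ceil c x : rord_ge c x <-> ord_ge (Num.ceil c) x.
Proof.
split; first by apply: rord_ge_ord; have := ceilB1_lt c; rewrite rmorphB.
by apply: ord_ge_rord; exact: ceil_ge.
Qed.

Lemma rord_geW c d x : d <= c -> rord_ge c x -> rord_ge d x.
Proof. by move=> dc [m cm mx]; exists m => //; exact: le_trans cm. Qed.

Lemma rord_ge0r c : rord_ge c 0.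
Proof. by exists (Num.ceil c); [exact: ceil_ge|exact: ord_ge0r]. Qed.

Lemma rord_geD c x y : rord_ge c x -> rord_ge c y -> rord_ge c (x + y).
Proof. by move=> /rord_ge_ceil cx /rord_ge_ceil cy; apply/rord_ge_ceil/ord_geD. Qed.

Lemma rord_geN c x : rord_ge c x -> rord_ge c (- x).
Proof. by move=> [m cm mx]; exists m => //; exact: ord_geN. Qed.

Lemma rord_geM c d x y : rord_ge c x -> rord_ge d y -> rord_ge (c + d) (x * y).
Proof.
move=> [m cm mx] [k dk ky]; exists (m + k); last exact: ord_geM.
by rewrite rmorphD lerD.
Qed.

Lemma rord_ge_sum c (I : Type) (r : seq I) (Q : pred I) (F : I -> Qp) :
  (forall i, Q i -> rord_ge c (F i)) -> rord_ge c (\sum_(i <- r | Q i) F i).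
Proof. by move=> FP; elim/big_ind: _ => //; [exact: rord_ge0r|exact: rord_geD]. Qed.

Lemma rord_geMZp c x y : ord_ge 0 x -> rord_ge c y -> rord_ge c (x * y).
Proof.
by move=> x0 cy; rewrite -(add0r c); apply: rord_geM => //; exact: ord_ge_rord x0.
Qed.

Section Weight.
Variable lam : R.
Implicit Types A B : {poly Qp}.

(** A lower bound c for the Gauss valuation min_k (ord A_k - k lam), so bounds add under
    multiplication. *)
Definition weight_ge c A : Prop := forall k, rord_ge (c + k%:R * lam) A`_k.

Lemma weight_geD c A B : weight_ge c A -> weight_ge c B -> weight_ge c (A + B).
Proof. by move=> cA cB k; rewrite coefD; exact: rord_geD. Qed.

Lemma weight_geN c A : weight_ge c A -> weight_ge c (- A).
Proof. by move=> cA k; rewrite coefN; exact: rord_geN. Qed.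

Lemma weight_geW c d A : d <= c -> weight_ge c A -> weight_ge d A.
Proof. by move=> dc cA k; apply: rord_geW (cA k); rewrite lerD2r. Qed.

Lemma weight_geM c d A B : weight_ge c A -> weight_ge d B -> weight_ge (c + d) (A * B).
Proof.
move=> cA dB k; rewrite coefM; apply: rord_ge_sum => j _.
have -> : c + d + k%:R * lam = c + (j : nat)%:R * lam + (d + (k - j)%:R * lam).
  by rewrite natrB ?leq_ord//; ring.
exact: rord_geM.
Qed.

Lemma weight_geZ c d x A : rord_ge c x -> weight_ge d A -> weight_ge (c + d) (x *: A).
Proof. by move=> cx dA k; rewrite coefZ -addrA; exact: rord_geM. Qed.

Lemma weight_ge_sum c (I : Type) (r : seq I) (Q : pred I) (F : I -> {poly Qp}) :
  (forall i, Q i -> weight_ge c (F i)) -> weight_ge c (\sum_(i <- r | Q i) F i).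
Proof.
move=> FP; elim/big_ind: _ => //; [|exact: weight_geD].
by move=> k; rewrite coef0; exact: rord_ge0r.
Qed.

Lemma weight_geX c A n : weight_ge c A -> weight_ge (n%:R * c) (A ^+ n).
Proof.
move=> cA; elim: n => [|n IH]; last first.
  by rewrite exprS -natr1 mulrDl mul1r addrC; exact: weight_geM.
rewrite mul0r expr0 => k; rewrite coef1 add0r.
case: k => [|k]; last exact: rord_ge0r.
by rewrite mul0r; apply: (@ord_ge_rord 0) => //; exact: (ord_ge_nat p_pr 1).
Qed.

End Weight.

End RealOrder.

(** * Inverse series by fixed-point iteration *)

Section FormalInverse.
Variables (R : realType) (p : nat) (p_pr : prime p).
Local Notation Qp := (padic p_pr).
Local Notation P := (p%:R : Qp).
Implicit Types (B : nat -> Qp) (X Y : {poly Qp}) (c : Qp) (K : nat).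

Definition comp_tail m B K X : {poly Qp} := \sum_(m <= k < K) B k *: X ^+ k.

Definition inverse_step B c K X : {poly Qp} :=
  (B 1%N)^-1 *: (c *: 'X - comp_tail 2 B K X).

(* The m-th iterate solves B_1 X + B_2 X^2 + ... = c t modulo t^(m+1). *)
Definition inverse_iter B c K m : {poly Qp} := iter m (inverse_step B c K) 0.

(** The k-th coefficient is stable from this iterate and this truncation on, as [inverse_iter_coef]
    shows. *)
Definition inverse_coef B c k : Qp := (inverse_iter B c k.+1 k.+1)`_k.

(** The cofactor of X - Y in X^k - Y^k is a sum of products of k - 1 >= 1 factors without constant
    term. The extra power of 'X makes [inverse_step] a contraction. *)
Lemma dvdp_subXn X Y j k : 'X %| X -> 'X %| Y -> 'X^j %| X - Y -> (1 < k)%N ->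
  'X^(j.+1) %| X ^+ k - Y ^+ k.
Proof.
move=> XX XY XXY k1; rewrite subrXX exprSr; apply: dvdp_mul => //.
rewrite -(big_mkord xpredT (fun i => X ^+ (k.-1 - i) * Y ^+ i)).
apply: (big_ind (fun A => 'X %| A)); [exact: dvdp0|exact: dvdp_add|move=> i _].
have [->|i0] := posnP i.
  rewrite subn0 expr0 mulr1 -(prednK (_ : 0 < k.-1)%N); last by lia.
  by rewrite exprS; exact: dvdp_mulr.
by rewrite -(prednK i0) exprS; apply: dvdp_mull; exact: dvdp_mulr.
Qed.

Lemma dvdp_comp_tail B K X Y j : 'X %| X -> 'X %| Y -> 'X^j %| X - Y ->
  'X^(j.+1) %| comp_tail 2 B K X - comp_tail 2 B K Y.
Proof.
move=> XX XY XXY; rewrite /comp_tail -sumrB big_nat_cond.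
apply: (big_ind (fun A => 'X^(j.+1) %| A)); [exact: dvdp0|exact: dvdp_add|].
move=> k /andP[/andP[k1 _] _]; rewrite -scalerBr -mul_polyC; apply: dvdp_mull.
exact: dvdp_subXn.
Qed.

Lemma dvdp_comp_tail0 B m K X : 'X %| X -> 'X^m %| comp_tail m B K X.
Proof.
move=> XX; rewrite /comp_tail big_nat_cond.
apply: (big_ind (fun A => 'X^m %| A)); [exact: dvdp0|exact: dvdp_add|].
move=> k /andP[/andP[k1 _] _]; rewrite -mul_polyC; apply: dvdp_mull.
by rewrite -(subnK k1) exprD; apply: dvdp_mull; exact: dvdp_exp2r.
Qed.

Lemma dvdp_comp_tail_trunc B m K K' X : (m <= K)%N -> (K <= K')%N -> 'X %| X ->
  'X^K %| comp_tail m B K' X - comp_tail m B K X.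
Proof.
move=> mK KK' XX; rewrite /comp_tail (big_cat_nat mK KK')/= [X in X - _]addrC addrK.
exact: dvdp_comp_tail0.
Qed.

Lemma inverse_iter_dvdX B c K m : 'X %| inverse_iter B c K m.
Proof.
elim: m => [|m IH]; first exact: dvdp0.
rewrite /= /inverse_step -mul_polyC; apply: dvdp_mull; apply: dvdp_sub.
  by rewrite -mul_polyC dvdp_mull.
apply: dvdp_trans (dvdp_comp_tail0 B 2 K IH).
by rewrite exprS expr1 dvdp_mulr.
Qed.

Lemma inverse_iterS B c K m : B 1%N != 0 ->
  B 1%N *: inverse_iter B c K m.+1 = c *: 'X - comp_tail 2 B K (inverse_iter B c K m).
Proof. by move=> B1; rewrite /= /inverse_step scalerA mulfV// scale1r. Qed.

Lemma inverse_iter_cauchy B c K m :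
  'X^(m.+1) %| inverse_iter B c K m.+1 - inverse_iter B c K m.
Proof.
elim: m => [|m IH]; first by rewrite subr0; exact: inverse_iter_dvdX.
rewrite [X in X - _]/= [X in _ - X]/= /inverse_step -scalerBr.
rewrite opprB [X in _ *: X]addrC addrA subrK -mul_polyC; apply: dvdp_mull.
rewrite -[X in _ %| X]opprB dvdpNr -/(inverse_step _ _ _ _).
rewrite -[inverse_step _ _ _ _]/(inverse_iter B c K m.+1).
exact: (dvdp_comp_tail B K (inverse_iter_dvdX B c K m.+1) (inverse_iter_dvdX B c K m) IH).
Qed.

Lemma inverse_iterP B c K m : B 1%N != 0 ->
  'X^(m.+1) %| B 1%N *: inverse_iter B c K m +
             comp_tail 2 B K (inverse_iter B c K m) - c *: 'X.
Proof.
move=> B1; have := inverse_iter_cauchy B c K m.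
have : c *: 'X = B 1%N *: inverse_iter B c K m.+1 + comp_tail 2 B K (inverse_iter B c K m).
  by rewrite inverse_iterS// subrK.
move: (inverse_iter B c K m.+1) (inverse_iter B c K m) (comp_tail _ _ _ _) => X Y A -> XY.
rewrite opprD addrACA subrr addr0 -scalerBr -mul_polyC; apply: dvdp_mull.
by rewrite -[X in _ %| X]opprB dvdpNr.
Qed.

Lemma inverse_uniq B K M X Y : B 1%N != 0 -> 'X %| X -> 'X %| Y ->
  'X^M %| B 1%N *: X + comp_tail 2 B K X - (B 1%N *: Y + comp_tail 2 B K Y) ->
  'X^M %| X - Y.
Proof.
move=> B1 XX XY H; suff : forall j, (j <= M)%N -> 'X^j %| X - Y by apply.
elim=> [_|j IH jM]; first by rewrite expr0 dvd1p.
have E : X - Y = (B 1%N)^-1 *: ((B 1%N *: X + comp_tail 2 B K X - (B 1%N *: Y + comp_tail 2 B K Y))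
   - (comp_tail 2 B K X - comp_tail 2 B K Y)).
  apply: (canRL (scalerK B1)); rewrite scalerBr.
  move: (_ *: X) (_ *: Y) (comp_tail _ _ _ X) (comp_tail _ _ _ Y) => X' Y' S S'.
  by rewrite [RHS]addrC -[X' + S]addrC; ring.
rewrite E -mul_polyC; apply: dvdp_mull; apply: dvdp_sub.
  exact: dvdp_trans (dvdp_exp2l _ jM) H.
by apply: dvdp_comp_tail => //; apply: IH; exact: ltnW.
Qed.

Definition inverse_poly B c K : {poly Qp} := \poly_(k < K) inverse_coef B c k.

Lemma inverse_iter_coef B c K j : B 1%N != 0 -> (j < K)%N ->
  (inverse_iter B c K K)`_j = inverse_coef B c j.
Proof.
move=> B1 jK; apply/eqP; rewrite -subr_eq0 -coefB; apply/eqP.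
apply: (@coef_dvdpXn _ j.+1) => //; case: j jK => [|j] jK.
  by rewrite expr1; apply: dvdp_sub; exact: inverse_iter_dvdX.
apply: (@inverse_uniq B j.+2) => //; try exact: inverse_iter_dvdX.
have H1 := inverse_iterP c j.+2 j.+2 B1.
have H2 := inverse_iterP c K K B1.
have H3 := dvdp_comp_tail_trunc B (isT : (2 <= j.+2)%N) jK (inverse_iter_dvdX B c K K).
have {}H2 := dvdp_trans (dvdp_exp2l 'X (leqW jK)) H2.
have {}H1 := dvdp_trans (dvdp_exp2l 'X (leqnSn j.+2)) H1.
have := dvdp_sub (dvdp_sub H2 H3) H1; congr (is_true (_ %| _)).
by move: (_ *: inverse_iter _ _ K _) (_ *: inverse_iter _ _ j.+2 _) => X Y; ring.
Qed.

Lemma inverse_poly_iter B c K : B 1%N != 0 ->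
  'X^K %| inverse_poly B c K - inverse_iter B c K K.
Proof.
move=> B1; apply: dvdpXn_coef => j jK.
by rewrite coefB coef_poly jK inverse_iter_coef// subrr.
Qed.

Lemma inverse_coef0 B c : inverse_coef B c 0 = 0.
Proof.
have := inverse_iter_dvdX B c 1 1; rewrite -['X]expr1 => /coef_dvdpXn.
exact.
Qed.

Lemma inverse_poly_dvdX B c K : 'X %| inverse_poly B c K.
Proof.
rewrite -['X]expr1; apply: dvdpXn_coef => -[|//] _.
by rewrite coef_poly inverse_coef0; case: ifP.
Qed.

Lemma comp_tail1 B K X : (1 < K)%N ->
  comp_tail 1 B K X = B 1%N *: X + comp_tail 2 B K X.
Proof. by move=> K1; rewrite /comp_tail big_ltn// expr1. Qed.

Lemma inverse_polyP B c K : B 1%N != 0 -> (1 < K)%N ->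
  'X^K %| comp_tail 1 B K (inverse_poly B c K) - c *: 'X.
Proof.
move=> B1 K1; rewrite comp_tail1//.
have H := dvdp_trans (dvdp_exp2l 'X (leqnSn K)) (inverse_iterP c K K B1).
have H' := dvdp_trans (dvdp_exp2l 'X (leqnSn K)) (dvdp_comp_tail B K
  (inverse_poly_dvdX B c K) (inverse_iter_dvdX B c K K) (inverse_poly_iter c K B1)).
have H'' := dvdp_mull (B 1%N)%:P (inverse_poly_iter c K B1).
have := dvdp_add (dvdp_add H'' H') H; congr (is_true (_ %| _)).
rewrite mul_polyC scalerBr.
by move: (_ *: inverse_poly _ _ _) (_ *: inverse_iter _ _ _ _) => X Y; ring.
Qed.

(** Serves to recognise the abstract inverse as an explicit series, namely the binomial one. *)
Lemma inverse_coef_uniq B c (Y : nat -> Qp) : B 1%N != 0 -> Y 0%N = 0 ->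
  (forall K, (1 < K)%N -> 'X^K %| comp_tail 1 B K (\poly_(k < K) Y k) - c *: 'X) ->
  forall k, inverse_coef B c k = Y k.
Proof.
move=> B1 Y0 YP k; pose K := k.+2; have K1 : (1 < K)%N by [].
have YX : 'X %| \poly_(j < K) Y j.
  by rewrite -['X]expr1; apply: dvdpXn_coef => -[|//] _; rewrite coef_poly Y0.
have : 'X^K %| inverse_poly B c K - \poly_(j < K) Y j.
  apply: (inverse_uniq (K := K) B1 (inverse_poly_dvdX B c K) YX); rewrite -!comp_tail1//.
  have := dvdp_sub (inverse_polyP c B1 K1) (YP K K1); congr (is_true (_ %| _)).
  by rewrite opprB addrA subrK.
move=> /coef_dvdpXn => /(_ k); rewrite coefB !coef_poly /K ltnW// => /(_ isT)/eqP.
by rewrite subr_eq0 => /eqP.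
Qed.

Section InverseWeight.
Variables (lam : R) (B : nat -> Qp) (c : Qp).
Hypotheses (c0 : ord_ge 0 c) (B1 : ord_ge 0 (B 1%N)^-1) (B1n : B 1%N != 0).
Hypothesis Bk : forall k, (1 < k)%N -> rord_ge (k.-1%:R * lam) (B k).

(** The weight - lam reproduces itself: a term B_k X^k has weight at least (k - 1) lam - k lam = -
    lam. *)
Lemma inverse_iter_weight K m : weight_ge lam (- lam) (inverse_iter B c K m).
Proof.
elim: m => [|m IH]; first by move=> k; rewrite coef0; exact: rord_ge0r.
rewrite /= /inverse_step -[- lam]add0r; apply: weight_geZ.
  exact: (ord_ge_rord _ B1).
apply: weight_geD.
  move=> k; rewrite coefZ coefX; case: eqP => [->|_]; last by rewrite mulr0; exact: rord_ge0r.
  by rewrite mulr1 mul1r addNr; exact: (ord_ge_rord _ c0).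
apply: weight_geN; rewrite /comp_tail big_nat_cond.
apply: weight_ge_sum => k /andP[/andP[k1 _] _].
apply: weight_geW (weight_geZ (Bk k1) (weight_geX k IH)).
by rewrite -subn1 natrB 1?ltnW// mulrN; lra.
Qed.

Lemma inverse_coef_ord k : rord_ge (k%:R * lam - lam) (inverse_coef B c k).
Proof. by rewrite addrC; exact: inverse_iter_weight. Qed.

End InverseWeight.

(** Every term in the difference of two steps contains either a difference B_k - B'_k, which brings
    mu, or the difference of the previous iterates, which has it by induction. *)
Lemma inverse_iter_weight_sub (lam mu : R) B B' c K m :
  ord_ge 0 c -> ord_ge 0 (B 1%N)^-1 -> B 1%N != 0 ->
  ord_ge 0 (B' 1%N)^-1 -> B' 1%N != 0 ->
  (forall k, (1 < k)%N -> rord_ge (k.-1%:R * lam) (B k)) ->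
  (forall k, (1 < k)%N -> rord_ge (k.-1%:R * lam) (B' k)) ->
  (forall k, (0 < k)%N -> rord_ge (mu + k.-1%:R * lam) (B k - B' k)) ->
  weight_ge lam (mu - lam) (inverse_iter B c K m - inverse_iter B' c K m).
Proof.
move=> c0 B1 B1n B1' B1n' Bk Bk' BB'.
elim: m => [|m IH]; first by move=> k; rewrite subr0 coef0; exact: rord_ge0r.
have W := inverse_iter_weight c0 B1 Bk K.
have W' := inverse_iter_weight c0 B1' Bk' K.
have E : inverse_iter B c K m.+1 - inverse_iter B' c K m.+1 = (B 1%N)^-1 *:
    (- (B 1%N - B' 1%N) *: inverse_iter B' c K m.+1 -
      \sum_(2 <= k < K) (B k *: (inverse_iter B c K m ^+ k - inverse_iter B' c K m ^+ k)
         + (B k - B' k) *: inverse_iter B' c K m ^+ k)).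
  apply: (canRL (scalerK B1n)).
  have -> : \sum_(2 <= k < K) (B k *: (inverse_iter B c K m ^+ k - inverse_iter B' c K m ^+ k)
         + (B k - B' k) *: inverse_iter B' c K m ^+ k) =
     comp_tail 2 B K (inverse_iter B c K m) - comp_tail 2 B' K (inverse_iter B' c K m).
    rewrite /comp_tail -sumrB; apply: eq_bigr => k _.
    by rewrite scalerBr scalerBl addrA subrK.
  rewrite scalerBr (inverse_iterS _ _ _ B1n) scaleNr scalerBl (inverse_iterS _ _ _ B1n').
  move: (comp_tail _ _ _ _) (comp_tail _ _ _ _) (_ *: inverse_iter _ _ _ _) => S S' X.
  by ring.
rewrite E -[mu - lam]add0r; apply: weight_geZ; first exact: (ord_ge_rord _ B1).
apply: weight_geD.
  apply: weight_geZ => //; apply: rord_geN.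
  by have := BB' 1%N isT; rewrite mul0r addr0.
apply: weight_geN; rewrite big_nat_cond.
apply: weight_ge_sum => k /andP[/andP[k1 _] _].
have kE : k.-1%:R = k%:R - 1 :> R by rewrite -subn1 natrB// ltnW.
apply: weight_geD; last first.
  apply: weight_geW (weight_geZ (BB' k (ltnW k1)) (weight_geX k (W' m))).
  by rewrite kE; lra.
apply: (@weight_geW _ _ _ _ (k.-1%:R * lam + (mu - lam + k.-1%:R * (- lam)))).
  by lra.
apply: weight_geZ; first exact: Bk.
rewrite subrXX; apply: weight_geM => //; apply: weight_ge_sum => i _.
have := weight_geM (weight_geX (k.-1 - i) (W m)) (weight_geX i (W' m)).
apply: weight_geW; rewrite -mulrDl -natrD subnK//.
by have := ltn_ord i; lia.
Qed.

Lemma inverse_coef_sub (lam mu : R) B B' c k :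
  ord_ge 0 c -> ord_ge 0 (B 1%N)^-1 -> B 1%N != 0 ->
  ord_ge 0 (B' 1%N)^-1 -> B' 1%N != 0 ->
  (forall k, (1 < k)%N -> rord_ge (k.-1%:R * lam) (B k)) ->
  (forall k, (1 < k)%N -> rord_ge (k.-1%:R * lam) (B' k)) ->
  (forall k, (0 < k)%N -> rord_ge (mu + k.-1%:R * lam) (B k - B' k)) ->
  rord_ge (mu - lam + k%:R * lam) (inverse_coef B c k - inverse_coef B' c k).
Proof.
move=> c0 B1 B1n B1' B1n' Bk Bk' BB'.
by rewrite -coefB; exact: (inverse_iter_weight_sub k.+1 k.+1 c0 B1 B1n B1' B1n' Bk Bk' BB').
Qed.

End FormalInverse.

(** * Binomial series *)

Section BinomialSeries.
Implicit Types (al be : rat) (K : nat).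

Lemma gbinomS al k : gbinom al k.+1 *+ k.+1 = (al - k%:R) * gbinom al k.
Proof.
rewrite /gbinom big_ord_recr/= factS natrM invfM -[LHS]mulr_natr.
have k1 : (k.+1%:R : rat) != 0 by rewrite pnatr_eq0.
have f0 : (k`!%:R : rat) != 0 by rewrite pnatr_eq0 -lt0n fact_gt0.
move: (\prod_(_ < _) _) (al - _) k1 f0 => A B; move: (k.+1%:R) (k`!%:R) => s t s0 t0.
by field; rewrite s0 t0.
Qed.

Lemma gbinom0 al : gbinom al 0 = 1.
Proof. by rewrite /gbinom big_ord0 divr1. Qed.

Definition binom_poly al K : {poly rat} := \poly_(k < K) gbinom al k.

(** The differential equation of (1 + X)^al; the composition law below is deduced from it. *)
Lemma binom_poly_deriv al K :
  'X^K %| (1 + 'X) * (binom_poly al K.+1)^`() - al *: binom_poly al K.+1.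
Proof.
apply: dvdpXn_coef => j jK; rewrite coefB mulrDl mul1r coefD coefXM coefZ !coef_deriv.
rewrite !coef_poly ltnS jK (leqW jK); case: j jK => [|j] jK /=.
  by rewrite addr0 gbinomS subr0 subrr.
rewrite ltnS ltnW// gbinomS -[gbinom _ _ *+ _]mulr_natr.
by rewrite mulrBl [gbinom _ _ * _]mulrC subrK subrr.
Qed.

(** By the chain rule the composite E satisfies (1 + X) E' = E up to order K with E(0) = 1, and this
    recursion leaves only 1 + X. *)
Lemma binom_poly_comp al be K : al * be = 1 ->
  'X^(K.+1) %| binom_poly al K.+1 \Po (binom_poly be K.+1 - 1) - (1 + 'X).
Proof.
move=> ab; set A := binom_poly al _; set Z := _ - 1; set E := A \Po Z.
have ZX : 'X %| Z.
  rewrite -['X]expr1; apply: dvdpXn_coef => -[|//] _.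
  by rewrite coefB coef_poly coef1 gbinom0 subrr.
have dZ : 'X^K %| (1 + 'X) * Z^`() - be *: (1 + Z).
  have -> : 1 + Z = binom_poly be K.+1 by rewrite addrC subrK.
  by rewrite derivB derivC subr0; exact: binom_poly_deriv.
have dA : 'X^K %| (1 + Z) * (A^`() \Po Z) - al *: E.
  have /dvdpP[r rE] := binom_poly_deriv al K.
  have -> : (1 + Z) * (A^`() \Po Z) - al *: E = (r * 'X^K) \Po Z.
    by rewrite -rE comp_polyB comp_polyM comp_polyD comp_polyZ comp_polyX comp_polyC.
  by rewrite comp_polyM comp_Xn_poly; apply: dvdp_mull; exact: dvdp_exp2r.
(* Multiplying by 1 + Z, which is invertible modulo 'X^K, brings in both differential equations; al
   be = 1 leaves the exponent 1. *)
have dE : 'X^K %| (1 + 'X) * E^`() - E.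
  have cop : coprimep 'X^K (1 + Z).
    rewrite coprimep_expl// coprimep_sym coprimepX rootE hornerD hornerC.
    by have /dvdpP[r ->] := ZX; rewrite hornerM hornerX mulr0 addr0 oner_eq0.
  rewrite -(Gauss_dvdpr _ cop) deriv_comp.
  have := dvdp_add (dvdp_mulr ((1 + 'X) * Z^`()) dA) (dvdp_mull (al *: E) dZ).
  congr (is_true (_ %| _)); rewrite -!mul_polyC.
  have abC : al%:P * be%:P = 1 by rewrite -polyCM ab.
  have -> : ((1 + Z) * (A^`() \Po Z) - al%:P * E) * ((1 + 'X) * Z^`()) +
    al%:P * E * ((1 + 'X) * Z^`() - be%:P * (1 + Z)) =
    (1 + Z) * ((1 + 'X) * ((A^`() \Po Z) * Z^`())) - (al%:P * be%:P) * E * (1 + Z).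
    by move: (A^`() \Po Z) (Z^`()) => F G; ring.
  by rewrite abC; move: (A^`() \Po Z) (Z^`()) => F G; ring.
have E0 : E`_0 = 1.
  rewrite -horner_coef0 horner_comp; have /dvdpP[r ->] := ZX.
  by rewrite hornerM hornerX mulr0 horner_coef0 coef_poly gbinom0.
have ES j : (j < K)%N -> E`_j.+1 *+ j.+1 + E`_j *+ j = E`_j.
  move=> jK; have := coef_dvdpXn dE jK; rewrite coefB mulrDl mul1r coefD coefXM !coef_deriv.
  by move/eqP; rewrite subr_eq0 => /eqP; case: j jK => [|j] jK //=; rewrite mulr0n.
have E1 : (0 < K)%N -> E`_1 = 1.
  by move=> /ES; rewrite mulr1n mulr0n addr0 E0.
have E2 j : (j.+2 <= K)%N -> E`_j.+2 = 0.
  elim: j => [|j IH] jK; have := ES _ jK.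
    rewrite mulr1n => /(canRL (addrK _))/eqP.
    by rewrite subrr mulrn_eq0 => /eqP.
  by rewrite IH 1?ltnW// mul0rn addr0 => /eqP; rewrite mulrn_eq0 => /eqP.
apply: dvdpXn_coef => j; rewrite ltnS coefB coefD coef1 coefX.
case: j => [|[|j]] jK; first by rewrite E0 addr0 subrr.
  by rewrite E1// add0r subrr.
by rewrite E2// addr0 subrr.
Qed.

End BinomialSeries.

Section BinomialInverse.
Variables (p : nat) (p_pr : prime p).
Local Notation Qp := (padic p_pr).

(** The equation (d/q) ((1 + th x)^al - 1) = d t reads (1 + th x)^al = 1 + q t, so x = ((1 + q t)^be
    - 1)/th. *)
Lemma binom_series_inverse (al be : rat) (d q th : Qp) K :
  al * be = 1 -> q != 0 -> th != 0 -> (1 < K)%N ->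
  'X^K %| comp_tail 1 (fun k => q^-1 * d * (ratr (gbinom al k) * th ^+ k)) K
            (\poly_(k < K) (if k == 0%N then 0 else th^-1 * (ratr (gbinom be k) * q ^+ k)))
          - d *: 'X.
Proof.
move=> ab q0 th0; case: K => // K _.
set Y := \poly_(k < _) _; pose f := map_poly (@padic_of_rat p p_pr).
have fX : f (1 + 'X) = 1 + 'X by rewrite /f rmorphD rmorph1/= map_polyX.
have fB A A' : f (A - A') = f A - f A' by rewrite /f rmorphB.
pose Z := binom_poly be K.+1 - 1.
have YZ : th *: Y = f Z \Po (q *: 'X).
  apply/polyP => k; rewrite coefZ comp_polyE coef_sum coef_poly.
  rewrite (eq_bigr (fun i : 'I__ => if (i == k :> nat) then (f Z)`_k * q ^+ k else 0)); last first.
    move=> i _; rewrite exprZn coefZ coefZ coefXn eq_sym.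
    by case: eqP => [->|_]; rewrite ?mulr1 ?mulr0.
  have fZk : (f Z)`_k = if (k < K.+1)%N && (k != 0%N) then ratr (gbinom be k) else 0.
    rewrite coef_map/= coefB coef_poly coef1; case: k => [|k].
      by rewrite gbinom0 subrr rmorph0.
    by rewrite /= subr0 andbT; case: ifP => _; rewrite ?rmorph0.
  rewrite -big_mkcond/=; have [kf|kf] := ltnP k (size (f Z)).
    rewrite (big_pred1 (Ordinal kf)) => [|i]; last by [].
    rewrite fZk; case: (ltnP k K.+1) => kK /=; last by rewrite mulr0 mul0r.
    by case: eqVneq => [->|k0] /=; rewrite ?mulr0 ?mul0r// mulVKf.
  rewrite big1 => [|i /eqP ik]; last by move: kf; rewrite -ik leqNgt ltn_ord.
  have : (f Z)`_k = 0 by rewrite nth_default.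
  rewrite fZk; case: (ltnP k K.+1) => kK /=; last by rewrite mulr0.
  by case: eqVneq => [->|k0] /= => [_|->]; rewrite ?mul0r ?mulr0.
have -> : comp_tail 1 (fun k => q^-1 * d * (ratr (gbinom al k) * th ^+ k)) K.+1 Y =
    (q^-1 * d) *: (f (binom_poly al K.+1 \Po Z) \Po (q *: 'X) - 1).
  have -> : f (binom_poly al K.+1 \Po Z) \Po (q *: 'X) =
      \sum_(0 <= k < K.+1) ratr (gbinom al k) *: (th *: Y) ^+ k.
    rewrite /f map_comp_poly -comp_polyA -/f -YZ.
    have -> : f (binom_poly al K.+1) =
        \poly_(k < K.+1) (ratr (gbinom al k) : Qp).
      by apply/polyP => k; rewrite coef_map/= !coef_poly; case: ifP; rewrite ?rmorph0.
    rewrite poly_def (rmorph_sum (comp_poly _)) big_mkord.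
    by apply: eq_bigr => k _; rewrite [LHS]comp_polyZ comp_Xn_poly.
  rewrite big_ltn// expr0 gbinom0 [ratr 1]padic_ratrE rmorph1 scale1r addrAC subrr add0r.
  rewrite /comp_tail scaler_sumr; apply: eq_bigr => k _.
  by rewrite exprZn !scalerA mulrA.
have -> : d *: 'X = (q^-1 * d) *: (q *: 'X) :> {poly Qp}.
  by rewrite scalerA mulrAC mulVf// mul1r.
rewrite -scalerBr -mul_polyC; apply: dvdp_mull.
have /dvdpP[r rE] := binom_poly_comp K ab.
have -> : f (binom_poly al K.+1 \Po Z) \Po (q *: 'X) - 1 - q *: 'X =
    f (r * 'X^(K.+1)) \Po (q *: 'X).
  rewrite -rE -/Z fB fX comp_polyB comp_polyD comp_polyX -polyC1 comp_polyC.
  by rewrite opprD addrA.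
rewrite [f _]rmorphM/= map_polyXn comp_polyM comp_Xn_poly exprZn.
by rewrite -scalerAr -mul_polyC; apply: dvdp_mull; exact: dvdp_mull.
Qed.

End BinomialInverse.

(** * Orders of the coefficients of the binomial part of f' *)

Section BinomialValuation.
Variables (R : realType) (p : nat) (p_pr : prime p).
Local Notation Zp := (padic_int p_pr).
Local Notation Qp := (padic p_pr).
Local Notation P := (p%:R : Qp).

Lemma ord_ge_prod_sub m k (x x' : nat -> Qp) :
  (forall i, ord_ge 0 (x i)) -> (forall i, ord_ge 0 (x' i)) ->
  (forall i, ord_ge m (x i - x' i)) ->
  ord_ge m (\prod_(i < k) x i - \prod_(i < k) x' i).
Proof.
move=> x0 x0' xx'; elim: k => [|k IH]; first by rewrite !big_ord0 subrr; exact: ord_ge0r.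
rewrite !big_ord_recr/=.
have -> : (\prod_(i < k) x i) * x k - (\prod_(i < k) x' i) * x' k =
   (\prod_(i < k) x i - \prod_(i < k) x' i) * x k + (\prod_(i < k) x' i) * (x k - x' k).
  by move: (\prod_(_ < _) x _) (\prod_(_ < _) x' _) => A A'; ring.
apply: ord_geD; first exact: ord_geMZp.
apply: ord_geZpM => //; elim/big_ind: _ => //; first exact: (ord_ge_nat p_pr 1).
exact: ord_geMZp.
Qed.

Lemma prod_sub_ffact (c k : nat) : \prod_(i < k) (c%:R - i%:R) = (c ^_ k)%:R :> Qp.
Proof.
elim: k => [|k IH]; first by rewrite big_ord0.
rewrite big_ord_recr/= IH ffactnSr natrM; case: (leqP k c) => kc; first by rewrite natrB.
by rewrite ffact_small// !mul0r.
Qed.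

(** With al replaced by a natural number c close to it modulo p^(v(k!)), the numerator becomes c (c
    - 1) ... (c - k + 1), which k! divides. *)
Lemma gbinom_integral (al : rat) k : ord_ge 0 (ratr al : Qp) ->
  ord_ge 0 (ratr (gbinom al k) : Qp).
Proof.
move=> al0; rewrite /gbinom padic_ratrE rmorphM fmorphV/= rmorph_prod rmorph_nat.
have [u uu uE] := padic_nat_factor p_pr (fact_gt0 k).
rewrite uE invfM invr_expz mulrCA; apply/ord_ge_expzM; rewrite sub0r opprK.
apply: ord_geMZp; last by rewrite -padic_of_intV//; exact: ord_ge_Zp.
set v := logn p k`!.
have [c cP] := padic_approx_nat v al0.
pose x i : Qp := padic_of_rat p_pr (al - i%:R); pose x' i : Qp := c%:R - i%:R.
have xE i : x i = ratr al - i%:R by rewrite /x rmorphB/= rmorph_nat.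
have -> : \prod_(i < k) padic_of_rat p_pr (al - i%:R) = \prod_(i < k) x i by [].
rewrite -(subrK (\prod_(i < k) x' i) (\prod_(i < k) x i)); apply: ord_geD.
  apply: ord_ge_prod_sub => i; rewrite ?xE.
  - by apply: ord_geB => //; exact: ord_ge_nat.
  - by apply: ord_geB; exact: ord_ge_nat.
  - by rewrite /x' opprB addrA subrK.
rewrite prod_sub_ffact -bin_ffact natrM mulrC uE -mulrA.
apply: ord_geMZp; first exact: ord_ge_expz.
by apply: ord_geMZp; [exact: ord_ge_Zp|exact: ord_ge_nat].
Qed.

Variables (y : rat) (kappa : nat) (om om' : Zp).
Local Notation a := (iotap p y + kappa%:Z).

(* For k > 0, the coefficient of t^k in p^(-w-a) f'(t), up to the contribution [pert] of g. *)
Definition main_coef k : Qp := (P ^ a)^-1 * om'%:Qp *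
  (ratr (gbinom (- y) k) * (P ^ (iota_p p y + kappa%:Z) * om%:Qp) ^+ k).

Lemma iota_p_ordq : iota_p p y + ordq p y = iotap p y.
Proof. by rewrite /iota_p /iotap; case: (lerP 0 (ordq p y)) => H; lia. Qed.

Lemma expz_exprn m k : (P ^ m) ^+ k = P ^ (m * k%:Z).
Proof. by rewrite exprnP exprz_exp. Qed.

Lemma main_coefE k : main_coef k =
  P ^ ((iota_p p y + kappa%:Z) * k%:Z - a) * ratr (gbinom (- y) k) * (om'%:Qp * om%:Qp ^+ k).
Proof.
rewrite /main_coef exprMn expz_exprn [P ^ (_ * _ - _)]padic_expzD invr_expz.
by move: (P ^ _) (P ^ _) (ratr _) => A A' A''; ring.
Qed.

Lemma main_coef_ord m k : ord_ge m (ratr (gbinom (- y) k) : Qp) ->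
  ord_ge (m + (iota_p p y + kappa%:Z) * k%:Z - a) (main_coef k).
Proof.
move=> H; rewrite main_coefE; apply: ord_geMZp; last first.
  by apply: ord_geMZp; [|apply: ord_geX]; exact: ord_ge_Zp.
by rewrite -addrA addrC; apply: ord_geM => //; exact: ord_ge_expz.
Qed.

Lemma ord_ge_ratrN m (r : rat) : ord_ge m (ratr r : Qp) -> ord_ge m (ratr (- r) : Qp).
Proof. by move=> H; rewrite padic_ratrE rmorphN; exact: ord_geN. Qed.

Lemma ord_ge_ratrD m (r s : rat) : ord_ge m (ratr r : Qp) -> ord_ge m (ratr s : Qp) ->
  ord_ge m (ratr (r + s) : Qp).
Proof. by move=> H H'; rewrite padic_ratrE rmorphD; exact: ord_geD. Qed.

Lemma ord_ge_ratr_nat n : ord_ge 0 (ratr n%:R : Qp).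
Proof. by rewrite padic_ratrE rmorph_nat; exact: ord_ge_nat. Qed.

(** The first factor of the numerator is -y; each of the other k - 1 factors -y - i has order at
    least - iota(y). *)
Lemma gbinom_ord k : (0 < k)%N ->
  ord_ge (ordq p y - (k.-1)%:Z * iota_p p y - (logn p k`!)%:Z)
    (ratr (gbinom (- y) k) : Qp).
Proof.
move=> k1; rewrite /gbinom padic_ratrE rmorphM fmorphV/= rmorph_prod rmorph_nat.
apply: ord_geM; last by apply: ord_ge_invn; exact: fact_gt0.
case: k k1 => // k _; elim: k => [|k IH].
  rewrite big_ord1 mul0r subr0 subr0; apply: ord_ge_ratrN; exact: ord_ge_ratr.
rewrite big_ord_recr/=.
have -> : ordq p y - k.+1%:Z * iota_p p y = ordq p y - k%:Z * iota_p p y + - iota_p p y.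
  by rewrite -[k.+1]addn1 PoszD mulrDl mul1r opprD addrA.
apply: ord_geM => //; rewrite -opprD; apply: ord_ge_ratrN; apply: ord_ge_ratrD.
  by apply: ord_geW (ord_ge_ratr p_pr y); rewrite /iota_p; lia.
by apply: ord_geW (ord_ge_ratr_nat _); rewrite /iota_p; lia.
Qed.

(** The exponent iota(y) + kappa in the class exactly absorbs the denominators of -y - i, since
    iota(y) + ord y = iota'(y). *)
Lemma main_coef_ord_fact k : (0 < k)%N ->
  ord_ge ((k.-1 * kappa)%N%:Z - (logn p k`!)%:Z) (main_coef k).
Proof.
move=> k1; have := main_coef_ord (gbinom_ord k1); apply: ord_geW.
have := iota_p_ordq; case: k k1 => // k _.
by rewrite /= PoszM -[k.+1]addn1 PoszD mulrDr mulrDl mulr1; lia.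
Qed.

Lemma main_coef_ord_unit k : ordq p y = 0 -> (0 < k)%N ->
  ord_ge (k.-1 * kappa)%N%:Z (main_coef k).
Proof.
move=> oy k1; have /main_coef_ord : ord_ge 0 (ratr (gbinom (- y) k) : Qp).
  by apply: gbinom_integral; apply: ord_ge_ratrN; rewrite -oy; exact: ord_ge_ratr.
apply: ord_geW; rewrite /iota_p /iotap oy; case: k k1 => // k _; lia.
Qed.

(** Origin of rho_p(y): Legendre's bound v_p(k!) <= (k - 1)/(p - 1) is lost from (k - 1) kappa,
    except when ord y = 0, where the binomial coefficients are p-integral. *)
Lemma main_coef_weight k : (0 < k)%N ->
  rord_ge (k.-1%:R * (kappa%:R - rho_at p R y)) (main_coef k).
Proof.
move=> k1; rewrite /rho_at; case: eqVneq => [oy|oy] /=.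
  apply: (ord_ge_rord _ (main_coef_ord_unit oy k1)).
  by rewrite subr0 -natrM.
apply: (ord_ge_rord _ (main_coef_ord_fact k1)).
rewrite intrB mulrBr -natrM; apply: lerB => //.
rewrite /rho ler_pdivlMr; last first.
  by rewrite subr_gt0 ltr1n prime_gt1.
have H : (p.-1 * logn p k`! <= k.-1)%N by have := logn_fact_leq p_pr k1; lia.
rewrite -(@ler_nat R) in H; apply: le_trans H.
by rewrite natrM mulrC -subn1 natrB// prime_gt0.
Qed.

Hypothesis y0 : 0 < y.

(** Source of iota'(y + 1) in [small_prime_cond]: the quadratic coefficient contains y (y + 1)/2. *)
Lemma main_coef2_ord : ord_ge (kappa%:Z + iotap p (y + 1) - (logn p 2)%:Z) (main_coef 2).
Proof.
have : ord_ge (ordq p y + ordq p (y + 1) - (logn p 2)%:Z) (ratr (gbinom (- y) 2) : Qp).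
  have -> : gbinom (- y) 2 = y * (y + 1) / 2%:R.
    rewrite /gbinom !big_ord_recr big_ord0/= mul1r subr0; congr (_ / _).
    by rewrite -opprD mulrNN.
  rewrite padic_ratrE !rmorphM fmorphV/= rmorph_nat; apply: ord_geM; last exact: ord_ge_invn.
  by apply: ord_geM; exact: ord_ge_ratr.
move/main_coef_ord; apply: ord_geW.
have := iota_p_ordq.
have : iotap p (y + 1) <= ordq p (y + 1) + iota_p p y; last by lia.
have : - iota_p p y <= ordq p (y + 1); last first.
  by rewrite /iotap /iota_p; case: (lerP 0 (ordq p (y + 1))) => H; lia.
have y10 : y + 1 != 0 by rewrite gt_eqF// addr_gt0.
have [u uu uE] := padic_rat_factor p_pr y10.
have : ord_ge (- iota_p p y) (ratr (y + 1) : Qp).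
  apply: ord_ge_ratrD.
    by apply: ord_geW (ord_ge_ratr p_pr y); rewrite /iota_p; lia.
  by apply: ord_geW (ord_ge_ratr_nat 1); rewrite /iota_p; lia.
rewrite uE => /ord_ge_expzM H; rewrite leNgt; apply/negP => lt.
by apply: (ord_ge_unit1 uu); apply: ord_geW H; lia.
Qed.

(** If p divided y + 1, then y would be p-integral, hence divisible by p as ord y <> 0, and p would
    divide 1. *)
Lemma iotap_add1 : ordq p y != 0 -> iotap p (y + 1) = 0.
Proof.
move=> oy; apply/eqP/negPn/negP => H.
have H1 : 1 <= ordq p (y + 1) by move: H; rewrite /iotap; lia.
have y1 : ord_ge 1 (ratr (y + 1) : Qp) by apply: ord_geW H1 _; exact: ord_ge_ratr.
have [u uu uE] := padic_rat_factor p_pr (lt0r_neq0 y0).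
have y_int : ord_ge 0 (ratr y : Qp).
  rewrite -(addrK 1 y); apply: ord_ge_ratrD; first exact: ord_geW y1.
  exact: (ord_ge_ratrN (ord_ge_ratr_nat 1)).
have oy1 : 1 <= ordq p y.
  suff : 0 <= ordq p y by move: oy; lia.
  rewrite leNgt; apply/negP => lt; apply: (ord_ge_unit1 uu).
  by move: y_int; rewrite uE => /ord_ge_expzM; apply: ord_geW; lia.
have : ord_ge 1 (1%:R : Qp).
  have -> : 1%:R = ratr (y + 1) - ratr y :> Qp.
    rewrite !padic_ratrE rmorphD/= [_ + padic_of_rat _ 1]addrC addrK.
    by symmetry; exact: rmorph1.
  by apply: ord_geB => //; apply: ord_geW oy1 _; exact: ord_ge_ratr.
by rewrite -(rmorph_nat (@padic_of_int p p_pr)) => /ord_ge_unit1; apply; exact: unitr1.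
Qed.

Lemma ordq_inv : iota_p p y^-1 = iotap p y /\ ordq p y^-1 = - ordq p y.
Proof.
suff E : ordq p y^-1 = - ordq p y by rewrite /iota_p /iotap E opprK.
have [u uu uE] := padic_rat_factor p_pr (lt0r_neq0 y0).
have [|v vu vE] := @padic_rat_factor _ p_pr y^-1; first by rewrite invr_eq0 lt0r_neq0.
have uv : P ^ (ordq p y + ordq p y^-1) * (u * v)%:Qp = 1.
  rewrite rmorphM padic_expzD mulrACA/= -uE -vE !padic_ratrE -rmorphM/=.
  by rewrite mulfV ?rmorph1// lt0r_neq0.
have uvu : (u * v) \is a GRing.unit by rewrite unitrMl.
have n1 : ~ ord_ge 1 (1 : Qp).
  by rewrite -(rmorph1 (@padic_of_int p p_pr)) => /(ord_ge_unit1 (unitr1 _)).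
have [lt|lt|] := ltrgtP 0 (ordq p y + ordq p y^-1); last by lia.
  case: n1; rewrite -uv; apply: ord_geMZp; last exact: ord_ge_Zp.
  by apply: ord_geW (ord_ge_expz _ _); lia.
case: (ord_ge_unit1 uvu); have -> : (u * v)%:Qp = P ^ (- (ordq p y + ordq p y^-1)).
  have := padic_expzNr p_pr (ordq p y + ordq p y^-1); move: uv.
  move: (P ^ _) (P ^ _) => A A' AE A'E.
  by rewrite -[LHS]mul1r -A'E -mulrA AE mulr1.
by apply: ord_geW (ord_ge_expz _ _); lia.
Qed.

Hypotheses (omu : om \is a GRing.unit) (omu' : om' \is a GRing.unit).

Lemma main_coef1 : exists2 v : Zp, v \is a GRing.unit & main_coef 1 = v%:Qp /\
  v%:Qp = - (om' * om)%:Qp * (ratr y * P ^ (- ordq p y)).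
Proof.
have [u uu uE] := padic_rat_factor p_pr (lt0r_neq0 y0).
have E : ratr y * P ^ (- ordq p y) = u%:Qp.
  by rewrite uE mulrAC -padic_expzD addrN expr0z mul1r.
exists (- (om' * om) * u); first by rewrite unitrMl// unitrN unitrMl.
have vE : (- (om' * om) * u)%:Qp = - (om' * om)%:Qp * (ratr y * P ^ (- ordq p y)).
  by rewrite E rmorphM rmorphN.
split; last exact: vE.
rewrite vE main_coefE mulr1 expr1 /gbinom big_ord1 subr0 divr1.
have -> : iota_p p y + kappa%:Z - a = - ordq p y by have := iota_p_ordq; lia.
rewrite padic_ratrE rmorphN/= -padic_ratrE [(om' * om)%:Qp]rmorphM/=.
by move: (P ^ _) (ratr y) => A A'; ring.
Qed.

End BinomialValuation.

(** * Sums around a critical point *)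

Section StationaryPhase.
Variables (R : realType) (p : nat) (p_pr : prime p).
Local Notation Zp := (padic_int p_pr).
Local Notation Qp := (padic p_pr).
Local Notation e := (@padic_e p p_pr R).
Local Notation P := (p%:R : Qp).
Local Notation sqrtp := (real_complex R (Num.sqrt p%:R)).

Lemma nderivn_deriv (Q : {poly Qp}) k : Q^`()^`N(k) = Q^`N(k.+1) *+ k.+1.
Proof.
apply/polyP => i; rewrite coefMn !coef_nderivn coef_deriv -!mulrnA addSn.
by congr (_ *+ _); rewrite mul_bin_diag mulnC.
Qed.

Variables (Q : {poly Qp}) (be : nat -> Qp) (a L r : nat) (v : Zp) (b : Qp).
Hypotheses (L0 : (0 < L)%N) (vu : v \is a GRing.unit) (be1 : be 1%N = v%:Qp).
Hypothesis Qbe : forall i, (0 < i)%N -> Q^`()`_i = P ^+ a * be i.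
Hypothesis bek : forall i, (1 < i)%N -> ord_ge 1 (be i).
Hypothesis Qr : ord_ge (L + a)%N%:Z Q^`().[r%:R].

Let be_int i : (0 < i)%N -> ord_ge 0 (be i).
Proof.
by case: i => [//|[|i]] _; [rewrite be1; exact: ord_ge_Zp|apply: ord_geW (bek _)].
Qed.

Let Qa i : (0 < i)%N -> ord_ge a%:Z Q^`()`_i.
Proof.
by move=> i0; rewrite Qbe//; apply: ord_geMZp; [exact: ord_ge_expz|exact: be_int].
Qed.

(** The constant coefficient is included because p^a divides Q'(r) and all the other terms of
    Q'(r). *)
Let Qa0 i : ord_ge a%:Z Q^`()`_i.
Proof.
case: i => [|i]; last exact: Qa.
have rest (q : {poly Qp}) : (forall i, (0 < i)%N -> ord_ge a%:Z q`_i) ->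
    ord_ge a%:Z (q.[r%:R] - q`_0).
  move=> qa; rewrite horner_coef; case: (posnP (size q)) => [s0|s0].
    by rewrite s0 big_ord0 nth_default ?s0// subr0; exact: ord_ge0r.
  rewrite -(prednK s0) big_ord_recl expr0 mulr1 addrAC subrr add0r.
  apply: ord_ge_sum => j _; apply: ord_geMZp; first exact: qa.
  by apply: ord_geX; exact: ord_ge_nat.
have := ord_geB (ord_geW (_ : a%:Z <= (L + a)%N%:Z) Qr) (rest _ Qa).
by rewrite opprB addrC subrK; apply; lia.
Qed.

Let Qxa (x : nat) : ord_ge a%:Z Q^`().[x%:R].
Proof. by apply: ord_ge_horner => //; exact: ord_ge_nat. Qed.

(** The Taylor expansion of Q at r from degree 2 on, divided by p^a: a polynomial with critical
    point 0 and value 0 there. [phase_cofactor] is its T. *)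
Definition phase_tail : {poly Qp} :=
  \poly_(j < size Q) (if (1 < j)%N then P ^- a * Q^`N(j).[r%:R] else 0).

Definition phase_cofactor : {poly Qp} :=
  \poly_(k < size Q) (P ^- a * Q^`()^`N(k.+1).[r%:R]).

Let Pa0 : P ^+ a != 0. Proof. by rewrite expf_neq0// padic_p_neq0. Qed.

Lemma phase_tail_deriv : phase_tail^`() = 'X * phase_cofactor.
Proof.
apply/polyP => -[|k]; rewrite coef_deriv coefXM !coef_poly /=.
  by case: ifP; rewrite mul0rn.
case: ltnP => [k1|k1].
  rewrite (ltn_trans _ k1); last by lia.
  by rewrite nderivn_deriv hornerMn mulrnAr.
by case: ifP => _; rewrite ?nderivn_deriv ?nderivn_poly0// !mul0rn ?horner0 ?mulr0.
Qed.

Lemma phase_taylor (x : nat) :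
  Q.[r%:R + x%:R] = Q.[r%:R] + Q^`().[r%:R] * x%:R + P ^+ a * phase_tail.[x%:R].
Proof.
pose s := maxn 2 (size Q).
rewrite (@nderiv_taylor_wide _ s) ?leq_maxr//; last exact: mulrC.
rewrite -(big_mkord xpredT (fun i => Q^`N(i).[r%:R] * x%:R ^+ i)).
rewrite (big_cat_nat (n := 2) (p := s))//= ?leq_maxl//.
rewrite !big_nat_recr//= big_geq// add0r nderivn0 nderivn1 expr0 mulr1 expr1.
congr (_ + _); rewrite horner_poly mulr_sumr.
rewrite -(big_mkord xpredT (fun j => P ^+ a *
  ((if (1 < j)%N then P ^- a * Q^`N(j).[r%:R] else 0) * x%:R ^+ j))).
have E : \sum_(2 <= j < s) Q^`N(j).[r%:R] * x%:R ^+ j =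
    \sum_(0 <= j < s) P ^+ a * ((if (1 < j)%N then P ^- a * Q^`N(j).[r%:R] else 0) * x%:R ^+ j).
  rewrite [RHS](big_cat_nat (n := 2))//= ?leq_maxl//.
  rewrite [X in _ = X + _](_ : _ = 0) ?add0r; last first.
    by rewrite !big_nat_recr//= big_geq// !mul0r !mulr0 !addr0.
  rewrite big_nat_cond [RHS]big_nat_cond; apply: eq_bigr => j /andP[/andP[j2 _] _].
  by rewrite j2 -mulrA mulVKf.
rewrite E [LHS](big_cat_nat (n := size Q))//= ?leq_maxr//.
rewrite [X in _ + X = _]big_nat_cond [X in _ + X = _]big1 ?addr0// => j /andP[/andP[j2 _] _].
by rewrite nderivn_poly0// horner0 mulr0 if_same mul0r mulr0.
Qed.

Lemma phase_cofactor_ord m k : (forall i, (k < i)%N -> ord_ge m (be i)) ->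
  ord_ge m phase_cofactor`_k.
Proof.
move=> bem; rewrite coef_poly; case: ifP => _; last exact: ord_ge0r.
have : ord_ge (a%:Z + m) Q^`()^`N(k.+1).[r%:R].
  apply: ord_ge_horner; last exact: ord_ge_nat.
  move=> j; rewrite coef_nderivn; apply: ord_geMn; rewrite Qbe ?addSn//.
  by apply: ord_geM; [exact: ord_ge_expz|apply: bem; rewrite ltnS leq_addr].
move=> H; rewrite exprnP invr_expz; apply/ord_ge_expzM.
by rewrite opprK addrC.
Qed.

(** The new leading coefficient is p^(-a) Q''(r), and its expansion be_1 + sum_(i > 1) i be_i
    r^(i-1) explains the multiples [be i *+ i]. *)
Lemma phase_cofactor0 m : (forall i, (1 < i)%N -> ord_ge m (be i *+ i)) ->
  ord_ge m (phase_cofactor`_0 - be 1%N).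
Proof.
move=> bem; have sQ : (0 < size Q)%N.
  rewrite lt0n size_poly_eq0; apply/eqP => Q0.
  have /esym/eqP := Qbe (isT : 0 < 1)%N; rewrite Q0 derivC coef0 mulf_eq0 (negPf Pa0) be1 /=.
  move=> /eqP v0; apply: (ord_ge_unit1 vu); rewrite v0; exact: ord_ge0r.
rewrite coef_poly sQ; apply: (_ : ord_ge m (P ^- a * (Q^`()^`N(1).[r%:R] - P ^+ a * be 1%N)) -> _).
  by rewrite mulrBr mulKf.
rewrite exprnP invr_expz; apply/ord_ge_expzM; rewrite opprK.
have -> : P ^+ a * be 1%N = Q^`()^`N(1)`_0 by rewrite coef_nderivn addn0 bin1 -Qbe.
have : forall i, (0 < i)%N -> ord_ge (m + a%:Z) Q^`()^`N(1)`_i.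
  move=> i i0; rewrite coef_nderivn add1n bin1 Qbe// -mulrnAr [m + _]addrC.
  by apply: ord_geM; [exact: ord_ge_expz|exact: bem].
move: (Q^`()^`N(1)) => q qm; rewrite horner_coef; case: (posnP (size q)) => [s0|s0].
  by rewrite s0 big_ord0 nth_default ?s0// subr0; exact: ord_ge0r.
rewrite -(prednK s0) big_ord_recl expr0 mulr1 addrAC subrr add0r.
apply: ord_ge_sum => j _; apply: ord_geMZp; first exact: qm.
by apply: ord_geX; exact: ord_ge_nat.
Qed.

(** Splitting with m = a discards nothing, as p^a divides every value of Q'. Around r the linear
    term vanishes modulo p^(L+a), and taking p^a out of the rest lowers the modulus to p^L. *)
Lemma sum_phase_center :
  \sum_(h < p ^ (L + a)) e (Q.[h%:R] / P ^+ (L + a)) =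
  (p ^ a)%:R * e (Q.[r%:R] / P ^+ (L + a)) *
    \sum_(h < p ^ L) e (phase_tail.[h%:R] / P ^+ L).
Proof.
have Pn k : P ^+ k != 0 by rewrite expf_neq0// padic_p_neq0.
have p2 : (p == 2%N)%:Z <= 1 by case: (p == 2%N).
rewrite (@sum_phase_split R _ _ Q a%:Z L a) => //; last 2 first.
- by apply: ord_geW (Qa0 0).
- by move: p2; rewrite -addnn !PoszD; lia.
rewrite -mulrA; congr (_ * _); pose G h := e (Q.[h%:R] / P ^+ (L + a)).
rewrite (eq_bigl xpredT) => [|x]; last by apply/asboolP.
(* Recentring needs G to be p^L-periodic: over a step p^L the phase changes by Q'(x) p^L and a
   Taylor error, both divisible by p^(L+a). *)
transitivity (\sum_(x < p ^ L) G (x + r)%N).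
  rewrite (sum_ord_periodic_shift r (q := p ^ L) (F := G))// => x.
  apply: eq_padic_e; rewrite -mulrBl mulrC exprnP invr_expz; apply/ord_ge_expzM.
  rewrite sub0r opprK natrD natrX.
  have := poly_taylor1 L0 Qa (ord_ge_nat p_pr x) (ord_ge_nat p_pr 1).
  rewrite mulr1 => H; rewrite -(subrK (Q^`().[x%:R] * P ^+ L) (_ - _)).
  apply: ord_geD.
    rewrite -addrA -opprD; apply: ord_geW H.
    by move: p2; rewrite -addnn !PoszD; lia.
  rewrite PoszD addrC; apply: ord_geM; [exact: Qxa|exact: ord_ge_expz].
rewrite mulr_sumr; apply: eq_bigr => x _; rewrite -padic_eD; apply: eq_padic_e.
rewrite addnC natrD phase_taylor !mulrDl.
have -> : P ^+ a * phase_tail.[x%:R] / P ^+ (L + a) = phase_tail.[x%:R] / P ^+ L.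
  by rewrite exprD invfM [P ^+ a * _]mulrC -mulrA [P ^+ a * _]mulrCA mulfV// mulr1.
set A := _ / _; set B := _ / _; set C := _ / _.
have -> : A + B + C - (A + C) = B by ring.
rewrite /B mulrC exprnP invr_expz; apply/ord_ge_expzM; rewrite sub0r opprK.
by apply: ord_geMZp => //; exact: ord_ge_nat.
Qed.

Lemma stationary_phase :
  (if odd L then [/\ ord_ge (1 + (p == 2%N)%:Z) (v%:Qp - b),
      forall i, (1 < i)%N -> ord_ge (1 + (p == 2%N)%:Z) (be i *+ i)
    & L = 1%N -> forall k i, (1 < k)%N -> (k <= i)%N ->
        ord_ge (1 + (logn p k.+1)%:Z) (be i)]
   else p = 2%N -> [/\ (2 < L)%N, forall i, (1 < i)%N -> ord_ge (i.-1)%:Z (be i),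
      ord_ge 3 (v%:Qp - b) & forall i, (1 < i)%N -> ord_ge 3 (be i *+ i)]) ->
  \sum_(h < p ^ (L + a)) e (Q.[h%:R] / P ^+ (L + a)) =
  gauss_factor R (odd L) b * ((p ^ a)%:R * sqrtp ^+ L)
    * e (Q.[r%:R] / P ^+ (L + a)).
Proof.
move=> H; rewrite sum_phase_center.
have T0 : ord_ge 0 phase_cofactor`_0 by apply: phase_cofactor_ord => i; exact: be_int.
have T1 : ord_ge 1 (phase_cofactor`_0 - v%:Qp).
  by rewrite -be1; apply: phase_cofactor0 => i i1; apply: ord_geMn; exact: bek.
have [u uu uE] : exists2 u : Zp, u \is a GRing.unit & phase_cofactor`_0 = u%:Qp.
  have [T0'|//] := padic_unitP T0; case: (ord_ge_unit1 vu).
  by have := ord_geB T0' T1; rewrite opprB addrC subrK.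
have ub m : ord_ge m (v%:Qp - b) -> (forall i, (1 < i)%N -> ord_ge m (be i *+ i)) ->
    ord_ge m (u%:Qp - b).
  move=> vb /phase_cofactor0; rewrite uE be1 => uv.
  by have := ord_geD uv vb; rewrite addrA subrK.
have tail0 : phase_tail`_0 = 0 by rewrite coef_poly; case: ifP.
rewrite (critical_sum (b := b) R uu phase_tail_deriv tail0 uE) //.
- by move: (e _) (gauss_factor _ _ _) => E G; ring.
- by move=> k k0; apply: phase_cofactor_ord => i ki; apply: bek; lia.
case: (odd L) H => [[vb bei L1]|H p2].
  split; first exact: ub.
  move=> /L1 {}L1 j j2; rewrite (critical_coef phase_tail_deriv)//.
  have -> : 1 = (1 + (logn p j)%:Z) - (logn p j)%:Z by lia.
  apply: ord_geM; last by apply: ord_ge_invn; lia.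
  apply: phase_cofactor_ord => i ji.
  by have := L1 j.-1 i; rewrite prednK; [apply; lia|lia].
have [L2 bei vb bei3] := H p2; split => //; last exact: ub.
by move=> k k0; apply: phase_cofactor_ord => i ki; apply: ord_geW (bei i _); lia.
Qed.

End StationaryPhase.

(** * Linear weights against logarithmic denominators *)

Section Growth.
Variables (R : realType) (p : nat) (p_pr : prime p).
Local Notation Qp := (padic p_pr).
Local Notation P := (p%:R : Qp).

Lemma archi_mul (c l : R) : 0 < l -> exists k : nat, c <= k%:R * l.
Proof.
move=> l0; exists (Num.bound (`|c| / l)); rewrite -ler_pdivrMr//.
apply: le_trans (ltW (archi_boundP _)); last by rewrite divr_ge0// ltW.
by rewrite ler_pM2r ?invr_gt0// ler_norm.
Qed.

Lemma sqr_leq_exp2 v : (v * v <= 2 ^ v.+1)%N.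
Proof.
elim: v => // v IH; have [v2|v2] := ltnP 2 v.
  by rewrite expnS; nia.
by case: v IH v2 => [|[|[|]]].
Qed.

(** With v = v_p(j + 1), p^v <= j + 1 makes v logarithmic in j. *)
Lemma logn_growth (c l : R) : 0 < l ->
  exists K, forall j, (K <= j)%N -> c + (logn p j.+1)%:R <= j%:R * l - l.
Proof.
(* The choice q l >= 2 gives v <= v q l/2. Values v <= 2q + 2 are absorbed in d, and larger ones
   satisfy v q <= 2^v <= j + 1. *)
move=> l0; have [q ql] := archi_mul 2 l0; pose d := (q * (2 * q + 2))%N.
have [K KP] := archi_mul (2 * c + (d%:R + 3) * l) l0; exists K => j Kj.
set v := logn p j.+1.
have vq : (v * q <= j.+1 + d)%N.
  have [vs|vl] := leqP v (2 * q + 2); first by rewrite /d; nia.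
  apply: (leq_trans _ (leq_addr _ _)).
  apply: (leq_trans _ (expn_logn_leq p (ltn0Sn j))); rewrite -/v.
  apply: (@leq_trans (2 ^ v)); last by rewrite leq_exp2r ?prime_gt1//; lia.
  by have := sqr_leq_exp2 v; rewrite expnS; nia.
rewrite -(ler_nat R) natrM natrD -addn1 natrD in vq.
have jK : K%:R * l <= j%:R * l by rewrite ler_pM2r// ler_nat.
have v2 : v%:R * 2 <= v%:R * (q%:R * l) by rewrite ler_wpM2l.
have vql : v%:R * q%:R * l <= (j%:R + 1 + d%:R) * l by rewrite ler_pM2r.
by lra.
Qed.

Lemma rord_I0_lam (l : R) (h : nat -> Qp) : 0 < l ->
  (forall k, rord_ge (k%:R * l) (h k)) -> I0_lam l h.
Proof.
move=> l0 hl; split; last by move=> k; apply/rord_ge_ceil.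
split=> [k|N].
  apply: (rord_ge_ord _ (hl k)); rewrite sub0r.
  have : 0 <= k%:R * l by rewrite mulr_ge0// ltW.
  by lra.
have [K KP] := archi_mul N%:R l0; exists K => k Kk.
apply: (rord_ge_ord _ (hl k)); rewrite ltrBlDr.
have : K%:R * l <= k%:R * l by rewrite ler_pM2r// ler_nat.
by move: KP; rewrite /=; lra.
Qed.

Lemma ord_ge_lower_bound (h : nat -> Qp) K : exists m : int, forall k, (k < K)%N -> ord_ge m (h k).
Proof.
elim: K => [|K [m mP]]; first by exists 0.
have [m' m'P] := ord_ge_exists (h K); exists (Num.min m m') => k.
rewrite ltnS leq_eqVlt => /predU1P[->|/mP H]; first by apply: ord_geW m'P; lia.
by apply: ord_geW H; lia.
Qed.

(** Coefficients tending to 0 leave finitely many nonintegral ones, and one power of p clears their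
    denominators. *)
Lemma scaled_I0_lim (h : nat -> Qp) :
  (forall m : int, exists K, forall k, (K <= k)%N -> ord_ge m (h k)) <-> scaled_I0 h.
Proof.
split=> [lim|[c c0 [b [b0 blim] hE]] m]; last first.
  have [m' cm'] := ord_ge_exists c; have [K KP] := blim (absz (m - m')).
  exists K => k /KP bk; rewrite hE; apply: ord_geW (ord_geM cm' bk); lia.
have [K KP] := lim 0; have [m mP] := ord_ge_lower_bound h K.
pose c := P ^ (Num.min m 0); have c0 : c != 0 by exact: padic_expz_neq0.
exists c => //; exists (fun k => c^-1 * h k) => [|k]; last by rewrite mulVKf.
split=> [k|N].
  rewrite invr_expz; apply/ord_ge_expzM; rewrite opprK add0r.
  case: (ltnP k K) => [/mP|/KP]; apply: ord_geW; lia.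
have [K' K'P] := lim N%:Z; exists K' => k /K'P H.
by rewrite invr_expz; apply/ord_ge_expzM; apply: ord_geW H; lia.
Qed.

Lemma ord_ge_horner_sub m (Q : {poly Qp}) (x x' : Qp) : (forall k, ord_ge 0 Q`_k) ->
  ord_ge 0 x -> ord_ge 0 x' -> ord_ge m (x - x') -> ord_ge m (Q.[x] - Q.[x']).
Proof.
move=> Q0 x0 x0' xx'; rewrite !horner_coef -sumrB; apply: ord_ge_sum => i _.
rewrite -mulrBr; apply: ord_geZpM => //; rewrite subrXX; apply: ord_geMZp => //.
by apply: ord_ge_sum => j _; apply: ord_geMZp; exact: ord_geX.
Qed.

End Growth.

(** * The transformed series *)

(** Envelope identity for the critical value G(X) - s X with s = A + c q t: as G'(X) equals s up to
    q E, the terms in X' cancel apart from that error and - s' X remains. *)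
Lemma critical_value_deriv (F : fieldType) (A c q : F) (G X E : {poly F}) :
  G^`() \Po X = A%:P + q *: (c *: 'X + E) ->
  (G \Po X - (A%:P + (c * q) *: 'X) * X)^`() = q *: (E * X^`()) - (c * q) *: X.
Proof.
move=> GX; rewrite derivB deriv_comp GX derivM derivD derivC derivZ derivX add0r.
rewrite -!mul_polyC !polyCM mulr1.
by move: (c%:P) (q%:P) (A%:P) (X^`()) => c' q' A' X'; ring.
Qed.

Section Transform.
Variables (R : realType) (p : nat) (p_pr : prime p).
Local Notation Zp := (padic_int p_pr).
Local Notation Qp := (padic p_pr).
Local Notation P := (p%:R : Qp).
Local Notation e := (@padic_e p p_pr R).
Variables (w : int) (y : rat) (kappa : nat) (lam : R) (u : nat) (om om' : Zp).
Variables (f : nat -> Qp) (gamma0 : Zp) (g : nat -> Qp) (n : nat).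
Hypothesis dec : F_decomp w y kappa lam u%:Z om om' f gamma0 g.
Hypothesis size_lb : kappa%:Z + iotap p y < Num.min (n%:Z - w) (u%:Z + Num.floor lam).
Local Notation lamt := (Num.min (kappa%:R - rho_at p R y) lam).
Hypothesis lamt0 : 0 < lamt.
Local Notation a := (iotap p y + kappa%:Z).
Local Notation main := (main_coef y kappa om om').

Definition pert k : Qp := P ^ (u%:Z - a) * g k.
(** For k > 0 this is the coefficient b_k of the overview, split into its binomial part and the part
    coming from g. *)
Definition lin_coef k : Qp := main k + pert k.
Definition slope0 : Qp := ps_deriv f 0%N * P ^ (- w).

Let kappa0 : (0 < kappa)%N. Proof. by case: dec => -[[]]. Qed.
Let y0 : 0 < y. Proof. by case: dec => -[]. Qed.
Let omu : om \is a GRing.unit. Proof. by case: dec => -[_ _ _ _ []]. Qed.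
Let omu' : om' \is a GRing.unit. Proof. by case: dec => -[_ _ _ _ []]. Qed.
Let fI : scaled_I0 f. Proof. by case: dec. Qed.
Let gl k : rord_ge (k%:R * lam) (g k).
Proof. by apply/rord_ge_ceil; case: dec => _ _ [_ ]. Qed.
Let a0 : 0 < a. Proof. by move: kappa0; rewrite /iotap; lia. Qed.
Let ua : 1 <= u%:Z + Num.floor lam - a.
Proof. by move: size_lb; lia. Qed.
Let na : a < n%:Z - w. Proof. by move: size_lb; lia. Qed.

Lemma ps_derivS k : (0 < k)%N -> ps_deriv f k = P ^ (w + a) * lin_coef k.
Proof.
case: dec => _ _ _ -> ; case: k => // k _; rewrite addr0 /lin_coef /pert mulrDr.
congr (_ + _); last first.
  by rewrite mulrA -padic_expzD; congr (P ^ _ * _); lia.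
rewrite /main_coef /ps_binom padic_expzD.
have := padic_expz_neq0 p_pr a.
move: (ratr _ * _) (P ^ w) (P ^ a) => X A A' A'0.
by rewrite -[RHS]mulrA -[_^-1 * _ * _]mulrA mulVKf// mulrA.
Qed.

Lemma slope0E : slope0 = om'%:Qp + gamma0%:Qp + P ^ u%:Z * g 0%N.
Proof.
rewrite /slope0; case: dec => _ _ _ ->; rewrite /ps_binom gbinom0 expr0 mulr1.
have -> : ratr 1 = 1 :> Qp by rewrite padic_ratrE rmorph1.
rewrite mulr1 eqxx padic_expzD; have := padic_expzNr p_pr w.
move: (P ^ w) (P ^ (- w)) (P ^ u%:Z) (g 0%N) => A A' A'' g0 AA.
have -> : (A * om'%:Qp + A * gamma0%:Qp + A'' * A * g0) * A' =
    A' * A * (om'%:Qp + gamma0%:Qp + A'' * g0) by ring.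
by rewrite AA mul1r.
Qed.

Lemma slope0_int : ord_ge 0 (slope0 - om'%:Qp).
Proof.
rewrite slope0E addrAC [om'%:Qp + _]addrC addrK; apply: ord_geD; first exact: ord_ge_Zp.
apply: ord_geMZp; first by apply: ord_geW (ord_ge_expz _ _).
by case: dec => _ _ [[]].
Qed.

(** The gain of [pert] over the weight (k - 1) lam: its order is at least u - a + k lam, and lam >=
    floor lam. The size hypothesis says precisely that the gain from g is at least 1. *)
Let mu : R := (u%:Z + Num.floor lam - a)%:~R.
Let mu1 : 1 <= mu. Proof. by rewrite /mu (ler_int R 1). Qed.

Lemma pert_ord k : (0 < k)%N -> rord_ge (mu + k.-1%:R * lam) (pert k).
Proof.
move=> k0; have := rord_geM (ord_ge_rord (lexx _) (ord_ge_expz p_pr (u%:Z - a))) (gl k).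
apply: rord_geW; rewrite /mu -{2}(prednK k0) -natr1 mulrDl mul1r.
rewrite [u%:Z + _ - a]addrAC intrD; have := floor_le lam; lra.
Qed.

Lemma lamt_le1 : lamt <= kappa%:R - rho_at p R y. Proof. by rewrite ge_min lexx. Qed.
Lemma lamt_le2 : lamt <= lam. Proof. by rewrite ge_min lexx orbT. Qed.

Lemma main_lamt k : (0 < k)%N -> rord_ge (k.-1%:R * lamt) (main k).
Proof.
move=> k0; apply: rord_geW (main_coef_weight R y kappa om om' k0).
by rewrite ler_wpM2l// lamt_le1.
Qed.

Lemma pert_lamt k : (0 < k)%N -> rord_ge (mu + k.-1%:R * lamt) (pert k).
Proof.
move=> k0; apply: rord_geW (pert_ord k0).
by rewrite lerD2l ler_wpM2l// lamt_le2.
Qed.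

Lemma lin_lamt k : (0 < k)%N -> rord_ge (k.-1%:R * lamt) (lin_coef k).
Proof.
move=> k0; apply: rord_geD; first exact: main_lamt.
by apply: rord_geW (pert_lamt k0); move: mu1; lra.
Qed.

Lemma lin_coef1 : exists2 v : Zp, v \is a GRing.unit & lin_coef 1 = v%:Qp.
Proof.
have [v vu [vE _]] := main_coef1 kappa y0 omu omu'.
have /rord_ge_ord p1 := pert_lamt (ltn0Sn 0).
have {}p1 : ord_ge 1 (pert 1) by apply: p1; rewrite /= subrr mul0r addr0; move: mu1; lra.
have lin0 : ord_ge 0 (lin_coef 1).
  by rewrite /lin_coef vE; apply: ord_geD; [exact: ord_ge_Zp|exact: ord_geW p1].
have [l1|//] := padic_unitP lin0; case: (ord_ge_unit1 vu).
by have := ord_geB l1 p1; rewrite /lin_coef addrK vE.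
Qed.

Lemma main_unit1 : ord_ge 0 (main 1%N)^-1 /\ main 1%N != 0.
Proof.
have [v vu [-> _]] := main_coef1 kappa y0 omu omu'.
rewrite -padic_of_intV//; split; first exact: ord_ge_Zp.
apply/eqP => v0; apply: (ord_ge_unit1 vu); rewrite v0; exact: ord_ge0r.
Qed.

Lemma lin_unit1 : ord_ge 0 (lin_coef 1%N)^-1 /\ lin_coef 1%N != 0.
Proof.
have [v vu ->] := lin_coef1.
rewrite -padic_of_intV//; split; first exact: ord_ge_Zp.
apply/eqP => v0; apply: (ord_ge_unit1 vu); rewrite v0; exact: ord_ge0r.
Qed.

(* [crit] is the critical point as a power series in t: p^(-w) f'(crit) = slope0 + om' p^a t. *)
Definition crit k : Qp := inverse_coef lin_coef om'%:Qp k.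
Definition crit0 k : Qp := inverse_coef main om'%:Qp k.

(** The equation to solve is (1 + p^(iota(y) + kappa) om x)^(-y) = 1 + p^a t; its solution exchanges
    y with 1/y. *)
Lemma crit0E k : (0 < k)%N -> crit0 k =
  (P ^ (iota_p p y + kappa%:Z) * om%:Qp)^-1 * (ratr (gbinom (- y^-1) k) * (P ^ a) ^+ k).
Proof.
have om0 : om%:Qp != 0.
  by apply/eqP => v0; apply: (ord_ge_unit1 omu); rewrite v0; exact: ord_ge0r.
pose th := P ^ (iota_p p y + kappa%:Z) * om%:Qp.
pose Y k := if k == 0%N then 0 else th^-1 * (ratr (gbinom (- y^-1) k) * (P ^ a) ^+ k).
move=> k0; transitivity (Y k); last by rewrite /Y gtn_eqF.
apply: inverse_coef_uniq => // [|K K1]; first exact: main_unit1.2.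
apply: binom_series_inverse; last exact: K1.
- by rewrite mulrNN mulfV// gt_eqF.
- exact: padic_expz_neq0.
- by apply: mulf_neq0 => //; exact: padic_expz_neq0.
Qed.

Lemma crit_lamt k : rord_ge (k%:R * lamt - lamt) (crit k).
Proof.
apply: inverse_coef_ord; [exact: ord_ge_Zp|exact: lin_unit1.1|].
by move=> j j1; apply: lin_lamt; exact: ltnW.
Qed.

Lemma crit_sub k : rord_ge (mu - lamt + k%:R * lamt) (crit k - crit0 k).
Proof.
have [l1 l1n] := lin_unit1; have [m1 m1n] := main_unit1.
apply: inverse_coef_sub => // [|j j1|j j1|j j0].
- exact: ord_ge_Zp.
- by apply: lin_lamt; exact: ltnW.
- by apply: main_lamt; exact: ltnW.
- by rewrite /lin_coef [main j + _]addrC addrK; exact: pert_lamt.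
Qed.

(* Since f' - p^w s vanishes at the critical point, the derivative in t of the critical value
   is -p^w (ds/dt) crit = -om' p^(w+a) crit; the constant term is f(0). *)
Definition transform k : Qp :=
  if k is j.+1 then - om'%:Qp * P ^ (w + a) * crit j / j.+1%:R else f 0%N.

Lemma ps_deriv_transform k : ps_deriv transform k = P ^ (w + a) * (- om'%:Qp * crit k).
Proof.
rewrite /ps_deriv /transform -[_ *+ k.+1]mulr_natr divfK ?padic_natr_eq0//.
by move: (P ^ _) => A; ring.
Qed.

Lemma transform_deriv_tI0 :
  exists2 h, tI0_lam lamt h &
    forall k, ps_deriv transform k = P ^ (w + iotap p y + kappa%:Z) * h k.
Proof.
exists (fun k => - om'%:Qp * crit k) => [|k]; last by rewrite ps_deriv_transform addrA.
exists (fun k => - om'%:Qp * crit k.+1); last first.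
  by split=> //; rewrite /crit inverse_coef0 mulr0.
apply: rord_I0_lam => // k; apply: rord_geMZp; first by apply: ord_geN; exact: ord_ge_Zp.
by have := crit_lamt k.+1; rewrite -natr1 mulrDl mul1r addrK.
Qed.

Lemma transform_ord k (C : R) : C + (logn p k.+1)%:R <= k%:R * lamt - lamt ->
  rord_ge ((w + a)%:~R + C) (transform k.+1).
Proof.
move=> kC; rewrite /transform.
have := rord_geM (rord_geM (ord_ge_rord (lexx _) (ord_ge_expz p_pr (w + a))) (crit_lamt k))
  (ord_ge_rord (lexx _) (ord_ge_invn p_pr (ltn0Sn k))).
have -> : - om'%:Qp * P ^ (w + a) * crit k / k.+1%:R =
    - om'%:Qp * (P ^ (w + a) * crit k / k.+1%:R) by rewrite !mulrA.
move=> H; apply: rord_geMZp; first by apply: ord_geN; exact: ord_ge_Zp.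
by apply: rord_geW H; rewrite mulrNz; move: kC; rewrite -pmulrn; lra.
Qed.

Lemma transform_scaled : scaled_I0 transform.
Proof.
apply/scaled_I0_lim => m; have [K KP] := logn_growth p_pr (m - (w + a))%:~R lamt0.
exists K.+1 => -[//|k] Kk; apply: (rord_ge_ord _ (transform_ord (KP k Kk))).
by rewrite intrB; lra.
Qed.

(** The new u comes from [crit_sub]: p^(w+a) (crit - crit0) has order at least w + u + floor lam -
    lamt + k lamt, and replacing lamt by its ceiling makes the extracted exponent [nu] an integer.
    The scale is right because iota(1/y) = iota'(y). *)
Lemma transform_class : F_class (w + ordq p y) y^-1 kappa lamt
  (u%:Z + (Num.floor lam - Num.ceil lamt) - ordq p y) 1 (- (om' * om^-1)) transform.
Proof.
have [iotay ordy] := ordq_inv p_pr y0.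
pose nu := u%:Z + (Num.floor lam - Num.ceil lamt) + w.
have nuE : u%:Z + (Num.floor lam - Num.ceil lamt) - ordq p y + (w + ordq p y) = nu.
  by rewrite /nu; lia.
have crit00 : crit 0 - crit0 0 = 0 by rewrite /crit /crit0 !inverse_coef0 subrr.
(* The constant om'/om cancels the leading term of the binomial series, since the derivative of
   [transform] vanishes at 0. *)
exists (om' * om^-1), (fun k => P ^ (- nu) * (- om'%:Qp * P ^ (w + a)) * (crit k - crit0 k)).
split.
- case: dec => -[[k0 k2] _ [j j0 lamE] _ _] _ _ _; split => //.
  (* Then the new u is at least u + floor lam - kappa - ord y >= 1 + iota(y) > 0. *)
  + suff : Num.ceil lamt <= kappa%:Z.
      by move: ua; have := iota_p_ordq p y; rewrite /iota_p /iotap; lia.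
    rewrite ceil_le_int; apply: le_trans lamt_le1 _; rewrite gerBl /rho_at.
    case: ifP => // _; rewrite invr_ge0 subr_ge0 (ler_nat R 1); exact: prime_gt0.
  (* Both kappa and rho_p(y) are integral multiples of rho_p, so lamt is one too; it is a positive
     one by [lamt0]. *)
  + have p1 : (p%:R - 1 : R) != 0 by rewrite subr_eq0 pnatr_eq1; case: (p) p_pr => [|[|]].
    have kr : kappa%:R = (kappa * p.-1)%N%:R * rho p R.
      by rewrite natrM -subn1 natrB ?prime_gt0// -mulrA mulfV// mulr1.
    have kE : kappa%:R - rho_at p R y = (kappa * p.-1 - (ordq p y != 0))%N%:R * rho p R.
      rewrite natrB; last first.
        apply: leq_trans (leq_b1 _) _; rewrite muln_gt0 kappa0 /=.
        by have := prime_gt1 p_pr; case: (p) => [|[]].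
      by rewrite mulrBl -kr /rho_at; case: ifP; rewrite ?mul1r ?mul0r.
    case: (lerP (kappa%:R - rho_at p R y) lam) lamt0 => _ l0; last by exists j.
    exists (kappa * p.-1 - (ordq p y != 0))%N; last exact: kE.
    by rewrite lt0n; apply/eqP => z0; move: l0; rewrite kE z0 mul0r ltxx.
  + by rewrite invr_gt0.
  + by split; [exact: unitr1|rewrite unitrN unitrMl ?unitrV].
- exact: transform_scaled.
- apply: rord_I0_lam => // k; rewrite -mulrA [- _ * _]mulrC -!mulrA.
  have H := rord_geMZp (ord_geN (ord_ge_Zp om')) (crit_sub k).
  have := rord_geM (ord_ge_rord (lexx _) (ord_ge_expz p_pr (- nu)))
    (rord_geM (ord_ge_rord (lexx _) (ord_ge_expz p_pr (w + a))) H).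
  apply: rord_geW; rewrite /nu /mu.
  have := ceil_ge lamt; rewrite !(intrD, mulrNz, opprD); lra.
move=> k; rewrite ps_deriv_transform nuE iotay.
have -> : P ^ nu * (P ^ (- nu) * (- om'%:Qp * P ^ (w + a)) * (crit k - crit0 k)) =
    P ^ (w + a) * (- om'%:Qp * (crit k - crit0 k)).
  have := padic_expzNr p_pr nu; move: (P ^ nu) (P ^ (- nu)) (P ^ (w + a)) => A A' A'' AA.
  have -> : A * (A' * (- om'%:Qp * A'') * (crit k - crit0 k)) =
     A' * A * (A'' * (- om'%:Qp * (crit k - crit0 k))) by ring.
  by rewrite AA mul1r.
have oV : (om^-1)%:Qp = om%:Qp^-1 by rewrite padic_of_intV.
have omE : (om' * om^-1)%:Qp = om'%:Qp * om%:Qp^-1 by rewrite rmorphM/= oV.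
have omNE : (- (om' * om^-1))%:Qp = - (om'%:Qp * om%:Qp^-1) by rewrite rmorphN/= omE.
rewrite omE omNE rmorph1 mulr1 /ps_binom.
case: k => [|k].
  rewrite eqxx crit00 gbinom0 expr0 mulr1 /crit inverse_coef0 !mulr0 addr0.
  have -> : ratr 1 = 1 :> Qp by rewrite padic_ratrE rmorph1.
  by move: (P ^ _) (om%:Qp^-1) => A o; ring.
rewrite addr0; have := crit0E (ltn0Sn k).
move: (crit k.+1) (crit0 k.+1) (ratr _) ((P ^ a) ^+ k.+1) => c c0 b q c0E.
have {}c0E : P ^ (w + a) * c0 = P ^ (w + ordq p y) * (om%:Qp^-1 * (b * q)).
  rewrite c0E; have -> : w + a = w + ordq p y + (iota_p p y + kappa%:Z).
    by have := iota_p_ordq p y; lia.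
  rewrite [P ^ (w + ordq p y + _)]padic_expzD invfM.
  have := padic_expz_neq0 p_pr (iota_p p y + kappa%:Z).
  move: (P ^ (w + ordq p y)) (P ^ (iota_p p y + kappa%:Z)) (om%:Qp^-1) => A A' o A0.
  by rewrite -!mulrA mulVKf.
have -> : P ^ (w + a) * (- om'%:Qp * c) =
    - om'%:Qp * (P ^ (w + a) * c0) + P ^ (w + a) * (- om'%:Qp * (c - c0)).
  by move: (P ^ _) => A; ring.
rewrite c0E; congr (_ + _).
by move: (P ^ _) (om%:Qp^-1) => A o; ring.
Qed.

Local Notation N := (absz (n%:Z - w)).
Local Notation av := (absz a).

Let NE : N%:Z = n%:Z - w. Proof. by move: a0 na; lia. Qed.
Let avE : av%:Z = a. Proof. by move: a0; lia. Qed.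

(** [hat_e] uses f only at natural numbers and modulo p^n, so for large K this polynomial gives the
    same sum, and Taylor's formula applies to it. *)
Definition trunc K : {poly Qp} := \poly_(i < K.+1) (f i * P ^ (- w)).

Definition phase K s : {poly Qp} := trunc K - s *: 'X.

Lemma trunc_deriv K k :
  (trunc K)^`()`_k = if (k < K)%N then ps_deriv f k * P ^ (- w) else 0.
Proof.
rewrite coef_deriv coef_poly ltnS; case: ifP => _; last exact: mul0rn.
by rewrite -mulrnAl.
Qed.

Lemma phase_deriv_coef K s i : (0 < i)%N ->
  (phase K s)^`()`_i = P ^+ av * (if (i < K)%N then lin_coef i else 0).
Proof.
move=> i0; rewrite derivB derivZ derivX coefB trunc_deriv coefZ coef1 gtn_eqF// mulr0 subr0.
case: ifP => _; last by rewrite mulr0.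
rewrite ps_derivS// mulrC mulrA -padic_expzD exprnP avE.
by congr (P ^ _ * _); lia.
Qed.

Lemma phase_deriv0 K s : (0 < K)%N -> (phase K s)^`()`_0 = slope0 - s.
Proof. by move=> K0; rewrite derivB derivZ derivX coefB trunc_deriv K0 coefZ coef1 mulr1. Qed.

Lemma hat_e_phase K s : (forall i, (K < i)%N -> ord_ge n%:Z (f i)) ->
  hat_e R f w n s = \sum_(m < p ^ N) e ((phase K s).[m%:R] / P ^+ N).
Proof.
move=> fK; apply: eq_bigr => m _; apply: eq_padic_e.
have := ps_eval_trunc fI (ord_ge_nat p_pr m) fK.
have -> : (phase K s).[m%:R] = (\sum_(i < K.+1) f i * m%:R ^+ i) * P ^ (- w) - s * m%:R.
  rewrite hornerD hornerN hornerZ hornerX horner_poly mulr_suml; congr (_ - _).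
  by apply: eq_bigr => i _; rewrite mulrAC.
rewrite exprnP NE invr_expz.
move: (ps_eval f _) (\sum_(_ < _) _) => v v' vv'.
have -> : (v * P ^ (- w) - s * m%:R) * P ^ (- (n%:Z - w)) -
    (v' * P ^ (- w) - s * m%:R) * P ^ (- (n%:Z - w)) = P ^ (- (n%:Z - w) - w) * (v - v').
  by rewrite padic_expzD; move: (P ^ _) (P ^ _) => A A'; ring.
by apply/ord_ge_expzM; apply: ord_geW vv'; lia.
Qed.

Lemma f_small : exists K, forall K' i, (K <= K')%N -> (K' < i)%N -> ord_ge n%:Z (f i).
Proof.
have [K KP] := (scaled_I0_lim f).2 fI n%:Z; exists K => K' i KK' K'i.
by apply: KP; lia.
Qed.

Let lin_int i : (0 < i)%N -> ord_ge 0 (lin_coef i).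
Proof.
move=> i0; apply: (rord_ge_ord _ (lin_lamt i0)).
have : 0 <= i.-1%:R * lamt by rewrite mulr_ge0// ltW.
by lra.
Qed.

(** All values of the derivative of the phase are congruent to slope0 - s modulo p^a, so splitting
    with m = a leaves no residue at all. *)
Lemma hat_e_off s : ord_ge 0 s -> ~ ord_ge a (slope0 - s) -> hat_e R f w n s = 0.
Proof.
move=> s0 ns; have [K KP] := f_small.
rewrite (@hat_e_phase K.+1 s) => [|i Ki]; last by apply: (KP K.+1); lia.
have Qa i : (0 < i)%N -> ord_ge a (phase K.+1 s)^`()`_i.
  move=> i0; rewrite phase_deriv_coef// exprnP avE; apply: ord_geMZp; first exact: ord_ge_expz.
  by case: ifP => _; [exact: lin_int|exact: ord_ge0r].
have slope_int : ord_ge 0 slope0.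
  by rewrite -(subrK om'%:Qp slope0); apply: ord_geD; [exact: slope0_int|exact: ord_ge_Zp].
have [L LE] : exists L, N = (L + av)%N by exists (N - av)%N; move: NE avE na; lia.
have p2 : (p == 2%N)%:Z <= 1 by case: (p == 2%N).
rewrite LE (@sum_phase_split R _ _ _ a L av); last 5 first.
- exact: ltW a0.
- by move: NE avE na; lia.
- by rewrite phase_deriv0//; exact: ord_geB.
- exact: Qa.
- by move: NE avE na p2; rewrite -addnn !PoszD; lia.
rewrite big_pred0 ?mulr0// => x; apply/asboolP; rewrite avE => H; apply: ns.
rewrite -(phase_deriv0 s (ltn0Sn K)).
move: ((phase K.+1 s)^`()) Qa H => q qa; rewrite horner_coef; case: (posnP (size q)) => [s0'|s0'].
  by rewrite nth_default ?s0'// => _; exact: ord_ge0r.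
rewrite -(prednK s0') big_ord_recl expr0 mulr1 => H.
rewrite -(addrK (\sum_(i < (size q).-1) q`_(bump 0 i) * x%:R ^+ bump 0 i) q`_0).
apply: ord_geB => //; apply: ord_ge_sum => j _; apply: ord_geMZp; first exact: qa.
by apply: ord_geX; exact: ord_ge_nat.
Qed.

(** * The critical value as a polynomial in t *)

Section Evaluation.
Variables (K : nat) (t : Zp).
Hypothesis K1 : (1 < K)%N.
Hypothesis Kbig : forall j, (K <= j)%N ->
  (n%:Z - w)%:~R + (logn p j.+1)%:R <= j%:R * lamt - lamt.
Local Notation Xp := (inverse_poly lin_coef om'%:Qp K).
Local Notation x := (Xp.[t%:Qp]).
Local Notation s := (slope0 + om'%:Qp * (P ^ a * t%:Qp)).

(** The error of the truncated inverse. It starts in degree K and keeps the weight - lamt, so [Kbig]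
    makes it vanish modulo p^(n-w). *)
Let E : {poly Qp} := comp_tail 1 lin_coef K Xp - om'%:Qp *: 'X.

Let E_dvd : 'X^K %| E.
Proof. by apply: inverse_polyP => //; exact: lin_unit1.2. Qed.

Let Xp_weight : weight_ge lamt (- lamt) Xp.
Proof.
move=> k; rewrite coef_poly; case: ifP => _; last exact: rord_ge0r.
by rewrite addrC; exact: crit_lamt.
Qed.

Let E_weight : weight_ge lamt (- lamt) E.
Proof.
apply: weight_geD; last first.
  apply: weight_geN => k; rewrite coefZ coefX.
  case: eqP => [->|_]; last by rewrite mulr0; exact: rord_ge0r.
  by rewrite mulr1 mul1r addNr; exact: (ord_ge_rord _ (ord_ge_Zp om')).
rewrite /comp_tail big_nat_cond; apply: weight_ge_sum => k /andP[/andP[k1 _] _].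
apply: weight_geW (weight_geZ (lin_lamt k1) (weight_geX k Xp_weight)).
by rewrite -subn1 natrB// mulrN; lra.
Qed.

Lemma trunc_comp : (trunc K)^`() \Po Xp = slope0%:P + P ^ a *: (om'%:Qp *: 'X + E).
Proof.
have -> : om'%:Qp *: 'X + E = comp_tail 1 lin_coef K Xp by rewrite addrC subrK.
have -> : (trunc K)^`() = \poly_(k < K) (ps_deriv f k * P ^ (- w)).
  by apply/polyP => k; rewrite trunc_deriv coef_poly.
rewrite poly_def (rmorph_sum (comp_poly _)).
rewrite -(big_mkord xpredT (fun k => ((ps_deriv f k * P ^ (- w)) *: 'X^k) \Po Xp)).
rewrite big_ltn ?(ltnW K1)// expr0 alg_polyC comp_polyC; congr (_ + _).
rewrite scaler_sumr big_nat_cond [RHS]big_nat_cond; apply: eq_bigr => k /andP[/andP[k1 _] _].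
rewrite [LHS]comp_polyZ comp_Xn_poly scalerA ps_derivS//; congr (_ *: _).
by rewrite mulrC mulrA -padic_expzD; congr (P ^ _ * _); lia.
Qed.

(** The truncated critical value. Its derivative identifies it with p^(-w) [transform] up to degree
    K; beyond that both are negligible. *)
Let W : {poly Qp} := trunc K \Po Xp - (slope0%:P + (om'%:Qp * P ^ a) *: 'X) * Xp.

Let W_deriv : W^`() = P ^ a *: (E * Xp^`()) - (om'%:Qp * P ^ a) *: Xp.
Proof.
by rewrite /W (critical_value_deriv trunc_comp).
Qed.

Let W_low j : (j <= K)%N -> W`_j = P ^ (- w) * transform j.
Proof.
case: j => [_|j jK].
  have Xp0 : Xp.[0] = 0.
    by rewrite horner_coef0 coef_poly inverse_coef0; case: ifP.
  rewrite -horner_coef0 /W hornerD hornerN hornerM horner_comp Xp0 mulr0 subr0.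
  by rewrite horner_coef0 coef_poly /= mulrC.
apply: (mulIf (_ : j.+1%:R != 0 :> Qp)); first by rewrite padic_natr_eq0.
rewrite mulr_natr -coef_deriv W_deriv coefB !coefZ.
rewrite (@coef_dvdpXn _ K) ?dvdp_mulr// mulr0 sub0r coef_poly jK /transform.
rewrite -[RHS]mulrA divfK ?padic_natr_eq0// [P ^ (w + a)]padic_expzD.
have := padic_expzNr p_pr w; rewrite /crit.
move: (inverse_coef _ _ _) (P ^ w) (P ^ (- w)) (P ^ a) => c A A' B AA.
have -> : A' * (- om'%:Qp * (A * B) * c) = (A' * A) * (- (om'%:Qp * B) * c) by ring.
by rewrite AA mul1r mulNr.
Qed.

(** Recovering W from its derivative divides by j + 1, which is why [Kbig] contains v_p(j + 1). *)
Let W_high j : (K <= j)%N -> ord_ge (n%:Z - w) W`_j.+1.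
Proof.
move=> Kj; have -> : W`_j.+1 = (W^`())`_j / j.+1%:R.
  by rewrite coef_deriv -[W`__ *+ _]mulr_natr mulfK// padic_natr_eq0.
rewrite W_deriv coefB !coefZ coef_poly ltnNge Kj /= mulr0 subr0 -mulrA.
have dX : weight_ge lamt 0 Xp^`().
  move=> k; rewrite coef_deriv -[_ *+ k.+1]mulr_natl; apply: rord_geMZp; first exact: ord_ge_nat.
  by apply: rord_geW (Xp_weight k.+1); rewrite -natr1 mulrDl mul1r; lra.
have H := rord_geM (weight_geM E_weight dX j) (ord_ge_rord (lexx _) (ord_ge_invn p_pr (ltn0Sn j))).
have := rord_geMZp (ord_geW (ltW a0) (ord_ge_expz p_pr a)) H.
apply: rord_ge_ord; have := Kbig Kj; rewrite mulrNz -pmulrn; lra.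
Qed.

Let x_int : ord_ge 0 x.
Proof.
apply: ord_ge_horner; last exact: ord_ge_Zp.
case=> [|k]; first by rewrite coef_poly inverse_coef0; case: ifP => _; exact: ord_ge0r.
rewrite coef_poly; case: ifP => _; last exact: ord_ge0r.
apply: (rord_ge_ord _ (crit_lamt k.+1)).
have : 0 <= k%:R * lamt by rewrite mulr_ge0// ltW.
by rewrite -natr1 mulrDl mul1r; lra.
Qed.

Lemma phase_deriv_crit : ord_ge (n%:Z - w) (phase K s)^`().[x].
Proof.
rewrite derivB derivZ derivX hornerD hornerN hornerZ hornerC mulr1.
rewrite -horner_comp trunc_comp hornerD hornerC !hornerZ hornerD hornerZ hornerX.
have -> : slope0 + P ^ a * (om'%:Qp * t%:Qp + E.[t%:Qp]) - s = P ^ a * E.[t%:Qp].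
  by move: (P ^ a) (E.[_]) => A e'; ring.
apply: ord_geZpM; first exact: ord_geW (ltW a0) (ord_ge_expz p_pr a).
apply: ord_ge_horner; last exact: ord_ge_Zp.
move=> k; case: (ltnP k K) => Kk.
  by rewrite (coef_dvdpXn E_dvd Kk); exact: ord_ge0r.
apply: (rord_ge_ord _ (E_weight k)); have := Kbig Kk.
have : (0 : R) <= (logn p k.+1)%:R by [].
by lra.
Qed.

Lemma transform_crit : ord_ge n%:Z (ps_eval transform t%:Qp - P ^ w * (phase K s).[x]).
Proof.
have tK i : (K < i)%N -> ord_ge n%:Z (transform i).
  case: i => // i Ki; apply: (rord_ge_ord _ (transform_ord (Kbig Ki))).
  rewrite -intrD (_ : w + a + (n%:Z - w) = n%:Z + a); last by lia.
  by rewrite intrD; have := a0; rewrite -(ltr_int R); lra.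
have H := ps_eval_trunc transform_scaled (ord_ge_Zp t) tK.
have Wx : (phase K s).[x] = W.[t%:Qp].
  rewrite /phase /W hornerD hornerN hornerZ hornerX hornerD hornerN hornerM horner_comp.
  by rewrite hornerD hornerC hornerZ hornerX mulrA.
rewrite Wx -(subrK (\sum_(i < K.+1) transform i * t%:Qp ^+ i) (ps_eval _ _)) -addrA.
apply: ord_geD => //; rewrite (@horner_coef_wide _ (maxn K.+1 (size W))) ?leq_maxr//.
rewrite -(big_mkord xpredT (fun i => transform i * t%:Qp ^+ i)).
rewrite -(big_mkord xpredT (fun i => W`_i * t%:Qp ^+ i)).
rewrite [X in _ - _ * X](big_cat_nat (n := K.+1))//= ?leq_maxl// mulrDr opprD addrA.
have -> : \sum_(0 <= i < K.+1) transform i * t%:Qp ^+ i =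
    P ^ w * \sum_(0 <= i < K.+1) W`_i * t%:Qp ^+ i.
  rewrite mulr_sumr big_nat_cond [RHS]big_nat_cond; apply: eq_bigr => i /andP[/andP[_ iK] _].
  rewrite W_low// mulrA; congr (_ * _); rewrite mulrA.
  by have := padic_expzNr p_pr (- w); rewrite opprK => ->; rewrite mul1r.
rewrite subrr sub0r; apply: ord_geN; apply/ord_ge_expzM.
rewrite big_nat_cond; apply: ord_ge_sum => -[//|i] /andP[/andP[Ki _] _].
apply: ord_geMZp; first exact: W_high.
by apply: ord_geX; exact: ord_ge_Zp.
Qed.

Lemma crit_center : exists r : nat,
  ord_ge (n%:Z - w) (phase K s)^`().[r%:R] /\
  e ((phase K s).[r%:R] / P ^+ N) = e (ps_eval transform t%:Qp / P ^ n%:Z).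
Proof.
(* The sum can only be recentred at a natural number. Replacing x by r changes the phase by a
   multiple of p^(n-w), since its derivative at x already vanishes modulo p^(n-w). *)
have [r rP] := padic_approx_nat N.+1 x_int.
have coefs k : ord_ge 0 (phase K s)^`()`_k.
  case: k => [|k].
    rewrite phase_deriv0 1?ltnW// opprD addrA subrr sub0r; apply: ord_geN.
    apply: ord_geZpM; first exact: ord_ge_Zp.
    by apply: ord_geW (ltW a0) _; apply: ord_geMZp; [exact: ord_ge_expz|exact: ord_ge_Zp].
  rewrite phase_deriv_coef//; apply: ord_geZpM; first by apply: ord_geX; exact: ord_ge_nat.
  by case: ifP => _; [exact: lin_int|exact: ord_ge0r].
have NS : n%:Z - w <= N.+1%:Z by rewrite -NE; lia.
exists r; split.
  rewrite -(subrK (phase K s)^`().[x] (phase K s)^`().[r%:R]).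
  apply: ord_geD; last exact: phase_deriv_crit.
  apply: ord_geW NS _; apply: ord_ge_horner_sub => //; first exact: ord_ge_nat.
  by rewrite -[r%:R - _]opprB; exact: ord_geN.
have [z zE] : exists z : Zp, r%:R = x + P ^+ N.+1 * z%:Qp.
  by case: rP => z zE; exists (- z); rewrite rmorphN mulrN exprnP -zE opprB addrC subrK.
have Xr : ord_ge (n%:Z - w) ((phase K s).[r%:R] - (phase K s).[x]).
  have := poly_taylor1 (ltn0Sn N) (fun k _ => coefs k) x_int (ord_ge_Zp z).
  rewrite -zE => H; have p2 : (p == 2%N)%:Z <= 1 by case: (p == 2%N).
  have D0 : ord_ge (n%:Z - w) ((phase K s)^`().[x] * (P ^+ N.+1 * z%:Qp)).
    apply: ord_geMZp; first exact: phase_deriv_crit.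
    by apply: ord_geZpM; [apply: ord_geX; exact: ord_ge_nat|exact: ord_ge_Zp].
  have {}H := ord_geW (_ : n%:Z - w <= _) H.
  have spl (D A B : Qp) : A - B = (A - (B + D)) + D by ring.
  rewrite (spl ((phase K s)^`().[x] * (P ^+ N.+1 * z%:Qp))).
  apply: ord_geD D0; apply: H.
  by move: p2; rewrite -NE -addnn PoszD; lia.
apply: eq_padic_e; have := transform_crit; move: Xr.
move: ((phase K s).[r%:R]) ((phase K s).[x]) (ps_eval _ _) => A B C AB BC.
rewrite exprnP NE !invr_expz.
have -> : A * P ^ (- (n%:Z - w)) - C * P ^ (- n%:Z) =
    P ^ (- (n%:Z - w)) * (A - B) - P ^ (- n%:Z) * (C - P ^ w * B).
  rewrite opprB [w - n%:Z]addrC padic_expzD.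
  by move: (P ^ w) (P ^ (- n%:Z)) => D D'; ring.
apply: ord_geB; first by apply/ord_ge_expzM; rewrite sub0r opprK.
by apply/ord_ge_expzM; rewrite sub0r opprK.
Qed.

End Evaluation.

Local Notation L := (N - av)%N.
Local Notation sqrtp := (real_complex R (Num.sqrt p%:R)).

Lemma hat_e_on (b : Qp) (t : Zp) :
  (if odd L then [/\ ord_ge (1 + (p == 2%N)%:Z) (lin_coef 1 - b),
      forall i, (1 < i)%N -> ord_ge (1 + (p == 2%N)%:Z) (lin_coef i *+ i)
    & L = 1%N -> forall k i, (1 < k)%N -> (k <= i)%N ->
        ord_ge (1 + (logn p k.+1)%:Z) (lin_coef i)]
   else p = 2%N -> [/\ (2 < L)%N, forall i, (1 < i)%N -> ord_ge (i.-1)%:Z (lin_coef i),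
      ord_ge 3 (lin_coef 1 - b) & forall i, (1 < i)%N -> ord_ge 3 (lin_coef i *+ i)]) ->
  hat_e R f w n (slope0 + om'%:Qp * (P ^ a * t%:Qp)) =
  gauss_factor R (odd L) b * ((p ^ av)%:R * sqrtp ^+ L) *
    e (ps_eval transform t%:Qp / P ^ n%:Z).
Proof.
move=> cond; have [K1 K1P] := f_small; have [K2 K2P] := logn_growth p_pr (n%:Z - w)%:~R lamt0.
pose K := maxn 2 (maxn K1 K2).
have Kgt1 : (1 < K)%N by rewrite leq_max.
have Kbig j : (K <= j)%N -> (n%:Z - w)%:~R + (logn p j.+1)%:R <= j%:R * lamt - lamt.
  by move=> Kj; apply: K2P; apply: leq_trans Kj; rewrite !leq_max leqnn !orbT.
rewrite (@hat_e_phase K) => [|i]; last by apply: K1P; rewrite !leq_max leqnn orbT.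
have [r [Qr <-]] := crit_center t Kgt1 Kbig.
set Q := phase K _ in Qr *.
(* The truncated phase has these coefficients; the zeros from K on satisfy every order condition. *)
pose be i := if (i < K)%N then lin_coef i else 0.
have [v vu vE] := lin_coef1.
have be1 : be 1%N = v%:Qp by rewrite /be Kgt1.
have NL : N = (L + av)%N by rewrite subnK//; move: NE avE na; lia.
rewrite -NE {1}NL in Qr.
have beP (Z : Qp -> Prop) i : Z 0 -> Z (lin_coef i) -> Z (be i) by rewrite /be; case: ifP.
have bek i : (1 < i)%N -> ord_ge 1 (be i).
  move=> i1; apply: beP; first exact: ord_ge0r.
  apply: (rord_ge_ord _ (lin_lamt (ltnW i1))).
  have : lamt <= i.-1%:R * lamt by rewrite ler_peMl ?(ltW lamt0)// (ler_nat R 1); lia.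
  by move: lamt0; lra.
have L0 : (0 < L)%N by move: NE avE na; lia.
have Qbe i : (0 < i)%N -> Q^`()`_i = P ^+ av * be i by exact: phase_deriv_coef.
have := stationary_phase R L0 vu be1 Qbe bek Qr (b := b); rewrite -NL; apply.
rewrite -vE; case: (odd L) cond => [[c1 c2 c3]|cond p2].
  split=> // [i i1|L1 k i k1 ki].
    by apply: (beP (fun z => ord_ge _ (z *+ i))); [rewrite mul0rn; exact: ord_ge0r|exact: c2].
  by apply: beP; [exact: ord_ge0r|exact: c3].
have [c1 c2 c3 c4] := cond p2; split=> // i i1.
  by apply: beP; [exact: ord_ge0r|exact: c2].
by apply: (beP (fun z => ord_ge _ (z *+ i))); [rewrite mul0rn; exact: ord_ge0r|exact: c4].
Qed.

End Transform.

(** * Conditions at small primes *)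

Lemma iotap_nat p (k : nat) : iotap p k%:R = (logn p k)%:Z.
Proof.
rewrite /iotap /ordq (_ : k%:R = k%:Z%:~R)// numq_int denq_int.
by rewrite /= logn1 subr0; apply/max_idPr.
Qed.

Lemma iotap_prime p q : prime q -> iotap p q%:R = (p == q)%:Z.
Proof. by move=> q_pr; rewrite iotap_nat logn_prime// eq_sym. Qed.

Lemma logn_leq_sub3 p n : prime p -> (3 < n)%N -> (p == 2%N) ==> (4 < n)%N ->
  (logn p n + 3 <= n)%N.
Proof.
move=> p_pr n3 n4; have n0 : (0 < n)%N by lia.
have H := expn_logn_leq p n0; have p1 := prime_gt1 p_pr.
have [v|] := leqP (logn p n) 2.
  move: v n4 H; case: (logn p n) => [|[|[|//]]] _; lia.
move=> v3; have : (2 ^ logn p n <= p ^ logn p n)%N by rewrite leq_exp2r //; lia.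
have : (logn p n + 3 <= 2 ^ logn p n)%N.
  move: v3; elim: (logn p n) => // k IH; rewrite ltnS leq_eqVlt => /predU1P[<- //|].
  by move=> /IH; rewrite expnS; lia.
by lia.
Qed.

Lemma logn_mul_leq p k : prime p -> (p.-1 * logn p k.+1 <= k)%N.
Proof.
move=> p_pr; have H := expn_logn_leq p (ltn0Sn k); have p1 := prime_gt1 p_pr.
suff : (p.-1 * logn p k.+1 < p ^ logn p k.+1)%N by lia.
elim: (logn p k.+1) => [|v IH]; first by rewrite muln0 expn0.
rewrite expnS; have : (0 < p ^ v)%N by rewrite expn_gt0; lia.
by move: (p ^ v)%N IH => q; nia.
Qed.

Section Conditions.
Variables (R : realType) (p : nat) (p_pr : prime p).
Local Notation Zp := (padic_int p_pr).
Local Notation Qp := (padic p_pr).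
Local Notation P := (p%:R : Qp).
Variables (w : int) (y : rat) (kappa : nat) (lam : R) (u : nat) (om om' : Zp).
Variables (f : nat -> Qp) (gamma0 : Zp) (g : nat -> Qp) (n : nat).
Hypothesis dec : F_decomp w y kappa lam u%:Z om om' f gamma0 g.
Hypothesis size_lb : kappa%:Z + iotap p y < Num.min (n%:Z - w) (u%:Z + Num.floor lam).
Local Notation a := (iotap p y + kappa%:Z).
Local Notation main := (main_coef y kappa om om').
Local Notation pertC := (pert y kappa u g).
Local Notation lin := (lin_coef y kappa u om om' g).
Local Notation L := (absz (n%:Z - w) - absz a)%N.

Let y0 : 0 < y. Proof. by case: dec => -[]. Qed.
Let kappa0 : (0 < kappa)%N. Proof. by case: dec => -[[]]. Qed.
Let kappa2 : p = 2%N -> (1 < kappa)%N.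
Proof.
move=> p2; case: dec => -[[_ H] _ _ _ _] _ _ _; move: H.
by rewrite (@iotap_prime p 2)// p2; lia.
Qed.
Let LE : L%:Z = n%:Z - w - a.
Proof. by move: size_lb kappa0; rewrite /iotap; lia. Qed.
Let L0 : (0 < L)%N.
Proof. by have := LE; move: size_lb; lia. Qed.

(** n - w + a and L = n - w - a have the same parity; subtracting iota'(2) in [parity] interchanges
    the two cases when p = 2. *)
Lemma odd_parity : odd L = ((p == 2%N) == (parity p w n y kappa == 0)).
Proof.
have -> : parity p w n y kappa = ((L%:Z - (p == 2%N)%:Z) %% 2)%Z.
  rewrite /parity (@iotap_prime p 2)// LE.
  rewrite -[RHS](modzMDl a); congr (modz _ _); lia.
by move: (L) => l; case: (p == 2%N) => /=; lia.
Qed.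

Local Notation lamt := (Num.min (kappa%:R - rho_at p R y) lam).
Hypothesis lamt0 : 0 < lamt.
Hypothesis small_cond : (p == 2%N) || (p == 3%N) -> small_prime_cond p w n y kappa.

Let rho1 : p = 2%N -> rho p R = 1.
Proof. by move=> ->; rewrite /rho (_ : 2%:R - 1 = 1) ?invr1//; ring. Qed.
Let p1 : 0 < p%:R - 1 :> R.
Proof. by rewrite subr_gt0 (ltr_nat R 1); exact: prime_gt1. Qed.
Let rho0 : 0 < rho p R. Proof. by rewrite invr_gt0. Qed.
Let rhoE : (p.-1)%:R * rho p R = 1.
Proof. by rewrite -subn1 natrB ?prime_gt0// mulfV// gt_eqF. Qed.
Let lam_rho : rho p R <= lam.
Proof.
by case: dec => -[_ _ [j j0 ->] _ _] _ _ _; apply: ler_peMl; rewrite ?(ltW rho0) ?(ler_nat R 1).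
Qed.
Let lamt1 : p = 2%N -> 1 <= lamt.
Proof.
move=> p2; have := lam_rho; rewrite rho1// le_min => ->; rewrite andbT /rho_at.
have : (2%:R : R) <= kappa%:R by rewrite ler_nat; exact: kappa2.
by rewrite rho1//; case: ifP => _; lra.
Qed.

Let lin_ord2 i : p = 2%N -> (0 < i)%N -> ord_ge i.-1%:Z (lin i).
Proof.
move=> p2 i0; apply: (rord_ge_ord _ (lin_lamt dec size_lb lamt0 i0)).
rewrite -pmulrn; have : (i.-1%:R : R) <= i.-1%:R * lamt by rewrite ler_peMr// lamt1.
lra.
Qed.

Let pert_int m i : (0 < i)%N -> m%:~R < 2 + i.-1%:R * lam -> ord_ge m (pertC i).
Proof.
move=> i0 mi; apply: (rord_ge_ord _ (pert_ord dec i0)).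
have : (1 : R) <= (u%:Z + Num.floor lam - a)%:~R by rewrite (ler_int R 1); lia.
by lra.
Qed.

Let pert_ord2 i : p = 2%N -> (0 < i)%N -> ord_ge i%:Z (pertC i).
Proof.
move=> p2 i0; apply: pert_int => //; rewrite -pmulrn.
have : (i.-1%:R : R) <= i.-1%:R * lam.
  by rewrite ler_peMr//; have := lam_rho; rewrite rho1.
by have -> : i%:R = i.-1%:R + 1 :> R; [rewrite natr1 prednK|lra].
Qed.

Let main3 : p = 2%N -> ord_ge 3 (main 3).
Proof.
move=> p2; have := main_coef_ord_fact y kappa om om' (ltn0Sn 2); apply: ord_geW.
by rewrite p2; have := kappa2 p2; have -> : logn 2 3`! = 1%N by []; lia.
Qed.

Let ordMn2 m x : p = 2%N -> ord_ge m x -> ord_ge (1 + m) (x *+ 2 : Qp).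
Proof.
move=> p2 H; rewrite -[x *+ 2]mulr_natl (_ : 2%:R = P); last by congr (_%:R).
apply: ord_geM => //.
exact: (ord_ge_expz p_pr 1).
Qed.

(** For L = 1 the terms of degree k + 1 >= 3, with coefficients of the shape b_i/(k + 1), must be
    divisible by p on their own. For p = 2 this follows from kappa >= 2 and for p >= 5 from rho_p <=
    1/4; p = 3 takes [small_prime_cond]. *)
Lemma lin_far k i : L = 1%N -> odd L -> (1 < k)%N -> (k <= i)%N ->
  ord_ge (1 + (logn p k.+1)%:Z) (lin i).
Proof.
move=> L1 oddL k1 ki; have i0 : (0 < i)%N by lia.
have pk := logn_mul_leq k p_pr; have pk2 := logn_leq_sub2 p_pr (k1 : (2 < k.+1)%N).
have par := odd_parity; rewrite oddL in par.
have n1 : n%:Z - w - kappa%:Z - iotap p y - 1 = 0 by move: LE; rewrite L1; lia.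
apply: ord_geD; last first.
  apply: pert_int => //; rewrite intrD -pmulrn.
  suff : (logn p k.+1)%:R < 1 + i.-1%:R * rho p R.
    by have := ler_wpM2l (ler0n R i.-1) lam_rho; lra.
  rewrite -(ltr_pM2l p1); set q := p%:R - 1.
  have qE : q = p.-1%:R by rewrite /q -subn1 natrB ?prime_gt0.
  have -> : q * (1 + i.-1%:R * rho p R) = q + i.-1%:R * (q * rho p R) by ring.
  rewrite qE rhoE mulr1 -natrM -natrD ltr_nat.
  case: (eqVneq p 2%N) pk pk2 => [->|p2]; first by rewrite mul1n; lia.
  have : (2 < p)%N by have := prime_gt1 p_pr; lia.
  by lia.
have [p2|p2] := eqVneq p 2%N.
  have H := main_coef_ord_fact y kappa om om' i0; have k2 := kappa2 p2.
  (* For i = k = 3 the required order is 3, as v_2(4) = 2, while the generic bound i - 1 gives only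
     2. *)
  have [i3|i3] := eqVneq i 3.
    by rewrite i3; apply: ord_geW (main3 p2); move: pk2; lia.
  have fi := logn_fact_leq p_pr i0; apply: ord_geW H.
  have : ((i.-1).*2 <= i.-1 * kappa)%N by rewrite -muln2 leq_mul2l k2 orbT.
  have [k3|k3] := leqP k 3.
    have : (logn p k.+1 <= 2)%N by lia.
    have : (i = 2%N) \/ (3 < i)%N by lia.
    case=> [i2|]; last by rewrite p2 in fi *; lia.
    have -> : k = 2%N by lia.
    by rewrite p2 i2 /= in fi *; rewrite (_ : logn 2 3 = 0%N)//; lia.
  have := @logn_leq_sub3 p k.+1 p_pr; rewrite p2 in fi * => /(_ _ _).
  by move=> /(_ ltac:(lia) ltac:(lia)); lia.
have [p3|p3] := eqVneq p 3%N.
  have [] := small_cond; first by rewrite p3.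
  have p3' : p == 3%N by rewrite p3.
  rewrite (@iotap_prime p 2)// (@iotap_prime p 3)// n1 (negPf p2) p3' /=.
  have pa : 1 <= parity p w n y kappa.
    by move: par; rewrite (negPf p2) /parity; lia.
  move=> _ _ cond.
  (* With n1 = 0 and parity 1, [cond] says kappa + iota'(y + 1) >= 2, which is what the denominator
     3 of the cubic term demands. *)
  have [i2|i2] := eqVneq i 2%N.
    have -> : k = 2%N by lia.
    rewrite i2; apply: ord_geW (main_coef2_ord kappa om om' y0).
    have -> : logn p 3 = 1%N by rewrite p3.
    have -> : logn p 2 = 0%N by rewrite p3.
    by lia.
  have [oy|oy] := eqVneq (ordq p y) 0.
    apply: ord_geW (main_coef_ord_unit kappa om om' oy i0).
    have : (i.-1 <= i.-1 * kappa)%N by rewrite leq_pmulr.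
    have [k2|k2] := leqP k 2; first by move: pk2; lia.
    have := @logn_leq_sub3 p k.+1 p_pr; rewrite (negPf p2) => /(_ k2 isT); lia.
  (* Here iota'(y + 1) = 0, so [cond] forces kappa >= 2, and the weight is at least 2 - 1/2. *)
  have a1 := iotap_add1 p_pr y0 oy.
  apply: (rord_ge_ord _ (main_coef_weight R y kappa om om' i0)).
  rewrite /rho_at oy intrD -pmulrn.
  have kap2 : (2%:R : R) <= kappa%:R by rewrite ler_nat; move: cond; rewrite a1; lia.
  have r2 : rho p R = 2^-1 by rewrite /rho p3; congr (_^-1); ring.
  have H : (2 * logn p k.+1)%:R <= (i%:R : R) by rewrite ler_nat; move: pk; rewrite {1}p3; lia.
  rewrite natrM in H.
  have i3 : (3%:R : R) <= i%:R by rewrite ler_nat ltn_neqAle eq_sym i2 (leq_trans k1).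
  have := ler_wpM2l (ler0n R i.-1) kap2; rewrite r2 mulrBr -subn1 natrB//; lra.
have p5 : (4 < p)%N.
  by move: p_pr p2 p3; clear; case: p => [|[|[|[|[|q]]]]].
apply: (rord_ge_ord _ (main_coef_weight R y kappa om om' i0)).
have r4 : rho p R <= 4^-1.
  by rewrite /rho lef_pV2 ?posrE// lerBrDr natr1 ler_nat.
have kap1 : (1%:R : R) <= kappa%:R by rewrite ler_nat.
have rr : 1 - rho p R <= kappa%:R - rho_at p R y.
  by rewrite /rho_at; case: ifP => _; have := rho0; lra.
have := ler_wpM2l (ler0n R i.-1) rr.
have H : (logn p k.+1)%:R <= i%:R * rho p R.
  rewrite -(ler_pM2l p1); set q := p%:R - 1.
  have qE : q = p.-1%:R by rewrite /q -subn1 natrB ?prime_gt0.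
  have -> : q * (i%:R * rho p R) = i%:R * (q * rho p R) by ring.
  rewrite qE rhoE mulr1 -natrM ler_nat; exact: leq_trans pk ki.
have i2 : (2%:R : R) <= i%:R by rewrite ler_nat (leq_trans k1).
rewrite intrD -pmulrn -subn1 natrB//; move: H i2 r4; move: (rho p R) => r H i2 r4.
have : 0 <= (i%:R - 1 : R) * (4^-1 - r) by rewrite mulr_ge0 ?subr_ge0//; lra.
rewrite mulr1z; lra.
Qed.

(** For odd p the Gauss factor sees b_1 only modulo p, where the share of g disappears; for p = 2
    precision 4 or 8 is needed, so that share is kept in [b]. *)
Lemma lin_cond (b : Qp := main 1 + (if p == 2%N then pertC 1 else 0)) :
  if odd L then [/\ ord_ge (1 + (p == 2%N)%:Z) (lin 1 - b),
      forall i, (1 < i)%N -> ord_ge (1 + (p == 2%N)%:Z) (lin i *+ i)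
    & L = 1%N -> forall k i, (1 < k)%N -> (k <= i)%N ->
        ord_ge (1 + (logn p k.+1)%:Z) (lin i)]
   else p = 2%N -> [/\ (2 < L)%N, forall i, (1 < i)%N -> ord_ge (i.-1)%:Z (lin i),
      ord_ge 3 (lin 1 - b) & forall i, (1 < i)%N -> ord_ge 3 (lin i *+ i)].
Proof.
have lin1 : p = 2%N -> lin 1 - b = 0.
  by move=> /eqP p2; rewrite /b p2 subrr.
have par := odd_parity.
case: ifPn par => [oddL _|_ par].
  split.
  - have [/eqP/lin1 ->|p2] := boolP (p == 2%N); first exact: ord_ge0r.
    rewrite /b (negPf p2) !addr0 /lin_coef addrAC subrr add0r; apply: pert_int => //.
    by rewrite /= mul0r; lra.
  - move=> i i1; have [/eqP p2|p2] := boolP (p == 2%N).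
      have := lin_ord2 p2 (ltnW i1).
      have [->|i2] := eqVneq i 2%N; first exact: ordMn2.
      by move=> H; apply: ord_geMn; apply: ord_geW H; lia.
    apply: ord_geMn; apply: (rord_ge_ord _ (lin_lamt dec size_lb lamt0 (ltnW i1))).
    have : 0 < i.-1%:R * lamt by rewrite mulr_gt0// ltr0n; lia.
    by rewrite addr0; lra.
  - by move=> L1 k i k1 ki; exact: lin_far.
move=> p2; have [] := small_cond; first by rewrite p2.
move: (introT eqP p2) => p2b; rewrite p2b in par.
rewrite (@iotap_prime p 2)// p2b.
have pa : parity p w n y kappa = 1 by move: par; rewrite /parity; lia.
rewrite pa /= => c1 c2 _; have k2 := kappa2 p2; split.
(* With nu = 1, [c2] reads L - 1 >= 2. *)
- by move: LE c2; lia.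
- by move=> i i1; apply: lin_ord2 => //; exact: ltnW.
- by rewrite lin1//; exact: ord_ge0r.
(* With nu = 1, [c1] gives kappa + iota'(y + 1) >= 3; the denominator 2 in the quadratic coefficient
   leaves order 2, and the multiple 2 b_2 regains 3. *)
move=> i i1; have [i2|i2] := eqVneq i 2%N.
  rewrite i2; apply: (ordMn2 (m := 2)) => //; apply: ord_geD; last exact: pert_ord2.
  apply: ord_geW (main_coef2_ord kappa om om' y0).
  have -> : logn p 2 = 1%N by rewrite p2.
  by move: c1; lia.
apply: ord_geMn; have [i3|i3] := eqVneq i 3%N.
  by rewrite i3; apply: ord_geD; [exact: main3|exact: pert_ord2].
by apply: ord_geW (lin_ord2 p2 (ltnW i1)); lia.
Qed.

End Conditions.

Lemma small_prime_cond_large (w : int) (p n : nat) (y : rat) (kappa : nat) :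
  (p == 2%N) || (p == 3%N) -> (0 < kappa)%N ->
  (1 + iotap p 4 <= kappa%:Z
        /\ iotap p y + kappa%:Z + iotap p 12 < n%:Z - w) \/
     (1 + iotap p 12 <= kappa%:Z
        /\ iotap p y + kappa%:Z + iotap p 4 < n%:Z - w) ->
  small_prime_cond p w n y kappa.
Proof.
move=> p23 kappa0; rewrite (iotap_nat p 4) (iotap_nat p 12) => H.
have y1 : 0 <= iotap p (y + 1) by rewrite /iotap le_max lexx.
have pa : parity p w n y kappa = 0 \/ parity p w n y kappa = 1 by rewrite /parity; lia.
rewrite /small_prime_cond (@iotap_prime p 2)// (@iotap_prime p 3)//.
case/orP: p23 H => /eqP p23.
  have -> : logn p 4 = 2%N by rewrite p23.
  have -> : logn p 12 = 2%N by rewrite p23.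
  have [-> ->] : (p == 2%N) = true /\ (p == 3%N) = false by rewrite p23.
  by case: pa => ->; split; lia.
have -> : logn p 4 = 0%N by rewrite p23.
have -> : logn p 12 = 1%N by rewrite p23.
have [-> ->] : (p == 2%N) = false /\ (p == 3%N) = true by rewrite p23.
by case: pa => ->; split; lia.
Qed.

Lemma sqrt_powR (R : realType) (p L m : nat) (z : int) : z = (L + m.*2)%N%:Z ->
  (p ^ m)%:R * real_complex R (Num.sqrt p%:R) ^+ L =
  real_complex R (p%:R `^ (z%:~R / 2)).
Proof.
move=> ->; have -> : (p ^ m)%:R = real_complex R (p ^ m)%:R by rewrite rmorph_nat.
rewrite -rmorphXn -rmorphM; congr (real_complex R _).
rewrite [_ / 2]mulrC powRrM powR12_sqrt// -pmulrn powR_mulrn// exprD -mul2n exprM.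
rewrite sqr_sqrtr//.
by rewrite -natrX mulrC.
Qed.

(** * The unit epsilon and the data it depends on *)

Section UnitFactor.
Variables (R : realType) (p : nat) (p_pr : prime p).
Local Notation Zp := (padic_int p_pr).
Local Notation Qp := (padic p_pr).
Local Notation P := (p%:R : Qp).

(* [main_coef 1] does not depend on kappa, so any value will do. *)
Definition unit_factor (om om' : Zp) (y : rat) (nu : int) (xi : Qp) : R[i] :=
  gauss_factor R ((p == 2%N) == (nu == 0)) (main_coef y 0 om om' 1 + xi).

Lemma main_coef1_kappa kappa y (om om' : Zp) : 0 < y -> om \is a GRing.unit ->
  om' \is a GRing.unit -> main_coef y kappa om om' 1 = main_coef y 0 om om' 1.
Proof.
move=> y0 omu omu'; have [v _ [-> ->]] := main_coef1 kappa y0 omu omu'.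
by have [v' _ [-> ->]] := main_coef1 0 y0 omu omu'.
Qed.

Lemma pert1E y kappa u (g : nat -> Qp) :
  pert y kappa u g 1 = P ^ (u%:Z - kappa%:Z - iotap p y) * ps_deriv g 0.
Proof.
by rewrite /pert /ps_deriv mulr1n; congr (P ^ _ * _); rewrite opprD addrA addrAC.
Qed.

(** The factor with the [b] of [lin_cond] sees g only through p^(u - kappa - iota') g'(0), and only
    for p = 2. *)
Lemma unit_factorE kappa y u (om om' : Zp) nu (g : nat -> Qp) :
  0 < y -> om \is a GRing.unit -> om' \is a GRing.unit ->
  unit_factor om om' y nu
    (if p == 2%N then P ^ (u%:Z - kappa%:Z - iotap p y) * ps_deriv g 0 else 0) =
  gauss_factor R ((p == 2%N) == (nu == 0))
    (main_coef y kappa om om' 1 + (if p == 2%N then pert y kappa u g 1 else 0)).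
Proof.
move=> y0 omu omu'; rewrite /unit_factor (main_coef1_kappa kappa)//.
by rewrite pert1E.
Qed.

End UnitFactor.

Theorem lemma10 (R : realType) (p : nat) (p_pr : prime p) :
  (forall (w : int) (n : nat) (y : rat) (kappa : nat),
     (p == 2%N) || (p == 3%N) -> (0 < n)%N -> (0 < kappa)%N -> 0 < y ->
     (1 + iotap p 4 <= kappa%:Z
        /\ iotap p y + kappa%:Z + iotap p 12 < n%:Z - w) \/
     (1 + iotap p 12 <= kappa%:Z
        /\ iotap p y + kappa%:Z + iotap p 4 < n%:Z - w) ->
     small_prime_cond p w n y kappa) /\
  exists E : padic_int p_pr -> padic_int p_pr -> rat -> int -> padic p_pr -> R[i],
  forall (w : int) (y : rat) (kappa : nat) (lam : R) (u : nat)
         (om om' : padic_int p_pr) (f : nat -> padic p_pr)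
         (gamma0 : padic_int p_pr) (g : nat -> padic p_pr) (n : nat),
  F_decomp w y kappa lam u%:Z om om' f gamma0 g ->
  (0 < n)%N ->
  kappa%:Z + iotap p y < Num.min (n%:Z - w) (u%:Z + Num.floor lam) ->
  let lamt : R := Num.min (kappa%:R - rho_at p R y) lam in
  0 < lamt ->
  ((p == 2%N) || (p == 3%N) -> small_prime_cond p w n y kappa) ->
  let eps_lam : int := Num.floor lam - Num.ceil lamt in
  let gt0 : padic p_pr := ps_deriv f 0%N * p%:R ^ (- w) - om'%:Qp in
  let ft_w : int := w + ordq p y in
  let ft_u : int := u%:Z + eps_lam - ordq p y in
  let s_of (t : padic_int p_pr) : padic p_pr :=
    gt0 + om'%:Qp * (1 + p%:R ^ (iotap p y + kappa%:Z) * t%:Qp) in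
  let eps : R[i] :=
    E om om' y (parity p w n y kappa)
      (if p == 2%N
       then p%:R ^ (u%:Z - kappa%:Z - iotap p y) * ps_deriv g 0%N else 0) in
  ord_ge 0 gt0 /\
  exists ft : nat -> padic p_pr,
  [/\ F_class ft_w y^-1 kappa lamt ft_u 1 (- (om' * om^-1)) ft,
      exists2 h, tI0_lam lamt h &
        forall k, ps_deriv ft k = p%:R ^ (w + iotap p y + kappa%:Z) * h k,
      `|eps| = 1,
      forall t : padic_int p_pr,
        hat_e R f w n (s_of t) =
          eps * (real_complex R
                   (p%:R `^ ((n%:Z - w + iotap p y + kappa%:Z)%:~R / 2)))
              * padic_e R (ps_eval ft t%:Qp / p%:R ^ n%:Z)
    & forall s : padic_int p_pr,
        (forall t : padic_int p_pr, s%:Qp <> s_of t) -> hat_e R f w n s%:Qp = 0].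
Proof.
split=> [w n y kappa p23 _ kappa0 _|]; first exact: small_prime_cond_large.
exists (@unit_factor R p p_pr) => w y kappa lam u om om' f gamma0 g n dec _ size_lb lamt lamt0
  small_cond eps_lam gt0 ft_w ft_u s_of eps.
have y0 : 0 < y by case: dec => -[].
have omu : om \is a GRing.unit by case: dec => -[_ _ _ _ []].
have omu' : om' \is a GRing.unit by case: dec => -[_ _ _ _ []].
set P : padic p_pr := p%:R; set a : int := iotap p y + kappa%:Z.
have gt00 : ord_ge 0 gt0 by exact: slope0_int dec.
have s_ofE t : s_of t = slope0 w f + om'%:Qp * (P ^ a * t%:Qp).
  rewrite /s_of /gt0 -/P -/a /slope0; move: (_ * P ^ (- w)) (P ^ a) => A B; ring.
pose b : padic p_pr := main_coef y kappa om om' 1 + (if p == 2%N then pert y kappa u g 1 else 0).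
have epsE : eps = gauss_factor R (odd (`|n%:Z - w| - `|a|)%N) b.
  by rewrite (odd_parity dec size_lb); exact: unit_factorE.
split=> //; exists (transform w y kappa u om om' f g); split.
- exact: transform_class dec size_lb lamt0.
- exact: transform_deriv_tI0 dec size_lb lamt0.
- have [l lu lE] := lin_coef1 dec size_lb lamt0.
  rewrite epsE /b; case: (p == 2%N); first by rewrite -/(lin_coef _ _ _ _ _ _ 1) lE gauss_factor_norm.
  by have [v vu [vE _]] := main_coef1 kappa y0 omu omu'; rewrite addr0 vE gauss_factor_norm.
- move=> t; rewrite s_ofE (hat_e_on dec size_lb lamt0 t (lin_cond dec size_lb lamt0 small_cond)).
  rewrite -/b -epsE -(@sqrt_powR R p (`|n%:Z - w| - `|a|) `|a|)//.
  case: dec => -[[k0 _] _ _ _ _] _ _ _; move: size_lb k0; rewrite /a /iotap -addnn; lia.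
(* An equation slope0 - s = p^a z would give s = s_of(- z/om'), against the assumption on s. *)
- move=> s ns; apply: (hat_e_off dec size_lb lamt0 (ord_ge_Zp s)) => -[z zE].
  apply: (ns (- om'^-1 * z)); rewrite s_ofE rmorphM rmorphN/= padic_of_intV//.
  have om0 : om'%:Qp != 0.
    by apply/eqP => v0; apply: (ord_ge_unit1 omu'); rewrite v0; exact: ord_ge0r.
  have -> : om'%:Qp * (P ^ a * (- om'%:Qp^-1 * z%:Qp)) = - (om'%:Qp * om'%:Qp^-1 * (P ^ a * z%:Qp)).
    by move: (P ^ a) (om'%:Qp^-1) => A B; ring.
  by rewrite divff// mul1r -zE opprB addrC subrK.
Qed.
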